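(* Let $\Omega\subset\mathbb{R}^d$ be a bounded open set, and let $(\phi_n)$ be an orthogonal sequence in $C^\infty(\Omega;\mathbb{R})$ with $-h_n^2\Delta\phi_n=\phi_n$ in $\Omega$, $\phi_n|_{\partial\Omega}=0$, $\|\phi_n\|_{L^2(\Omega)}^2=\mathrm{Vol}(\Omega)$, where $h_n>0$, $h_n\to0$. If $\sigma_\Omega((\phi_n)_n)=\{\mu_{Berry}\}$, then $$\|\phi_n\|_{L^\infty(\Omega)}\underset{n\to+\infty}{\longrightarrow}+\infty.$$
   Context: $FP:=\{f\in C^\infty(\mathbb{R}^d;\mathbb{R}): -\Delta f=f\}$. For $k\in\mathbb{N}=\{0,1,2,\dots\}$, $\mathcal{H}^k$ is the space $C^k(\mathbb{R}^d)$ of real-valued functions with the metric $\boldsymbol{d}_k(f,g)=\inf\{\varepsilon>0:\|f-g\|_{C^k(B(0,\varepsilon^{-1}))}<\varepsilon\}$; it is a Polish space. $FP$ is closed in every $\mathcal{H}^k$, and all metrics $\boldsymbol{d}_k$ induce the same topology on $FP$, which is the topology used on $FP$. $\mathcal{C}_b(X)$ is the space of bounded real-valued continuous functions on $X$ with the sup norm. The condition $\phi_n|_{\partial\Omega}=0$ is the Dirichlet condition ($\phi_n$ is an eigenfunction of the Dirichlet Laplacian of $\Omega$, in $H^1_0(\Omega)$). Fix a decreasing function $\chi\in C_c^\infty([0,\infty);[0,1])$ equal to $1$ near the origin and vanishing outside $[0,1]$. For $x_0\in\Omega$ set $\tilde\phi_{x_0,n}(y):=\phi_n(x_0+h_ny)\,\chi\big(\frac{h_n|y|}{d(x_0,\partial\Omega)}\big)$,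 $y\in\mathbb{R}^d$ (understood as $0$ where the cutoff vanishes). For a Borel set $U\subset\Omega$ of positive Lebesgue measure, $LM_{k,U}(\phi_n):=\frac1{\mathrm{Vol}(U)}\int_U\delta_{\tilde\phi_{x_0,n}}\,dx_0$, a Borel probability measure on $\mathcal{H}^k$. Let $\iota_k:\mathcal{C}_b(FP)\to\mathcal{C}_b(\mathcal{H}^k)$ be a continuous linear map with $(\iota_kF)|_{FP}=F$ and $\|\iota_kF\|=\|F\|$ (such maps exist), and $LM^{\iota_k}_{k,U}(\phi_n)\in(\mathcal{C}_b(FP))^*$ be $F\mapsto\langle LM_{k,U}(\phi_n),\iota_kF\rangle$. The set of weak-* accumulation points of $(LM^{\iota_k}_{k,U}(\phi_n))_n$ consists of finite measures on $FP$ and does not depend on $k$ or $\iota_k$; it is denoted $\sigma_U((\phi_n)_n)$. $\Psi_{Berry}:\mathbb{R}^d\to\mathbb{R}$ is the centred stationary Gaussian field with covariance $\mathbb{E}[\Psi_{Berry}(x)\Psi_{Berry}(x')]=\int_{\mathbb{S}^{d-1}}e^{i(x-x')\cdot\theta}\,d\theta$, where $d\theta$ is the uniform probability measure on $\mathbb{S}^{d-1}$. Almost surely $\Psi_{Berry}\in FP$, and $\mu_{Berry}$ is its law, a Borel probability measure on $FP$. *)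

(* Defs.v *)
From HB Require Import structures.
From mathcomp Require Import all_boot all_order all_algebra.
From mathcomp Require Import all_classical all_reals all_analysis measurable_realfun.
From mathcomp.real_closed Require Import complex.

Set Implicit Arguments.
Unset Strict Implicit.
Unset Printing Implicit Defensive.

Import Order.TTheory GRing.Theory Num.Theory.
Import numFieldNormedType.Exports.

Local Open Scope classical_set_scope.
Local Open Scope ring_scope.

Notation borel T := (g_sigma_algebraType (@open T)).

Lemma open_borel (T : ptopologicalType) (A : set T) :
  open A -> measurable (A : set (borel T)).
Proof. exact: sub_gen_smallest. Qed.

Section borel_row_vector.
Context {R : realType}.

Lemma continuous_borel_measurable (T : ptopologicalType) (f : T -> R) :
  continuous f -> measurable_fun setT (f : borel T -> R).
Proof.
move=> /continuousP cf; apply: (measurability _ (RGenOpens.measurableE R)).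
move=> _ [_ [a [b ->] <-]]; rewrite setTI; apply: open_borel.
exact/cf/interval_open.
Qed.

Lemma measurable_coord n (i : 'I_n) :
  measurable_fun setT (fun v : borel 'rV[R]_n => (v : 'rV[R]_n) ord0 i).
Proof.
apply: (@continuous_borel_measurable 'rV[R]_n (fun v => v ord0 i)).
exact: coord_continuous.
Qed.

Section components.
Context dT (T : measurableType dT) (n : nat) (f : T -> 'rV[R]_n).
Hypothesis mf : forall i, measurable_fun setT (fun x => f x ord0 i).

Let preimage_ball (v : 'rV[R]_n) (r : R) : measurable (f @^-1` ball v r).
Proof.
have [r0|r0] := ltP 0 r; last first.
  rewrite (_ : _ @^-1` _ = set0); first exact: measurable0.
  by apply/seteqP; split => // x /= -[]; rewrite ltNge r0.
rewrite (_ : _ @^-1` _ =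
    \big[setI/setT]_(i < n) ((fun x => f x ord0 i) @^-1` ball (v ord0 i) r)).
  apply: bigsetI_measurable => i _; rewrite -[X in measurable X]setTI.
  by apply: mf => //; exact: measurable_ball.
apply/seteqP; split => x /=.
  move=> [_ fx]; elim/big_ind : _ => // i _; exact: fx.
move=> fx; split => // i j; rewrite (ord1 i).
by move: fx; rewrite (bigD1 j)//= => -[].
Qed.

Lemma measurable_row_vector :
  measurable_fun setT (f : T -> borel 'rV[R]_n).
Proof.
apply: (@measurability _ _ T (borel 'rV[R]_n) setT f (@open 'rV[R]_n) erefl) => _ [U oU <-]; rewrite setTI.
pose B (p : 'rV[rat]_n * rat) : set 'rV[R]_n :=
  ball (\row_i ratr (p.1 ord0 i) : 'rV[R]_n) (ratr p.2 : R).
pose F p := if pselect (B p `<=` U) then f @^-1` B p else set0.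
rewrite (_ : _ @^-1` _ = \bigcup_p F p).
  apply: countable_bigcupT_measurable => // p; rewrite /F.
  by case: pselect => ?; [exact: preimage_ball|exact: measurable0].
apply/seteqP; split => [x /= Ufx|x [p _]]; last first.
  by rewrite /F; case: pselect => [BU|//]; exact: BU.
move: oU; rewrite openE => /(_ _ Ufx)/nbhs_ballP[e /= e0 eU].
have /rat_in_itvoo[r /andP[r0 re]] : 0 < e / 2 by rewrite divr_gt0.
rewrite !bnd_simp in r0 re.
have /choice[q fq] : forall i, exists q : rat, `|f x ord0 i - ratr q| < ratr r.
  move=> i.
  have /rat_in_itvoo[q qr] : f x ord0 i - ratr r < f x ord0 i + ratr r.
    by rewrite ltrD2l gtrN.
  by exists q; rewrite distrC ltr_distl; exact: qr.
exists (\row_i q i, r) => //; rewrite /F.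
have rB : B (\row_i q i, r) (f x).
  split => // i j; rewrite (ord1 i) !mxE /ball/= distrC.
  exact: fq.
case: pselect => // -[] y By; apply: eU.
exact: (ball_splitr (le_ball (ltW re) rB) (le_ball (ltW re) By)).
Qed.

End components.

End borel_row_vector.

Section lebesgue_row_vector.
Context {R : realType}.

Definition consv n (p : R * 'rV[R]_n) : 'rV[R]_n.+1 := row_mx p.1%:M p.2.

Lemma measurable_consv n :
  measurable_fun setT (@consv n : R * borel 'rV[R]_n -> borel 'rV[R]_n.+1).
Proof.
apply: measurable_row_vector => i; rewrite /consv.
have [j ->|j ->] := split_ordP (i : 'I_(1 + n)).
  rewrite (_ : (fun _ => _) = fst); first exact: measurable_fst.
  by apply/funext => x; rewrite [LHS]row_mxEl mxE !ord1.
rewrite (_ : (fun _ => _) = (fun v : borel 'rV[R]_n => v ord0 j) \o snd).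
  exact: measurableT_comp (measurable_coord j) measurable_snd.
by apply/funext => x; rewrite [LHS]row_mxEr.
Qed.

Section step.
Context (n : nat) (m : {sigma_finite_measure set (borel 'rV[R]_n) -> \bar R}).

Let cons : measurableTypeR R * borel 'rV[R]_n -> borel 'rV[R]_n.+1 := @consv n.

Definition lebesgue_step : set (borel 'rV[R]_n.+1) -> \bar R :=
  pushforward (lebesgue_measure \x m)%E cons.

Let mcons : measurable_fun setT cons := @measurable_consv n.

Let step0 : lebesgue_step set0 = 0%E.
Proof. by rewrite /lebesgue_step /pushforward preimage_set0 measure0. Qed.

Let step_ge0 A : (0 <= lebesgue_step A)%E.
Proof. exact: measure_ge0. Qed.

Let step_sigma_additive : semi_sigma_additive lebesgue_step.
Proof.
have := @measure_semi_sigma_additive _ _ _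
  (measure_function_pushforward__canonical__measure_function_Measure
     (lebesgue_measure \x m)%E mcons).
exact.
Qed.

HB.instance Definition _ := isMeasure.Build _ _ _ lebesgue_step
  step0 step_ge0 step_sigma_additive.

Let step_sigma_finite : sigma_finite setT lebesgue_step.
Proof.
have /sigma_finiteP[F [TF ndF Foo]] :=
  sigma_finiteT (lebesgue_measure : set (measurableTypeR R) -> \bar R).
have /sigma_finiteP[G [TG ndG Goo]] := sigma_finiteT m.
have TFG : \bigcup_k (F k `*` G k) = setT.
  apply/seteqP; split => // -[x y] _.
  have : (\bigcup_k F k) x by rewrite -TF.
  have : (\bigcup_k G k) y by rewrite -TG.
  move=> [j _ Gy] [i _ Fx]; exists (maxn i j) => //; split => /=.
  - by move: x Fx; exact/subsetPset/ndF/leq_maxl.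
  - by move: y Gy; exact/subsetPset/ndG/leq_maxr.
pose uncons (v : borel 'rV[R]_n.+1) : measurableTypeR R * borel 'rV[R]_n :=
  ((v : 'rV[R]_n.+1) ord0 ord0, \row_j (v : 'rV[R]_n.+1) ord0 (lift ord0 j)).
have consK : cancel cons uncons.
  move=> [x v]; rewrite /uncons /cons /consv /=; congr pair.
    have -> : ord0 = lshift n ord0 :> 'I_(1 + n) by exact: val_inj.
    by rewrite [LHS]row_mxEl mxE.
  apply/rowP => j; rewrite mxE.
  have -> : lift ord0 j = rshift 1 j :> 'I_(1 + n) by exact: val_inj.
  by rewrite [LHS]row_mxEr.
have muncons : measurable_fun setT uncons.
  apply: measurable_fun_pair; first exact: measurable_coord.
  apply: measurable_row_vector => j.
  rewrite (_ : (fun _ => _) =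
    fun v : borel 'rV[R]_n.+1 => (v : 'rV[R]_n.+1) ord0 (lift ord0 j)).
    exact: measurable_coord.
  by apply/funext => v; rewrite mxE.
exists (fun k => uncons @^-1` (F k `*` G k)) => [|k].
  by rewrite -preimage_bigcup TFG preimage_setT.
have [mF Fk] := Foo k; have [mG Gk] := Goo k; split.
  by rewrite -[X in measurable X]setTI; apply: muncons => //; exact: measurableX.
rewrite /lebesgue_step /pushforward -comp_preimage.
rewrite (_ : uncons \o cons = id); last exact/funext.
by rewrite preimage_id product_measure1E// lte_mul_pinfty// ge0_fin_numE.
Qed.

HB.instance Definition _ :=
  Measure_isSigmaFinite.Build _ _ _ lebesgue_step step_sigma_finite.

End step.

(* The d-dimensional Lebesgue measure, as an iterated product. *)
Fixpoint lebesgue_rV (n : nat) :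
    {sigma_finite_measure set (borel 'rV[R]_n) -> \bar R} :=
  match n with
  | 0 => \d_(0 : borel 'rV[R]_0)
  | n'.+1 => lebesgue_step (lebesgue_rV n')
  end.

End lebesgue_row_vector.
Section euclidean.
Context {R : realType} {d : nat}.
Implicit Types x y : 'rV[R]_d.

Definition dotr x y : R := \sum_i x ord0 i * y ord0 i.

(* The library norm on row vectors is the sup norm, hence a separate
   Euclidean norm. *)
Definition enorm x : R := Num.sqrt (dotr x x).

Definition basis_vec (i : 'I_d) : 'rV[R]_d := delta_mx ord0 i.

Definition frontier (A : set 'rV[R]_d) : set 'rV[R]_d := closure A `\` A°.

Definition dist_to (A : set 'rV[R]_d) x : R := inf [set enorm (x - z) | z in A].

Lemma measurable_enorm : measurable_fun setT (enorm : borel 'rV[R]_d -> R).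
Proof.
apply: (@measurableT_comp _ _ _ _ _ _ (@Num.sqrt R)).
  by apply: continuous_measurable_fun => x; exact: sqrt_continuous.
by apply: measurable_sum => i; apply: measurable_funM; exact: measurable_coord.
Qed.

End euclidean.
Arguments basis_vec {R d}.

Section uniform_sphere.
Context {R : realType} {d : nat}.

Definition unit_ball : set (borel 'rV[R]_d) := [set x | enorm x <= 1].

Definition normalize (x : borel 'rV[R]_d) : borel 'rV[R]_d :=
  (enorm x)^-1 *: (x : 'rV[R]_d).

(* The uniform probability measure on the unit sphere, as the measure on the
   whole space which gives to A the normalized volume of the cone
   {x in unit_ball | x / |x| in A} over A. *)
Definition unif_sphere (A : set (borel 'rV[R]_d)) : \bar R :=
  ((fine (lebesgue_rV d unit_ball))^-1%:E *
   lebesgue_rV d (normalize @^-1` A `&` unit_ball))%E.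

Let mball : measurable unit_ball.
Proof.
rewrite (_ : unit_ball = enorm @^-1` `]-oo, 1]).
  by rewrite -[X in measurable X]setTI; exact: measurable_enorm.
by apply/seteqP; split => x; rewrite /= in_itv.
Qed.

Let mnormalize : measurable_fun setT normalize.
Proof.
apply: measurable_row_vector => i.
rewrite (_ : (fun _ => _) =
    fun x : borel 'rV[R]_d => enorm x `^ (-1) * (x : 'rV[R]_d) ord0 i).
  apply: measurable_funM; last exact: measurable_coord.
  apply: (@measurableT_comp _ _ _ _ _ _ (fun a : R => a `^ (-1))).
    exact: measurable_powR.
  exact: measurable_enorm.
by apply/funext => x; rewrite mxE powR_inv1 ?sqrtr_ge0.
Qed.

Let unif0 : unif_sphere set0 = 0%E.
Proof. by rewrite /unif_sphere preimage_set0 set0I measure0 mule0. Qed.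

Let inv_vol_ge0 : 0 <= (fine (lebesgue_rV d unit_ball : \bar R))^-1.
Proof. by rewrite invr_ge0 fine_ge0. Qed.

Let unif_ge0 A : (0 <= unif_sphere A)%E.
Proof. by rewrite mule_ge0 ?lee_fin. Qed.

Let unif_sigma_additive : semi_sigma_additive unif_sphere.
Proof.
exact: (@measure_semi_sigma_additive _ _ _
  (mscale (NngNum inv_vol_ge0)
    (measure_function_pushforward__canonical__measure_function_Measure
      (mrestr (lebesgue_rV d) mball) mnormalize))).
Qed.

HB.instance Definition _ := isMeasure.Build _ _ _ unif_sphere
  unif0 unif_ge0 unif_sigma_additive.

End uniform_sphere.

Section smooth_functions.
Context {R : realType} {d : nat}.

Definition pderivs (s : seq 'I_d) (f : 'rV[R]_d -> R) : 'rV[R]_d -> R :=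
  foldr (fun i g => 'D_(basis_vec i) g) f s.

Definition laplacian (f : 'rV[R]_d -> R) (x : 'rV[R]_d) : R :=
  \sum_(i < d) pderivs [:: i; i] f x.

(* For U open, this only depends on the values of f on U. *)
Definition Ck_on (U : set 'rV[R]_d) (k : nat) (f : 'rV[R]_d -> R) : Prop :=
  forall s : seq 'I_d, (size s <= k)%N -> forall x, U x ->
    {for x, continuous (pderivs s f)} /\
    ((size s < k)%N -> forall i, derivable (pderivs s f) x (basis_vec i)).

Definition smooth_on (U : set 'rV[R]_d) (f : 'rV[R]_d -> R) : Prop :=
  forall k, Ck_on U k f.

Definition test_function (U : set 'rV[R]_d) (f : 'rV[R]_d -> R) : Prop :=
  smooth_on setT f /\
  exists K : set 'rV[R]_d,
    [/\ compact K, K `<=` U & forall x, ~ K x -> f x = 0].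

(* Membership in H^1_0(U), the closure of the test functions in H^1(U), of a
   function which is smooth on U, whose classical and weak gradients
   coincide. *)
Definition in_H10 (U : set 'rV[R]_d) (f : 'rV[R]_d -> R) : Prop :=
  forall e : R, 0 < e -> exists2 g, test_function U g &
    (\int[lebesgue_rV d]_(x in U)
       ((f x - g x) ^+ 2 + \sum_(i < d)
          ('D_(basis_vec i) f x - 'D_(basis_vec i) g x) ^+ 2)%:E < e%:E)%E.

End smooth_functions.
Section Ck_space.
Context {R : realType} {d : nat}.

Record Ck_space (k : nat) := MkCk {
  Ck_fun :> 'rV[R]_d -> R ;
  Ck_funP : Ck_on setT k Ck_fun }.

HB.instance Definition _ k := gen_eqMixin (Ck_space k).
HB.instance Definition _ k := gen_choiceMixin (Ck_space k).

Lemma Ck_fun_inj k : injective (@Ck_fun k).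
Proof.
move=> [f fP] [g gP] /= fg; move: fP gP; rewrite fg => fP gP.
by congr MkCk; exact: Prop_irrelevance.
Qed.

(* The C^k norm on the ball B(0, r). *)
Definition Ck_norm (k : nat) (r : R) (f : 'rV[R]_d -> R) : \bar R :=
  ereal_sup [set y | exists s x, [/\ (size s <= k)%N, enorm x < r &
    y = `|pderivs s f x|%:E]].

Definition dist_Ck (k : nat) (f g : 'rV[R]_d -> R) : R :=
  inf [set e | 0 < e /\ (Ck_norm k e^-1 (f \- g)%R < e%:E)%E].

Section metric.
Context (k : nat).
Implicit Types f g : 'rV[R]_d -> R.

Lemma pderivsB f g : Ck_on setT k f -> Ck_on setT k g ->
  forall s, (size s <= k)%N -> pderivs s (f \- g) = pderivs s f \- pderivs s g.
Proof.
move=> fk gk; elim=> //= i s IH sk; rewrite IH 1?ltnW//.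
apply/funext => x.
have [_ /(_ sk i) df] := fk _ (ltnW sk) x I.
have [_ /(_ sk i) dg] := gk _ (ltnW sk) x I.
exact: deriveB.
Qed.

Lemma pderivs_cst0 s : pderivs s (cst 0 : 'rV[R]_d -> R) = cst 0.
Proof.
elim: s => //= i s ->; apply/funext => x; exact: derive_cst.
Qed.

Lemma Ck_cst0 : Ck_on setT k (cst 0 : 'rV[R]_d -> R).
Proof.
move=> s _ x _; rewrite pderivs_cst0; split; first exact: cst_continuous.
by move=> _ i; exact: derivable_cst.
Qed.

Lemma enorm_ge_norm (x : 'rV[R]_d) : `|x| <= enorm x.
Proof.
rewrite [leLHS]/Num.norm /= mx_normrE.
apply: bigmax_le => [|[i j] _ /=]; first exact: sqrtr_ge0.
rewrite (ord1 i) -sqrtr_sqr ler_wsqrtr// /dotr (bigD1 j)//= expr2 lerDl.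
by apply: sumr_ge0 => l _; rewrite -expr2 sqr_ge0.
Qed.

Lemma enorm0 : enorm (0 : 'rV[R]_d) = 0.
Proof.
by rewrite /enorm /dotr big1 ?sqrtr0// => i _; rewrite mxE mul0r.
Qed.

Lemma pderivs_bounded f : Ck_on setT k f ->
  exists M : R, forall s x, (size s <= k)%N -> enorm x <= 1 ->
    `|pderivs s f x| <= M.
Proof.
move=> fk.
have /choice[M HM] : forall s : seq 'I_d, exists M : R, 0 <= M /\
    ((size s <= k)%N -> forall x, enorm x <= 1 -> `|pderivs s f x| <= M).
  move=> s; have [sk|_] := boolP (size s <= k)%N; last by exists 0; split.
  have cs : continuous (fun x => `|pderivs s f x|).
    move=> x; apply: (@continuous_comp _ _ _ (pderivs s f) Num.norm).
      exact: (fk s sk x I).1.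
    exact: norm_continuous.
  have cB : compact [set x : 'rV[R]_d | `|x| <= 1].
    apply: bounded_closed_compact.
      by exists 1; split => // r r1 x /= x1; rewrite (le_trans x1)// ltW.
    rewrite (_ : [set x | _] = (fun x : 'rV[R]_d => `|x|) @^-1` [set r : R | r <= 1])//.
    apply: preimage_closed; last exact: closed_le.
    by move=> x _; exact: norm_continuous.
  have : compact [set `|pderivs s f x| | x in [set x : 'rV[R]_d | `|x| <= 1]].
    by apply: continuous_compact => //; exact: continuous_subspaceT.
  move=> /compact_bounded[M [_ HM]].
  exists (`|M| + 1); split; first by rewrite addr_ge0.
  move=> _ x x1.
  have := HM (`|M| + 1).
  rewrite (le_lt_trans (ler_norm M)) ?ltrDl// => /(_ isT).
  move=> /(_ `|pderivs s f x|); rewrite /= normr_id; apply.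
  by exists x => //=; exact: le_trans (enorm_ge_norm x) x1.
exists (\sum_(n < k.+1) \sum_(t : n.-tuple 'I_d) M t) => s x sk x1.
apply: le_trans ((HM s).2 sk x x1) _.
rewrite (bigD1 (Ordinal (sk : (size s < k.+1)%N)))//= (bigD1 (in_tuple s))//=.
rewrite -addrA lerDl addr_ge0 ?sumr_ge0// => [t _|n _]; first exact: (HM _).1.
by apply: sumr_ge0 => t _; exact: (HM _).1.
Qed.

Let D f g := [set e : R | 0 < e /\ (Ck_norm k e^-1 (f \- g)%R < e%:E)%E].

Let D_lb f g : lbound (D f g) 0.
Proof. by move=> e [/ltW]. Qed.

Let D_nonempty f g : Ck_on setT k f -> Ck_on setT k g -> D f g !=set0.
Proof.
move=> fk gk.
have [M fM] := pderivs_bounded fk; have [N gN] := pderivs_bounded gk.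
have MN0 : 0 <= `|M| + `|N| by rewrite addr_ge0.
exists (`|M| + `|N| + 1); split; first by rewrite ltr_pwDr.
apply: (@le_lt_trans _ _ (`|M| + `|N|)%:E); last by rewrite lte_fin ltrDl.
apply: ge_ereal_sup => _ [s [x [sk xr ->]]]; rewrite lee_fin.
have x1 : enorm x <= 1.
  by rewrite (le_trans (ltW xr))// invf_le1 ?lerDr// ltr_pwDr.
rewrite pderivsB//= (le_trans (ler_normB _ _))// lerD//.
  by rewrite (le_trans (fM _ _ sk x1))// ler_norm.
by rewrite (le_trans (gN _ _ sk x1))// ler_norm.
Qed.

Let DP f g e s x : D f g e -> (size s <= k)%N -> enorm x < e^-1 ->
  `|pderivs s (f \- g) x| < e.
Proof.
move=> [e0 fge] sk xe; rewrite -lte_fin; apply: le_lt_trans fge.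
by apply: ereal_sup_ubound; exists s, x.
Qed.

Let dist_lt f g e : Ck_on setT k f -> Ck_on setT k g ->
  dist_Ck k f g < e -> exists2 e', D f g e' & e' < e.
Proof.
by move=> fk gk /inf_lt[|e' De' e'e]; [exact: D_nonempty|exists e'].
Qed.

Let dist_le f g e : D f g e -> dist_Ck k f g <= e.
Proof. by move=> De; apply: ge_inf => //; exists 0; exact: D_lb. Qed.

Let dist_ge0 f g : Ck_on setT k f -> Ck_on setT k g -> 0 <= dist_Ck k f g.
Proof. by move=> fk gk; apply: lb_le_inf; [exact: D_nonempty|exact: D_lb]. Qed.

Lemma dist_Ckxx (f : Ck_space k) : dist_Ck k f f = 0.
Proof.
have f0 : 0 <= dist_Ck k f f by apply: dist_ge0; exact: Ck_funP.
apply/eqP; rewrite eq_le f0 andbT.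
apply/ler_addgt0Pl => e e0; rewrite addr0; apply: dist_le; split => //.
apply: (@le_lt_trans _ _ 0%:E); last by rewrite lte_fin.
apply: ge_ereal_sup => _ [s [x [sk _ ->]]].
rewrite pderivsB//; [|exact: Ck_funP..].
by rewrite /= subrr normr0.
Qed.

Lemma dist_Ck_eq0 (f g : Ck_space k) : dist_Ck k f g = 0 -> f = g.
Proof.
move=> fg0; apply: Ck_fun_inj; apply/funext => x; apply/eqP.
rewrite -subr_eq0 -normr_le0; apply/ler_addgt0Pl => e e0; rewrite addr0.
have x0 : 0 < enorm x + 1 by rewrite ltr_pwDr// sqrtr_ge0.
have : dist_Ck k f g < Num.min e (enorm x + 1)^-1.
  by rewrite fg0 lt_min e0 invr_gt0.
move=> /dist_lt[||e' De']; [exact: Ck_funP..|].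
rewrite lt_min => /andP[e'e e'x]; have [e'0 _] := De'.
apply/ltW/(lt_trans _ e'e)/(DP De' (s := [::])) => //.
by rewrite (@lt_trans _ _ (enorm x + 1)) ?ltrDl// -ltf_pV2 ?invrK// posrE ?invr_gt0.
Qed.

Lemma dist_CkC (f g : Ck_space k) : dist_Ck k f g = dist_Ck k g f.
Proof.
congr inf; apply/seteqP; split => e [e0 fge]; split => //;
  rewrite (le_lt_trans _ fge)//; apply: ge_ereal_sup => _ [s [x [sk xe ->]]];
  apply: ereal_sup_ubound; exists s, x; split => //;
  rewrite !pderivsB//; try exact: Ck_funP.
  all: by rewrite /= distrC.
Qed.

Lemma dist_Ck_triangle (g f h : Ck_space k) :
  dist_Ck k f h <= dist_Ck k f g + dist_Ck k g h.
Proof.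
have fk := Ck_funP f; have gk := Ck_funP g; have hk := Ck_funP h.
apply/ler_addgt0Pl => e e0.
have e20 : 0 < e / 2 by rewrite divr_gt0.
have := @dist_lt f g (dist_Ck k f g + e / 2) fk gk.
rewrite ltrDl => /(_ e20)[a Da ae].
have := @dist_lt g h (dist_Ck k g h + e / 2) gk hk.
rewrite ltrDl => /(_ e20)[b Db be].
have a0 : 0 < a by case: Da.
have b0 : 0 < b by case: Db.
apply: (@le_trans _ _ (a + b)); last first.
  by rewrite (le_trans (ltW (ltrD ae be)))// addrACA -splitr addrC.
apply/ler_addgt0Pl => c c0; apply: dist_le; split; first by rewrite !addr_gt0.
apply: (@le_lt_trans _ _ (a + b)%:E); last by rewrite lte_fin ltrDr.
apply: ge_ereal_sup => _ [s [x [sk xe ->]]]; rewrite lee_fin.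
have xa : enorm x < a^-1.
  rewrite (lt_le_trans xe)// lef_pV2 ?posrE ?addr_gt0//.
  by rewrite addrCA lerDl addr_ge0// ltW.
have xb : enorm x < b^-1.
  rewrite (lt_le_trans xe)// lef_pV2 ?posrE ?addr_gt0//.
  by rewrite addrA lerDr addr_ge0// ltW.
have := ltrD (DP Da sk xa) (DP Db sk xb).
rewrite !pderivsB//= => /ltW; apply: le_trans.
by rewrite (le_trans _ (ler_normD _ _))// subrKA.
Qed.

HB.instance Definition _ := isMetric.Build R (Ck_space k)
  dist_Ckxx dist_Ck_eq0 dist_CkC dist_Ck_triangle.

HB.instance Definition _ := isPointed.Build (Ck_space k) (MkCk Ck_cst0).

End metric.
End Ck_space.
Section bounded_continuous.
Context {R : realType} {X : ptopologicalType}.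

Definition bcont : {pred X -> R} :=
  mem [set F : X -> R | continuous F /\ bounded_fun F].

Record Cb : Type := MkCb { Cb_fun :> X -> R ; _ : Cb_fun \in bcont }.

HB.instance Definition _ := [isSub for Cb_fun].
HB.instance Definition _ := [Choice of Cb by <:].

Lemma CbP (F : Cb) : continuous F /\ bounded_fun F.
Proof. by case: F => F /=; rewrite inE. Qed.

Let bcont_submod : submod_closed bcont.
Proof.
split=> [|a F G].
  rewrite inE; split => [x|]; first exact: cst_continuous.
  by exists 0; split => // M M0 x _ /=; rewrite normr0 ltW.
rewrite !inE => -[cF [M [Mr bF]]] [cG [N [Nr bG]]]; split.
  have -> : a *: F + G = (fun x => a * F x + G x) by [].
  by move=> x; apply: cvgD (cG x); exact: cvgM (cvg_cst a) (cF x).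
exists (`|a| * (`|M| + 1) + (`|N| + 1)); split => // K ltK x _.
apply: le_trans (ltW ltK); apply: le_trans (ler_normD _ _) _; apply: lerD.
  rewrite normrM ler_wpM2l// bF//.
  by rewrite (le_lt_trans (ler_norm M)) ?ltrDl.
by apply: bG => //; rewrite (le_lt_trans (ler_norm N)) ?ltrDl.
Qed.

HB.instance Definition _ := GRing.isSubmodClosed.Build _ _ bcont bcont_submod.
HB.instance Definition _ := [SubChoice_isSubLmodule of Cb by <:].

Definition Cb_norm (F : Cb) : R := sup [set `|F x| | x in setT].

Lemma Cb_norm_has_sup (F : Cb) : has_sup [set `|F x| | x in setT].
Proof.
split; first by exists `|F point|, point.
have [_ [M [_ bF]]] := CbP F; exists (`|M| + 1) => _ [x _ <-].
apply: bF => //; by rewrite (le_lt_trans (ler_norm M)) ?ltrDl.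
Qed.

Lemma Cb_norm_ub (F : Cb) x : `|F x| <= Cb_norm F.
Proof.
by apply: ub_le_sup; [exact: (Cb_norm_has_sup F).2|exists x].
Qed.

Let norm_ge0 (F : Cb) : 0 <= Cb_norm F.
Proof. by rewrite (le_trans _ (Cb_norm_ub F point)). Qed.

Let ler_Cb_normD (F G : Cb) : Cb_norm (F + G) <= Cb_norm F + Cb_norm G.
Proof.
apply: sup_le_ub; first exact: (Cb_norm_has_sup _).1.
move=> _ [x _ <-]; apply: le_trans (ler_normD _ _) _.
by apply: lerD; exact: Cb_norm_ub.
Qed.

Let Cb_normZ (a : R) (F : Cb) : Cb_norm (a *: F) = `|a| * Cb_norm F.
Proof.
have [->|a0] := eqVneq a 0.
  rewrite scale0r normr0 mul0r; apply/eqP; rewrite eq_le norm_ge0 andbT.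
  apply: sup_le_ub; first exact: (Cb_norm_has_sup _).1.
  by move=> _ [x _ <-] /=; rewrite normr0.
have le_Z b (G : Cb) : Cb_norm (b *: G) <= `|b| * Cb_norm G.
  apply: sup_le_ub; first exact: (Cb_norm_has_sup _).1.
  move=> _ [x _ <-]; rewrite [leLHS](_ : _ = `|b| * `|G x|).
    by rewrite ler_wpM2l//; exact: Cb_norm_ub.
  by rewrite -normrM.
apply/eqP; rewrite eq_le le_Z/=.
have := le_Z a^-1 (a *: F); rewrite scalerA mulVf// scale1r normfV.
by rewrite ler_pdivlMl ?normr_gt0.
Qed.

Let Cb_norm_eq0 (F : Cb) : Cb_norm F = 0 -> F = 0.
Proof.
move=> F0; apply/val_inj/funext => x /=; apply/eqP.
by rewrite -normr_le0 -F0 Cb_norm_ub.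
Qed.

HB.instance Definition _ :=
  Lmodule_isNormed.Build R Cb ler_Cb_normD Cb_normZ Cb_norm_eq0.

End bounded_continuous.
Arguments Cb : clear implicits.

Section waves.
Context {R : realType} {d : nat} (k : nat).

Definition FP_set : set (@Ck_space R d k) :=
  [set f | smooth_on setT f /\ forall x, - laplacian f x = f x].

(* All the distances dist_Ck k induce the same topology on FP: here the one for
   the same k as that of the ambient space is used. *)
Definition FP : Type := set_type FP_set.

Lemma FP_set0 : (point : Ck_space k) \in FP_set.
Proof.
rewrite inE; split => [j|x]; first exact: Ck_cst0.
by rewrite /laplacian big1 ?oppr0// => i _; rewrite [LHS](congr1 (@^~ x) (pderivs_cst0 _)).
Qed.

HB.instance Definition _ := PseudoMetric.copy FP (set_type FP_set).
HB.instance Definition _ := isPointed.Build FP (exist _ point FP_set0).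

Definition extension_operator
    (iota : {linear Cb R FP -> Cb R (@Ck_space R d k)}) : Prop :=
  [/\ continuous iota,
      forall (F : Cb R FP) (f : FP), iota F (val f) = F f &
      forall F : Cb R FP, `|iota F| = `|F| ].

End waves.
Arguments FP R d k : clear implicits.
Arguments Ck_space R d k : clear implicits.

Definition top_dual {R : realType} (V : normedModType R) : set (V -> R) :=
  [set l : V -> R | scalar l /\ continuous l].
Arguments top_dual {R} V.

Section local_measures.
Context {R : realType} {d : nat}.

(* Smoothness at 0 follows from chi being constant near 0. *)
Definition cutoff (chi : R -> R) : Prop :=
  [/\ forall t, 0 <= t -> 0 <= chi t <= 1,
      forall s t, 0 <= s -> s <= t -> chi t <= chi s,
      forall j t, 0 < t -> derivable (chi^`(j))%classic t 1,
      exists2 e : R, 0 < e & forall t, 0 <= t -> t < e -> chi t = 1 &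
      forall t, 1 < t -> chi t = 0].

(* The second factor vanishes when x0 + h *: y is not in Omega, so that the
   values of phi outside Omega do not matter. *)
Definition rescaled (Omega : set 'rV[R]_d) (chi : R -> R) (h : R)
    (phi : 'rV[R]_d -> R) (x0 y : 'rV[R]_d) : R :=
  phi (x0 + h *: y) * chi (h * enorm y / dist_to (frontier Omega) x0).

(* For a Dirichlet eigenfunction phi the rescaled function is C^k, even where
   the support of the cutoff touches the frontier, as the cutoff is flat there:
   the default value is only there to get a total function. *)
Definition to_Ck k (f : 'rV[R]_d -> R) : Ck_space R d k :=
  if pselect (Ck_on setT k f) is left fk then MkCk fk else point.

Definition LM k (Omega : set 'rV[R]_d) (chi : R -> R) (U : set 'rV[R]_d)
    (h : R) (phi : 'rV[R]_d -> R) (B : set (borel (Ck_space R d k))) : \bar R :=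
  ((fine (lebesgue_rV d U))^-1%:E * \int[lebesgue_rV d]_(x0 in U)
    \d_(to_Ck k (rescaled Omega chi h phi x0) : borel (Ck_space R d k)) B)%E.

Definition LM_ext k (Omega : set 'rV[R]_d) (chi : R -> R)
    (iota : {linear Cb R (FP R d k) -> Cb R (Ck_space R d k)})
    (U : set 'rV[R]_d) (h : R) (phi : 'rV[R]_d -> R) (F : Cb R (FP R d k)) : R :=
  fine (\int[@LM k Omega chi U h phi]_f (iota F f)%:E)%E.

(* The weak-* topology is that of pointwise convergence. *)
Definition sigma k (Omega : set 'rV[R]_d) (chi : R -> R)
    (iota : {linear Cb R (FP R d k) -> Cb R (Ck_space R d k)})
    (U : set 'rV[R]_d) (h : nat -> R) (phi : nat -> 'rV[R]_d -> R) :
    set (Cb R (FP R d k) -> R) :=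
  top_dual (Cb R (FP R d k)) `&`
  cluster ((fun n => LM_ext Omega chi iota U (h n) (phi n)) @ \oo :
    set_system {ptws Cb R (FP R d k) -> R}).

End local_measures.

Section complex_integral.
Local Open Scope complex_scope.
Context {R : realType} d (T : measurableType d).

Definition expi (t : R) : R[i] := cos t +i* sin t.

Definition Cintegral (mu : {measure set T -> \bar R}) (f : T -> R[i]) : R[i] :=
  (\int[mu]_x complex.Re (f x)) +i* (\int[mu]_x complex.Im (f x)).

End complex_integral.

Section berry.
Context {R : realType} {d : nat} {dT} {T : measurableType dT}
  (P : probability T R).

(* The library's normal_prob m s is not the Dirac mass at m for s = 0. *)
Definition gaussian (Y : T -> R) : Prop :=
  measurable_fun setT Y /\
  exists m s : R, forall A : set R, measurable A ->
    P (Y @^-1` A) = if s == 0 then \d_m A else normal_prob m s A.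

Definition gaussian_field (Psi : 'rV[R]_d -> T -> R) : Prop :=
  forall (n : nat) (x : 'I_n -> 'rV[R]_d) (a : 'I_n -> R),
    gaussian (fun w => \sum_i a i * Psi (x i) w).

Definition berry_field (Psi : 'rV[R]_d -> T -> R) : Prop :=
  [/\ gaussian_field Psi,
      forall x, ('E_P[Psi x] = 0)%E &
      forall x x', (fine 'E_P[Psi x \* Psi x'])%:C%C =
        Cintegral unif_sphere (fun theta : borel 'rV[R]_d => expi (dotr (x - x') theta))].

End berry.

(* Main.v *)
Require Import Defs.
From mathcomp Require Import all_boot all_order all_algebra.
From mathcomp Require Import all_classical all_reals all_analysis.
From mathcomp Require Import ess_sup_inf measurable_realfun ring lra.

(** If the sup norms do not tend to infinity, they are at most M for n in an
    infinite set A. Along an ultrafilter refining A the functionals defining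
    sigma_Omega converge pointwise, to an element of sigma_Omega, hence to
    mu_Berry. Test this limit on F f = min(1, max(0, |f(0)| - M)). On the one
    hand mu_Berry F > 0, as the value of the field at 0 is a nondegenerate
    Gaussian. On the other hand, fix x0 in Omega: the rescaled functions around
    x0 with n in A solve - Delta u = u on larger and larger balls and are bounded
    by M there. Bernstein's gradient estimate, which only uses the maximum
    principle, bounds all their derivatives locally, so that they are relatively
    compact in C^k, with limit points f in FP such that |f(0)| <= M, for which
    F f = 0. Whatever the extension operator iota, continuity then gives
    iota F -> 0 at the rescaled functions, and dominated convergence in x0
    yields mu_Berry F = 0.
    The local measures are genuine measures because the rescaled functions are
    C^k and depend continuously on x0: where the support of the cutoff touches
    the frontier of Omega, the interior estimates only blow up polynomially
    while the cutoff vanishes to infinite order. *)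

Set Implicit Arguments.
Unset Strict Implicit.
Unset Printing Implicit Defensive.

Import Order.TTheory GRing.Theory Num.Theory.
Import numFieldNormedType.Exports.

Local Open Scope classical_set_scope.
Local Open Scope ring_scope.

(** * Derivatives along lines and jets *)

(** Off [FP], nothing is known of [iota F] but continuity and a bound, so the bound M on a rescaled
    function says nothing directly about [iota F] there. It can be used only in the limit, for a
    fixed centre, before integrating over centres. Ultrafilters replace the extraction of
    subsequences because limits are needed at once for uncountably many bounded families: all test
    functions, and all derivatives at all points. Dominated convergence, however, is a statement
    about sequences. It is therefore run along the integers, with integrands set to 0 outside A, and
    transferred to the ultrafilter at the end. Derivatives are carried by jets, families of
    functions tied by derivation relations on an open set. Jets can be shifted, rescaled,
    differentiated and passed to a limit without regard to values off that set. As [to_Ck] returns a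
    default value outside C^k, regularity must be settled before a rescaled function means anything.
    The interior estimates thus serve twice: for compactness, and against the flatness of the cutoff
    at the frontier. *)

Section lines.
Context {R : realType} {V : normedModType R}.
Implicit Types (f g : V -> R) (x v : V).

(** The two difference quotients are the same function of h, so the one-variable mean value theorem
    and chain rule become available for directional derivatives. *)
Lemma is_derive_line f x v (t a : R) :
  is_derive (x + t *: v) v f a <-> is_derive t 1 (fun s => f (x + s *: v)) a.
Proof.
suff E : (fun h : R => h^-1 *: ((f \o shift (x + t *: v)) (h *: v) - f (x + t *: v)))
    = (fun h : R => h^-1 *: (((fun s => f (x + s *: v)) \o shift t) (h *: 1) -
        f (x + t *: v))).
  by split => -[]; rewrite /derivable /derive => d1 d2; constructor;
    rewrite /derivable /derive /=; [rewrite -E|rewrite -E|rewrite E|rewrite E].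
apply/funext => h /=; congr (_ *: (f _ - _)).
by rewrite [_%:A]mulr1 scalerDl addrCA addrA addrC addrA.
Qed.

Lemma is_derive_scale_dir f x v (c a : R) :
  is_derive x v f a -> is_derive x (c *: v) f (c * a).
Proof.
move=> fa; have {}fa : is_derive (0 : R) 1 (fun s => f (x + s *: v)) a.
  by apply/is_derive_line; rewrite scale0r addr0.
suff : is_derive (x + (0 : R) *: (c *: v)) (c *: v) f (c * a).
  by rewrite scale0r addr0.
apply/is_derive_line.
rewrite (_ : (fun s => _) = (fun s => f (x + s *: v)) \o (fun s => c * s)); last first.
  by apply/funext => s /=; rewrite scalerA mulrC.
rewrite mulrC; apply: is_derive1_comp.
  by rewrite mulr0.
have := @is_deriveZ R R R (@id R) c 0 1 1 (is_derive_id _ _); rewrite /GRing.scale/= mulr1.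
exact.
Qed.

Lemma is_derive_shift_dom f x v a z :
  is_derive (z + x) v f a <-> is_derive x v (fun y => f (z + y)) a.
Proof.
suff E : (fun h : R => h^-1 *: ((f \o shift (z + x)) (h *: v) - f (z + x)))
    = (fun h : R => h^-1 *: (((fun s => f (z + s)) \o shift x) (h *: v) - f (z + x))).
  by split => -[]; rewrite /derivable /derive => d1 d2; constructor;
    rewrite /derivable /derive /=; [rewrite -E|rewrite -E|rewrite E|rewrite E].
by apply/funext => h /=; rewrite addrCA.
Qed.

Lemma line_mvt f (g : V -> R) x v :
  (forall t : R, 0 <= t <= 1 -> is_derive (x + t *: v) v f (g (x + t *: v))) ->
  exists2 t : R, 0 <= t <= 1 & f (x + v) - f x = g (x + t *: v).
Proof.
move=> fg.
have fg' (t : R) : 0 <= t <= 1 -> is_derive t 1 (fun s => f (x + s *: v)) (g (x + t *: v)).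
  by move=> t01; apply/is_derive_line/fg.
have [t||t t01 E] := @MVT_segment R (fun s => f (x + s *: v))
   (fun s => g (x + s *: v)) 0 1 ler01.
- by rewrite in_itv/= => /andP[t0 t1]; apply: fg'; rewrite !ltW.
- apply: derivable_within_continuous => t; rewrite in_itv/= => t01.
  by have [] := fg' t t01.
- exists t; first by rewrite in_itv/= in t01.
  by move: E; rewrite scale1r scale0r addr0 subr0 mulr1.
Qed.

Lemma line_mvt_scaled f (g : V -> R) x v (c : R) :
  (forall t : R, 0 <= t <= 1 ->
    is_derive (x + t *: (c *: v)) v f (g (x + t *: (c *: v)))) ->
  exists2 t : R, 0 <= t <= 1 & f (x + c *: v) - f x = c * g (x + t *: (c *: v)).
Proof.
move=> fg; apply: (@line_mvt f (fun y => c * g y)) => t /fg.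
exact: is_derive_scale_dir.
Qed.

Lemma is_derive_unique f x v (a b : R) :
  is_derive x v f a -> is_derive x v f b -> a = b.
Proof. by move=> [_ <-] [_ <-]. Qed.

(** Dividing a quadratic remainder by t leaves C |t|. The derivatives of |y - a|^2, of a wave at the
    edge of its cutoff and of a limit of waves all come from such a remainder. *)
Lemma is_derive_taylor f x v (a C : R) :
  (forall t : R, `|t| <= 1 -> `|f (x + t *: v) - f x - t * a| <= C * t ^+ 2) ->
  is_derive x v f a.
Proof.
move=> fa; have C0 : 0 <= C.
  by have := fa 1; rewrite normr1 expr1n mulr1 lexx => /(_ isT); exact: le_trans.
have L : (fun h : R => h^-1 *: ((f \o shift x) (h *: v) - f x)) @ 0^' --> a.
  apply/cvgrPdist_le => e e0; rewrite near_withinE.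
  have C1 : 0 < C + 1 by rewrite ltr_wpDl.
  have : 0 < Num.min 1 (e / (C + 1)) by rewrite lt_min ltr01 divr_gt0.
  move=> d0; near=> t => t0.
  have : `|t| < Num.min 1 (e / (C + 1)).
    by near: t; apply: (@nbhs0_lt R R).
  rewrite lt_min => /andP[t1 te] /=.
  have -> : a - t^-1 *: (f (t *: v + x) - f x) =
      - (t^-1 * (f (x + t *: v) - f x - t * a)).
    by rewrite /GRing.scale/= (addrC x); field.
  rewrite normrN normrM normfV.
  have tp : 0 < `|t| by rewrite normr_gt0.
  rewrite ler_pdivrMl//; apply: le_trans (fa _ (ltW t1)) _.
  rewrite -real_normK ?num_real// expr2 mulrCA ler_wpM2l//.
  rewrite ltr_pdivlMr// in te; rewrite mulrC; apply: le_trans (ltW te).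
  by rewrite ler_wpM2l// lerDl.
by constructor; [apply/cvg_ex; exists a|apply/cvg_lim].
Unshelve. all: by end_near. Qed.

End lines.

Section jets.
Context {R : realType} {d : nat}.
Implicit Types (U : set 'rV[R]_d) (J : seq 'I_d -> 'rV[R]_d -> R)
  (x : 'rV[R]_d) (i j : 'I_d) (s : seq 'I_d).

(* J s plays the role of the iterated derivative along s. *)
Definition jet U J := forall s x, U x -> {for x, continuous (J s)} /\
  forall i, is_derive x (basis_vec i) (J s) (J (i :: s) x).

Lemma jet_sub U U' J : U' `<=` U -> jet U J -> jet U' J.
Proof. by move=> UU' jJ s x /UU'; exact: jJ. Qed.

Lemma smooth_jet U f : smooth_on U f -> jet U (fun s => pderivs s f).
Proof.
move=> sf s x Ux; have [cf df] := sf (size s).+1 s (leqnSn _) x Ux.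
by split=> // i; exact/derivableP/df.
Qed.

(** Derivatives only see neighbourhoods, and U is one of each of its points: induction on s
    identifies every [pderivs], whatever f is off U. *)
Lemma jet_smooth U J f : open U -> jet U J -> (forall x, U x -> f x = J [::] x) ->
  smooth_on U f /\ forall s x, U x -> pderivs s f x = J s x.
Proof.
move=> oU jJ fJ.
have nU x : U x -> \forall y \near x, U y by move=> Ux; exact: open_nbhs_nbhs.
have E s : forall x, U x -> pderivs s f x = J s x.
  elim: s => //= i s IH x Ux.
  have [_ /(_ i)[_ <-]] := jJ s x Ux.
  by apply: near_eq_derive; apply: filterS (nU _ Ux) => y /IH.
have nE s x : U x -> \forall y \near x, J s y = pderivs s f y.
  by move=> Ux; apply: filterS (nU _ Ux) => y /E.
split=> // k s _ x Ux; have [cJ dJ] := jJ s x Ux; split.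
  move: cJ; rewrite /prop_for /continuous_at (E s x)//; apply: cvg_trans.
  exact: near_eq_cvg (nE s x Ux).
by move=> _ i; apply: near_eq_derivable (nE s x Ux) _; have [] := dJ i.
Qed.

Lemma norm_basis_vec i : `|basis_vec i : 'rV[R]_d| <= 1.
Proof.
rewrite [leLHS]/Num.norm/= mx_normrE; apply: bigmax_le => // -[a b] _ /=.
by rewrite mxE; case: (_ && _); rewrite ?normr1 ?normr0.
Qed.

Lemma norm_scale_basis_vec i (t : R) : `|t *: (basis_vec i : 'rV[R]_d)| <= `|t|.
Proof. by rewrite normrZ ler_piMr// norm_basis_vec. Qed.

(** Two mean values: along e_i for the function f(y + t e_j) - f(y) of y, then along e_j for
    [fi]. *)
Lemma mixed_difference U (f fi fji : 'rV[R]_d -> R) x i j (t : R) :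
  (forall y, U y -> is_derive y (basis_vec i) f (fi y)) ->
  (forall y, U y -> is_derive y (basis_vec j) fi (fji y)) ->
  (forall y, `|y - x| <= 2 * `|t| -> U y) ->
  exists2 y, `|y - x| <= 2 * `|t| &
    f (x + t *: basis_vec i + t *: basis_vec j) - f (x + t *: basis_vec i)
    - f (x + t *: basis_vec j) + f x = t ^+ 2 * fji y.
Proof.
move=> di dj xU; set ei := basis_vec i; set ej := basis_vec j.
have bnd (a b : R) : 0 <= a <= 1 -> 0 <= b <= 1 ->
    `|x + a *: (t *: ei) + b *: (t *: ej) - x| <= 2 * `|t|.
  move=> /andP[a0 a1] /andP[b0 b1].
  rewrite -[x + _ + _]addrA [x + _]addrC addrK.
  rewrite mulr_natl mulr2n (le_trans (ler_normD _ _))//.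
  by apply: lerD; rewrite scalerA (le_trans (norm_scale_basis_vec _ _))//
    normrM ler_piMl// ger0_norm.
have [|a a01 Ea] := @line_mvt_scaled _ _ (fun y => f (y + t *: ej) - f y)
  (fun y => fi (y + t *: ej) - fi y) x ei t.
  move=> a a01; apply: is_deriveB; last first.
    by apply/di/xU; have := bnd a 0 a01; rewrite scale0r addr0; apply; lra.
  rewrite (_ : (fun y => _) = (fun y => f (t *: ej + y))); last first.
    by apply/funext => y; rewrite addrC.
  apply/(@is_derive_shift_dom _ _ f (x + a *: (t *: ei))).
  rewrite [t *: ej + (_ + _)]addrC; apply/di/xU.
  by have := bnd a 1 a01; rewrite scale1r; apply; lra.
have [b b01 Eb] := @line_mvt_scaled _ _ fi fji (x + a *: (t *: ei)) ej t
  (fun b b01 => dj _ (xU _ (bnd a b a01 b01))).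
exists (x + a *: (t *: ei) + b *: (t *: ej)); first exact: bnd.
rewrite expr2 -mulrA -Eb -Ea; ring.
Qed.

(** The second difference over a square of side t is symmetric in i and j; divided by t^2 it is a
    value near x of either mixed derivative, and both are continuous. The side r/4 keeps all points
    within r/2 of x. *)
Lemma jet_schwarz U J s x i j : open U -> jet U J -> U x ->
  J (i :: j :: s) x = J (j :: i :: s) x.
Proof.
move=> oU jJ Ux; apply/eqP; rewrite -subr_eq0 -normr_le0.
apply/ler_addgt0Pl => e e0; rewrite addr0.
have e20 : 0 < e / 2 by rewrite divr_gt0.
have c1 := (jJ (i :: j :: s) x Ux).1; have c2 := (jJ (j :: i :: s) x Ux).1.
have : \forall y \near x, [/\ U y, `|J (i :: j :: s) x - J (i :: j :: s) y| < e / 2 &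
    `|J (j :: i :: s) x - J (j :: i :: s) y| < e / 2].
  near=> y; split.
  - by near: y; exact: open_nbhs_nbhs.
  - by near: y; move/cvgrPdist_lt : c1; exact.
  - by near: y; move/cvgrPdist_lt : c2; exact.
move=> /nbhs_ballP[r /= r0 xr].
have N y : `|y - x| <= 2 * `|r / 4| ->
    [/\ U y, `|J (i :: j :: s) x - J (i :: j :: s) y| < e / 2 &
    `|J (j :: i :: s) x - J (j :: i :: s) y| < e / 2].
  move=> yx; apply: xr; rewrite -ball_normE/= distrC (le_lt_trans yx)//.
  by rewrite ger0_norm; lra.
have dU s' k : forall y, U y -> is_derive y (basis_vec k) (J s') (J (k :: s') y).
  by move=> y Uy; have [_] := jJ s' y Uy; exact.
have UN y : `|y - x| <= 2 * `|r / 4| -> U y by move=> /N[].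
have [y yx Ey] := mixed_difference (dU s i) (dU (i :: s) j) UN.
have [z zx Ez] := mixed_difference (dU s j) (dU (j :: s) i) UN.
have [_ zi _] := N _ zx; have [_ _ yj] := N _ yx.
have : J (j :: i :: s) y = J (i :: j :: s) z.
  apply: (@mulfI _ ((r / 4) ^+ 2)); first by rewrite expf_neq0// gt_eqF; lra.
  rewrite -Ey -Ez (addrAC x (_ *: basis_vec j)); ring.
move=> E; move: zi yj; rewrite E !ltr_norml => /andP[z1 z2] /andP[y1 y2].
by rewrite ler_norml; apply/andP; split; lra.
Unshelve. all: by end_near. Qed.

Lemma jet_helmholtz U J s x : open U -> jet U J ->
  (forall y, U y -> - (\sum_i J [:: i; i] y) = J [::] y) -> U x ->
  - (\sum_i J (i :: i :: s) x) = J s x.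
Proof.
move=> oU jJ H; elim: s x => [x Ux|j s IH x Ux]; first exact: H.
have nU : \forall y \near x, U y by exact: open_nbhs_nbhs.
(* Two exchanges bring j to the front. One of them happens under the derivative along i, hence is
   needed on a whole neighbourhood of x. *)
have E i : J (i :: i :: j :: s) x = J (j :: i :: i :: s) x.
  rewrite -[RHS](@jet_schwarz U J (i :: s) x i j)//.
  have [_ /(_ i)] := jJ (i :: j :: s) x Ux.
  move=> /(near_eq_is_derive (g := J (j :: i :: s))) D.
  apply: is_derive_unique (D _) _; first by apply: filterS nU => y; exact: jet_schwarz.
  by have [_] := jJ (j :: i :: s) x Ux; exact.
have D : is_derive x (basis_vec j) (J s) (J (j :: s) x).
  by have [_] := jJ s x Ux; exact.
apply: is_derive_unique D.
have : is_derive x (basis_vec j) (- (\sum_i J (i :: i :: s)))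
    (- \sum_i J (i :: i :: j :: s) x).
  apply: is_deriveN; rewrite fct_sumE.
  under [X in is_derive _ _ _ X]eq_bigr do rewrite E.
  rewrite -fct_sumE; apply: is_derive_sum => i.
  by have [_] := jJ (i :: i :: s) x Ux; exact.
apply: near_eq_is_derive; apply: filterS nU => y Uy.
by rewrite -IH//= /GRing.opp/= fct_sumE.
Qed.

End jets.

(** * Bernstein's gradient estimate *)

Section continuity_of_operations.
Context {R : realType} {T : topologicalType}.
Implicit Types (f g : T -> R) (x : T).

Lemma continuous_at_add f g x : {for x, continuous f} -> {for x, continuous g} ->
  {for x, continuous (fun y => f y + g y)}.
Proof. exact: (@cvgD _ _ _ (nbhs x)). Qed.

Lemma continuous_at_mul f g x : {for x, continuous f} -> {for x, continuous g} ->
  {for x, continuous (fun y => f y * g y)}.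
Proof. exact: (@cvgM _ _ (nbhs x)). Qed.

End continuity_of_operations.

(** * The Euclidean norm, compared with the sup norm of row vectors *)

Section enorm_theory.
Context {R : realType} {d : nat}.
Implicit Types x y z : 'rV[R]_d.

Lemma dotr_ge0 x : 0 <= dotr x x.
Proof. by apply: sumr_ge0 => i _; rewrite -expr2 sqr_ge0. Qed.

Lemma enorm_ge0 x : 0 <= enorm x.
Proof. exact: sqrtr_ge0. Qed.

Lemma sqr_enorm x : enorm x ^+ 2 = dotr x x.
Proof. by rewrite sqr_sqrtr// dotr_ge0. Qed.

Lemma dotrC x y : dotr x y = dotr y x.
Proof. by apply: eq_bigr => i _; rewrite mulrC. Qed.

Lemma dotrD x y : dotr (x + y) (x + y) = dotr x x + 2 * dotr x y + dotr y y.
Proof.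
rewrite /dotr mulr_sumr -!big_split/=; apply: eq_bigr => i _.
rewrite !mxE; ring.
Qed.

Lemma dotrZl (c : R) x y : dotr (c *: x) y = c * dotr x y.
Proof. by rewrite /dotr mulr_sumr; apply: eq_bigr => i _; rewrite !mxE mulrA. Qed.

Lemma dotrZr (c : R) x y : dotr x (c *: y) = c * dotr x y.
Proof. by rewrite dotrC dotrZl dotrC. Qed.

Lemma dotr_basisr x (i : 'I_d) : dotr x (basis_vec i) = x ord0 i.
Proof.
rewrite /dotr (bigD1 i)//= big1 ?addr0; first by rewrite !mxE !eqxx mulr1.
by move=> j ji; rewrite !mxE (negbTE ji) andbF mulr0.
Qed.

Lemma cauchy_schwarz x y : dotr x y <= enorm x * enorm y.
Proof.
have [y0|y0] := eqVneq (enorm y) 0.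
  have yi i : y ord0 i = 0.
    have := sqr_enorm y; rewrite y0 expr0n/= => /esym/eqP.
    rewrite psumr_eq0 => [|j _]; last by rewrite -expr2 sqr_ge0.
    by move=> /allP/(_ i (mem_index_enum _))/=; rewrite mulf_eq0 orbb => /eqP.
  by rewrite y0 mulr0 /dotr big1// => i _; rewrite yi mulr0.
have yp : 0 < enorm y by rewrite lt_def y0 enorm_ge0.
rewrite -(@ler_pM2r _ (enorm y))// -mulrA -expr2.
have [xy0|xy0] := leP (dotr x y) 0.
  apply: (@le_trans _ _ 0); first by rewrite mulr_le0_ge0 ?enorm_ge0.
  by rewrite mulr_ge0 ?enorm_ge0 ?sqr_ge0.
rewrite -ler_sqr ?nnegrE ?mulr_ge0 ?enorm_ge0 ?sqr_ge0 ?(ltW xy0)//.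
(* The squared norm of |y|^2 x - (x.y) y equals |y|^2 (|x|^2 |y|^2 - (x.y)^2); the inequality was
   multiplied by |y| beforehand to match this factor. *)
have := dotr_ge0 (enorm y ^+ 2 *: x + (- dotr x y) *: y).
rewrite dotrD !dotrZl !dotrZr -!sqr_enorm.
set X := enorm x; set Y := enorm y; set D := dotr x y => H.
rewrite -subr_ge0.
apply: le_trans H _; rewrite le_eqVlt; apply/orP; left; apply/eqP; ring.
Qed.

Lemma ler_enormD x y : enorm (x + y) <= enorm x + enorm y.
Proof.
rewrite -ler_sqr ?nnegrE ?addr_ge0 ?enorm_ge0// sqr_enorm dotrD -!sqr_enorm.
have := cauchy_schwarz x y; nra.
Qed.

Lemma enormZ (c : R) x : enorm (c *: x) = `|c| * enorm x.
Proof.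
rewrite /enorm dotrZl dotrZr mulrA -expr2 sqrtrM ?sqr_ge0//.
by rewrite sqrtr_sqr.
Qed.

Lemma enormN x : enorm (- x) = enorm x.
Proof. by rewrite -scaleN1r enormZ normrN normr1 mul1r. Qed.

Lemma enorm_distC x y : enorm (x - y) = enorm (y - x).
Proof. by rewrite -enormN opprB. Qed.

Lemma enorm_le_norm x : enorm x <= d%:R * `|x|.
Proof.
rewrite -ler_sqr ?nnegrE ?enorm_ge0 ?mulr_ge0// sqr_enorm.
have xi i : x ord0 i * x ord0 i <= `|x| ^+ 2.
  rewrite -expr2 -[leLHS]real_normK ?num_real// lerXn2r ?nnegrE//.
  rewrite [leRHS]/Num.norm/= mx_normrE.
  exact: (@le_bigmax _ _ _ _ (fun p : 'I_1 * 'I_d => `|x p.1 p.2|) (ord0, i)).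
apply: le_trans (ler_sum _ (fun i _ => xi i)) _.
rewrite sumr_const card_ord -[leLHS]mulr_natl exprMn ler_wpM2r ?sqr_ge0//.
by rewrite -natrX ler_nat; case: (d) => // n; rewrite leq_pmulr.
Qed.

Lemma continuous_enorm_sub z : continuous (fun x : 'rV[R]_d => enorm (x - z)).
Proof.
move=> x; apply/(@cvgrPdist_lt _ _ _ (nbhs x)) => e e0.
have d1 : 0 < d%:R + 1 :> R by rewrite ltr_wpDl.
have : \forall y \near x, ball x (e / (d%:R + 1)) y.
  by apply: nbhsx_ballx; rewrite divr_gt0.
apply: filterS => y; rewrite -ball_normE/= => xy.
have H : enorm (x - y) < e.
  apply: le_lt_trans (enorm_le_norm _) _.
  rewrite ltr_pdivlMr// in xy; apply: le_lt_trans xy.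
  by rewrite mulrC ler_wpM2l// lerDl.
have h1 := ler_enormD (x - y) (y - z); have h2 := ler_enormD (y - x) (x - z).
rewrite subrKA in h1; rewrite subrKA (enorm_distC y x) in h2.
by rewrite ltr_norml; apply/andP; split; lra.
Qed.

Lemma enorm_compact z (r : R) : compact [set x : 'rV[R]_d | enorm (x - z) <= r].
Proof.
apply: bounded_closed_compact.
  exists (r + `|z|); split; first exact: num_real.
  move=> t rt x /= xr; rewrite -(subrK z x) (le_trans (ler_normD _ _))// (le_trans _ (ltW rt))//.
  by rewrite lerD2r (le_trans (enorm_ge_norm _)).
rewrite (_ : [set x | _] = (fun x => enorm (x - z)) @^-1` [set t : R | t <= r])//.
by apply: preimage_closed; [move=> x _; exact: continuous_enorm_sub|exact: closed_le].
Qed.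

Lemma open_enorm_ball (r : R) : open [set y : 'rV[R]_d | enorm y < r].
Proof.
rewrite (_ : [set y | _] = (fun y : 'rV[R]_d => enorm (y - 0)) @^-1` [set t : R | t < r]).
  by apply: open_comp; [move=> y _; exact: continuous_enorm_sub|exact: open_lt].
by apply/seteqP; split => y /=; rewrite subr0.
Qed.

End enorm_theory.

Section second_derivatives.
Context {R : realType} {d : nat}.
Implicit Types (U : set 'rV[R]_d) (f g : 'rV[R]_d -> R) (j : 'I_d).

(** [W1] vanishes at 0. If w2 were positive, [W1] would be positive just to the right of 0, and [W]
    would exceed its maximum there by the mean value theorem. *)
Lemma second_derivative_max (W W1 : R -> R) (w2 r : R) : 0 < r ->
  (forall t : R, `|t| < r -> is_derive t 1 W (W1 t)) -> is_derive (0 : R) 1 W1 w2 ->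
  (forall t, `|t| < r -> W t <= W 0) -> w2 <= 0.
Proof.
move=> r0 dW [dW1 dW1E] W0; rewrite leNgt; apply/negP => w20.
have W10 : W1 0 = 0.
  have I t : t \in `](- r), r[%R -> `|t| < r by rewrite in_itv/= ltr_norml.
  apply: (@is_derive_unique _ _ W 0 1); first by apply: dW; rewrite normr0.
  apply: (@derive1_at_max _ _ (- r) r); first by lra.
  - by move=> t /I/dW[].
  - by rewrite in_itv/=; lra.
  - by move=> t /I; exact: W0.
have : \forall t \near (0 : R)^', 0 < t^-1 *: (W1 (t *: 1 + 0) - W1 0).
  have L : (fun t : R => t^-1 *: ((W1 \o shift 0) (t *: 1) - W1 0)) @ 0^' --> w2.
    by rewrite -dW1E; exact: dW1.
  exact: (cvgr_gt w2 L).
rewrite near_withinE => /nbhs_ballP[e /= e0 eP].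
have m0 : 0 < Num.min e r by rewrite lt_min e0.
set b := Num.min e r / 2.
have b0 : 0 < b by rewrite divr_gt0.
have be : b < Num.min e r by rewrite /b; lra.
have [be' br] : b < e /\ b < r by move: be; rewrite lt_min => /andP.
have [t||c] := @MVT R W W1 0 b b0.
- by rewrite in_itv/= => /andP[t0 tb]; apply: dW; rewrite gtr0_norm//; lra.
- apply: derivable_within_continuous => t; rewrite in_itv/= => /andP[t0 tb].
  have tr : `|t| < r by rewrite ger0_norm//; lra.
  by have [] := dW t tr.
rewrite in_itv/= => /andP[c0 cb] E.
have := W0 b; rewrite gtr0_norm// => /(_ br).
rewrite -subr_le0 E subr0; apply/negP; rewrite -ltNge mulr_gt0//.
have := eP c; rewrite -ball_normE/= sub0r normrN gtr0_norm// => /(_ (lt_trans cb be')).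
rewrite gt_eqF// => /(_ isT); rewrite W10 subr0 addr0 [_%:A]mulr1.
by rewrite pmulr_rgt0// invr_gt0.
Qed.

(** Both derivatives are explicit parameters, so that those of the auxiliary function in Bernstein's
    method are assembled by the closure lemmas for sums and products. *)
Definition twice_derivable_along U j f (f1 f2 : 'rV[R]_d -> R) := forall y, U y ->
  is_derive y (basis_vec j) f (f1 y) /\ is_derive y (basis_vec j) f1 (f2 y).

Local Notation D2 := twice_derivable_along.

Lemma twice_derivable_alongD U j f f1 f2 g g1 g2 : D2 U j f f1 f2 -> D2 U j g g1 g2 ->
  D2 U j (fun y => f y + g y) (fun y => f1 y + g1 y) (fun y => f2 y + g2 y).
Proof. by move=> fD gD y Uy; have [? ?] := fD y Uy; have [? ?] := gD y Uy; split; exact: is_deriveD. Qed.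

Lemma is_derive_mul f g (y v : 'rV[R]_d) (a b : R) : is_derive y v f a -> is_derive y v g b ->
  is_derive y v (fun x => f x * g x) (a * g y + f y * b).
Proof.
move=> fa gb; have := is_deriveM fa gb; rewrite /GRing.scale/= addrC (mulrC (g y)).
exact.
Qed.

Lemma twice_derivable_alongM U j f f1 f2 g g1 g2 : D2 U j f f1 f2 -> D2 U j g g1 g2 ->
  D2 U j (fun y => f y * g y) (fun y => f1 y * g y + f y * g1 y)
    (fun y => f2 y * g y + 2 * (f1 y * g1 y) + f y * g2 y).
Proof.
move=> fD gD y Uy; have [? ?] := fD y Uy; have [? ?] := gD y Uy.
split; first exact: is_derive_mul.
rewrite (_ : _ + _ = (f2 y * g y + f1 y * g1 y) + (f1 y * g1 y + f y * g2 y)); last by ring.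
by apply: is_deriveD; exact: is_derive_mul.
Qed.

Lemma twice_derivable_along_cst U j (c : R) : D2 U j (cst c) (cst 0) (cst 0).
Proof. by move=> y _; split; exact: is_derive_cst. Qed.

Lemma is_derive_coord (i : 'I_d) j (y a : 'rV[R]_d) :
  is_derive y (basis_vec j) (fun z : 'rV[R]_d => (z - a) ord0 i) (i == j)%:R.
Proof.
apply: (@is_derive_taylor _ _ _ _ _ _ 0) => t _.
rewrite mul0r normr_le0 !mxE eqxx/= eq_sym; apply/eqP; ring.
Qed.

Lemma is_derive_dotr j (a y : 'rV[R]_d) :
  is_derive y (basis_vec j) (fun y => dotr (y - a) (y - a)) (2 * (y - a) ord0 j).
Proof.
apply: (@is_derive_taylor _ _ _ _ _ _ 1) => t _.
rewrite [y + _ - a]addrAC dotrD dotrZr dotr_basisr dotrZl dotrZr dotr_basisr.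
rewrite !mxE !eqxx/= mul1r.
rewrite (_ : _ - _ = t ^+ 2); last by ring.
by rewrite ger0_norm// sqr_ge0.
Qed.

Lemma twice_derivable_along_dotr U j (a : 'rV[R]_d) :
  D2 U j (fun y => dotr (y - a) (y - a)) (fun y => 2 * (y - a) ord0 j) (cst 2).
Proof.
move=> y _; split; first exact: is_derive_dotr.
have := is_derive_mul (is_derive_cst (2 : R) y (basis_vec j)) (is_derive_coord j j y a).
by rewrite eqxx mul0r add0r mulr1.
Qed.

Lemma twice_derivable_along_max U j f f1 f2 x : open U -> U x -> D2 U j f f1 f2 ->
  (\forall y \near x, f y <= f x) -> f2 x <= 0.
Proof.
move=> oU Ux fD fx.
have : \forall y \near x, U y /\ f y <= f x.
  by apply: filterI => //; exact: open_nbhs_nbhs.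
move=> /nbhs_ballP[r /= r0 rP].
have B t : `|t| < r -> ball x r (x + t *: basis_vec j).
  by move=> tr; rewrite -ball_normE/= opprD addrA subrr sub0r normrN
    (le_lt_trans (norm_scale_basis_vec _ _)).
apply: (@second_derivative_max (fun t => f (x + t *: basis_vec j))
  (fun t => f1 (x + t *: basis_vec j)) _ r r0).
- move=> t /B/rP[/fD[fd _] _].
  exact: (is_derive_line f x (basis_vec j) t _).1 fd.
- apply: (is_derive_line f1 x (basis_vec j) 0 _).1.
  by rewrite scale0r addr0; have [] := fD x Ux.
- by move=> t /B/rP[_]; rewrite scale0r addr0.
Qed.

End second_derivatives.

Section bernstein.
Context {R : realType} {d : nat}.
Implicit Types (U : set 'rV[R]_d) (J : seq 'I_d -> 'rV[R]_d -> R).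

Definition helmholtz_jet U J :=
  jet U J /\ forall x, U x -> - (\sum_i J [:: i; i] x) = J [::] x.

(** Three times the factor 13 + 2d of [lam] in the next proof: on the sphere the auxiliary function
    is at most 3 lam M^2. *)
Definition bernstein_cst : R := 39 + 6 * d%:R.

(* Bernstein's method: on the ball of radius r around a, the maximum principle
   is applied to (zeta d_i u)^2 + lam u^2 + mu |x - a|^2, where
   zeta = r^2 - |x - a|^2. *)
Lemma bernstein U J (a : 'rV[R]_d) (r M : R) (i : 'I_d) : open U -> helmholtz_jet U J ->
  0 < r -> r <= 1 -> 0 < M ->
  (forall y, enorm (y - a) <= r -> U y /\ `|J [::] y| <= M) ->
  `|J [:: i] a| <= bernstein_cst * M / r.
Proof.
move=> oU [jJ HJ] r0 r1 M0 K.
(* With 13 + 2d, the term 2 lam v^2 of the Laplacian of [w] cancels the loss (24 + 4d + 2) r^2 v^2;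
   [mu] contributes 2 d mu = 4 d lam M^2, which beats the loss 2 lam u^2 since d >= 1. *)
pose lam : R := (13 + 2 * d%:R) * r ^+ 2; pose mu := 2 * lam * M ^+ 2.
pose Q y := dotr (y - a) (y - a).
pose Z y := r ^+ 2 + (- 1) * Q y.
pose u := J [::]; pose v := J [:: i].
pose w y := (Z y * v y) * (Z y * v y) + (lam * (u y * u y) + mu * Q y).
have lam0 : 0 < lam by rewrite mulr_gt0 ?exprn_gt0// addr_gt0 ?mulr_gt0 ?ltr0n// ltr_wpDr// mulr_ge0.
have d1 : 1 <= d%:R :> R by rewrite ler1n (leq_ltn_trans _ (ltn_ord i)).
have mu0 : 0 < mu by rewrite !mulr_gt0 ?exprn_gt0.
have JD2 s j : twice_derivable_along U j (J s) (J (j :: s)) (J (j :: j :: s)).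
  by move=> y Uy; split; [have [_] := jJ s y Uy|have [_] := jJ (j :: s) y Uy]; exact.
have cD2 j c := @twice_derivable_along_cst R d U j c.
have QD2 j := @twice_derivable_along_dotr R d U j a.
have ZvD2 j := twice_derivable_alongM
  (twice_derivable_alongD (cD2 j (r ^+ 2)) (twice_derivable_alongM (cD2 j (- 1)) (QD2 j)))
  (JD2 [:: i] j).
have wD2 j := twice_derivable_alongD (twice_derivable_alongM (ZvD2 j) (ZvD2 j))
  (twice_derivable_alongD
    (twice_derivable_alongM (cD2 j lam) (twice_derivable_alongM (JD2 [::] j) (JD2 [::] j)))
    (twice_derivable_alongM (cD2 j mu) (QD2 j))).
pose B := [set y : 'rV[R]_d | enorm (y - a) <= r].
have cQ : continuous Q.
  move=> y; rewrite (_ : Q = fun y => enorm (y - a) * enorm (y - a)).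
    by apply: (@continuous_at_mul R 'rV[R]_d (fun z => enorm (z - a))
      (fun z => enorm (z - a))); exact: continuous_enorm_sub.
  by apply/funext => z; rewrite -expr2 sqr_enorm.
have cw : {within B, continuous w}.
  apply: continuous_in_subspaceT => y; rewrite inE => /K[Uy _].
  have cu : {for y, continuous u} by have [] := jJ [::] y Uy.
  have cv : {for y, continuous v} by have [] := jJ [:: i] y Uy.
  have cc (c : R) : {for y, continuous (cst c : 'rV[R]_d -> R)} by exact: cst_continuous.
  have cZv := continuous_at_mul (continuous_at_add (cc (r ^+ 2))
    (continuous_at_mul (cc (- 1)) (cQ y))) cv.
  exact: continuous_at_add (continuous_at_mul cZv cZv) (continuous_at_add
    (continuous_at_mul (cc lam) (continuous_at_mul cu cu)) (continuous_at_mul (cc mu) (cQ y))).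
have Ba : B a by rewrite /B/= subrr enorm0 ltW.
have [|x xB wx] := @compact_EVT_max _ R w B _ (@enorm_compact R d a r) cw.
  by exists a.
have {}wx y : B y -> w y <= w x by move=> By; apply: wx; rewrite inE.
rewrite inE in xB; have [Ux ux] := K _ xB.
have Qx : Q x <= r ^+ 2 by rewrite /Q -sqr_enorm lerXn2r ?nnegrE ?enorm_ge0 ?(ltW r0)//.
have Q0 : 0 <= Q x by exact: dotr_ge0.
have ux2 : u x ^+ 2 <= M ^+ 2.
  by rewrite -[leLHS]real_normK ?num_real// lerXn2r ?nnegrE// ltW.
have wa : (r ^+ 2 * v a) ^+ 2 <= w a.
  rewrite /w /Z /Q subrr -sqr_enorm enorm0 expr0n/= !mulr0 !addr0 -expr2 lerDl.
  by rewrite mulr_ge0 ?(ltW lam0)// -expr2 sqr_ge0.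
have r2 : 0 < r ^+ 2 by rewrite exprn_gt0.
have r21 : r ^+ 2 <= 1 by rewrite exprn_ile1// ltW.
(* On the sphere [Z] vanishes and [w] is bounded by M alone. A maximum inside the ball is
   impossible: the Laplacian of [w] would be positive there. *)
have := xB; rewrite /B /= le_eqVlt => /orP[/eqP xr|xr]; last first.
  exfalso.
  have nx : \forall y \near x, w y <= w x.
    have : \forall y \near x, enorm (y - a) < r.
      exact: (cvgr_lt (enorm (x - a)) (@continuous_enorm_sub R d a x)).
    by apply: filterS => y /ltW; exact: wx.
  pose z j := (x - a) ord0 j.
  (* This is the second derivative of [w] along e_j minus the square 2 (Z v_j - 4 z_j v)^2.
     Completing that square absorbs the cross terms in v_j and turns 8 z_j^2 v^2 into -24 z_j^2
     v^2. *)
  pose L j := (- 24 * v x ^+ 2) * z j ^+ 2 + (- (4 * Z x * v x ^+ 2) + 2 * mu)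
      + 2 * Z x ^+ 2 * v x * J [:: j; j; i] x + 2 * lam * J [:: j] x ^+ 2
      + 2 * lam * u x * J [:: j; j] x.
  have wj j : L j <= 0.
    have := twice_derivable_along_max oU Ux (wD2 j) nx; apply: le_trans.
    rewrite /L /cst -/u -/v -/(Q x) -/(z j) -subr_ge0.
    rewrite (_ : _ - _ =
      2 * (- (4 * z j) * v x + Z x * J [:: j; i] x) ^+ 2); last by rewrite /Z; ring.
    by rewrite mulr_ge0// sqr_ge0.
  clear wD2 ZvD2 QD2; have : \sum_j L j <= 0 by apply: sumr_le0 => j _; exact: wj.
  rewrite !big_split/= -!mulr_sumr !sumr_const !card_ord -(mulr_natr (- _) d) -(mulr_natr M d).
  rewrite (_ : \sum_j z j ^+ 2 = Q x); last by apply: eq_bigr => j _; rewrite expr2.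
  have -> : \sum_j J [:: j; j; i] x = - v x.
    by have := jet_helmholtz [:: i] oU jJ HJ Ux; rewrite -/v => <-; rewrite opprK.
  have -> : \sum_j J [:: j; j] x = - u x by rewrite /u -HJ// opprK.
  have Jv : v x ^+ 2 <= \sum_j J [:: j] x ^+ 2.
    by rewrite (bigD1 i)//= lerDl sumr_ge0// => j _; rewrite sqr_ge0.
  move: Jv; set S := \sum_j _ => Jv.
  have Z0 : 0 <= Z x by rewrite /Z; lra.
  have Zr : Z x <= r ^+ 2 by rewrite /Z; lra.
  have Zr2 : Z x ^+ 2 <= r ^+ 2.
    by rewrite expr2; apply: le_trans (_ : Z x * 1 <= _); [rewrite ler_wpM2l//; lra|lra].
  set V2 := v x ^+ 2; have V20 : 0 <= V2 by rewrite sqr_ge0.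
  apply/negP; rewrite -ltNge.
  apply: (@lt_le_trans _ _ (- ((24 + 4 * d%:R + 2) * r ^+ 2) * V2 + 2 * lam * V2
     - 2 * lam * M ^+ 2 + 4 * lam * M ^+ 2)).
    rewrite (_ : _ + _ = 2 * (lam * M ^+ 2)); last by rewrite /lam; ring.
    by rewrite !mulr_gt0 ?exprn_gt0.
  have e1 : lam * V2 <= lam * S by rewrite ler_wpM2l// ltW.
  have e2 : lam * u x ^+ 2 <= lam * M ^+ 2 by rewrite ler_wpM2l// ltW.
  have e3 : Q x * V2 <= r ^+ 2 * V2 by rewrite ler_wpM2r.
  have e4 : Z x * V2 * d%:R <= r ^+ 2 * V2 * d%:R by rewrite !ler_wpM2r.
  have e5 : Z x ^+ 2 * V2 <= r ^+ 2 * V2 by rewrite ler_wpM2r.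
  have e6 : lam * M ^+ 2 * 1 <= lam * M ^+ 2 * d%:R.
    by rewrite ler_wpM2l// mulr_ge0 ?sqr_ge0// ltW.
  rewrite -/V2 /mu.
  move: e1 e2 e3 e4 e5 e6; rewrite /V2 /mu; clear; lra.
clear wD2 ZvD2 QD2; have Zx : Z x = 0 by rewrite /Z /Q -sqr_enorm xr; ring.
have wxb : w x <= 3 * lam * M ^+ 2.
  rewrite /w Zx mul0r mul0r add0r -expr2.
  have e1 : lam * u x ^+ 2 <= lam * M ^+ 2 by rewrite ler_wpM2l// ltW.
  have e2 : mu * Q x <= mu * 1 by rewrite ler_wpM2l ?(ltW mu0)// (le_trans Qx).
  move: e1 e2; rewrite /mu; clear; lra.
have rv : (r * v a) ^+ 2 <= bernstein_cst * M ^+ 2.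
  rewrite -(ler_pM2l r2); have := le_trans wa (le_trans (wx _ Ba) wxb).
  rewrite /lam /bernstein_cst; clear; lra.
rewrite ler_pdivlMr// -[X in _ * X <= _](gtr0_norm r0) -normrM mulrC.
(* What is known is (r v)^2 <= [bernstein_cst] M^2; a constant at least 1 may replace its own square
   root. *)
have C1 : 1 <= bernstein_cst by rewrite /bernstein_cst; lra.
rewrite -ler_sqr ?nnegrE ?mulr_ge0 ?(ltW M0)//; last by lra.
rewrite real_normK ?num_real// (le_trans rv)// exprMn ler_wpM2r ?sqr_ge0//.
by rewrite expr2 ler_peMl//; lra.
Qed.

Lemma helmholtz_jet_cat U J (s : seq 'I_d) : open U -> helmholtz_jet U J ->
  helmholtz_jet U (fun t => J (t ++ s)).
Proof.
move=> oU [jJ HJ]; split; first by move=> t x Ux; exact: jJ.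
by move=> x Ux; exact: jet_helmholtz oU jJ HJ Ux.
Qed.

(** Each point of the half ball is the centre of a ball of radius r/2 inside the large one, where
    the estimate for s applies. The resulting bound on J s over the half ball feeds Bernstein's
    estimate, since J s solves the same equation. The halvings produce the power of 2 in C. *)
Lemma interior_estimate (s : seq 'I_d) : exists2 C : R, 0 < C &
  forall U J (x : 'rV[R]_d) (r M : R), open U -> helmholtz_jet U J ->
  0 < r -> r <= 1 -> 0 < M ->
  (forall y, enorm (y - x) < r -> U y /\ `|J [::] y| <= M) ->
  `|J s x| <= C * M / r ^+ size s.
Proof.
elim: s => [|i s [C C0 IH]].
  exists 1 => // U J x r M oU _ r0 _ M0 /(_ x); rewrite subrr enorm0 => /(_ r0)[_].
  by rewrite expr0 divr1 mul1r.
have B0 : 0 < bernstein_cst by rewrite /bernstein_cst ltr_pwDl// mulr_ge0.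
exists (bernstein_cst * C * 2 ^+ (size s).+1); first by rewrite !mulr_gt0// exprn_gt0.
move=> U J x r M oU hJ r0 r1 M0 K.
have r20 : 0 < r / 2 by rewrite divr_gt0.
have P0 : 0 < C * M / (r / 2) ^+ size s by rewrite divr_gt0 ?mulr_gt0// exprn_gt0.
have := @bernstein U _ x (r / 2) (C * M / (r / 2) ^+ size s) i oU
  (helmholtz_jet_cat s oU hJ) r20 _ P0.
rewrite /=; move=> /(_ ltac:(lra)) H.
apply: le_trans (H _) _; last first.
  rewrite le_eqVlt; apply/orP; left; apply/eqP.
  rewrite !exprS expr_div_n; field.
  by rewrite expf_neq0 ?gt_eqF// expf_neq0 ?pnatr_eq0// gt_eqF.
move=> y yx; have yr z : enorm (z - y) < r / 2 -> enorm (z - x) < r.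
  move=> zy; have := ler_enormD (z - y) (y - x); rewrite subrKA; lra.
split; first by apply: (K y _).1; lra.
by apply: IH hJ _ _ _ _ => //; [lra|move=> z /yr/K].
Qed.

End bernstein.

(** * Distance to the frontier *)

Section distance_to_frontier.
Context {R : realType} {d : nat}.
Implicit Types (x y z : 'rV[R]_d) (Omega : set 'rV[R]_d).

(** Otherwise the parameters of the points of the segment in Omega form an open and closed subset of
    [0, 1]: if the segment avoids the frontier, Omega and its closure have the same trace on it.
    Connectedness then forces z into Omega. *)
Lemma segment_meets_frontier Omega x z : open Omega -> Omega x -> ~ Omega z ->
  exists2 t : R, 0 <= t <= 1 & frontier Omega (x + t *: (z - x)).
Proof.
move=> oO Ox nOz; apply: contrapT => nF; apply: nOz.
pose g (t : R) := x + t *: (z - x).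
have cg : continuous g.
  by move=> t; apply: cvgD; [exact: cvg_cst|apply: cvgZr_tmp; exact: cvg_id].
have BA : `[0, 1]%classic `&` (g @^-1` Omega) = `[0, 1 : R]%classic.
  apply: (@segment_connected R 0 1).
  - exists 0; split; first by rewrite /= in_itv/= lexx ler01.
    by rewrite /= /g scale0r addr0.
  - by exists (g @^-1` Omega) => //; apply: open_comp => // t _; exact: cg.
  - exists (g @^-1` closure Omega).
      by apply: preimage_closed; [move=> t _; exact: cg|exact: closed_closure].
    apply/seteqP; split => t [t01 Ot]; split => //.
      exact: subset_closure.
    apply: contrapT => nOt; apply: nF; exists t; first by rewrite /= in_itv/= in t01.
    by split => // Oi; apply: nOt; exact: interior_subset Oi.
have : (`[0, 1]%classic `&` (g @^-1` Omega)) (1 : R).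
  by rewrite BA /= in_itv/= lexx ler01.
by move=> [_]; rewrite /= /g scale1r subrKC.
Qed.

Context (Omega : set 'rV[R]_d).
Hypotheses (d0 : (0 < d)%N) (oO : open Omega) (bO : bounded_set Omega).

Local Notation delta := (dist_to (frontier Omega)).

Lemma frontier_nonempty x : Omega x -> frontier Omega !=set0.
Proof.
move=> Ox; have [M [_ HM]] := bO.
(* A point whose sup norm exceeds the bound on Omega; that it is large requires at least one
   coordinate, hence 0 < d. *)
pose z : 'rV[R]_d := const_mx (`|M| + 2).
have nOz : ~ Omega z.
  have M1 : M < `|M| + 1 by rewrite (le_lt_trans (ler_norm M)) ?ltrDl.
  move=> /(HM _ M1)/=; apply/negP; rewrite -ltNge.
  rewrite [ltRHS]/Num.norm/= mx_normrE.
  apply: (@lt_le_trans _ _ `|z ord0 (Ordinal d0)|).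
    by rewrite mxE [ltRHS]ger0_norm ?addr_ge0//; lra.
  exact: (@le_bigmax _ _ _ _ (fun p : 'I_1 * 'I_d => `|z p.1 p.2|) (ord0, _)).
by have [t _ Ft] := segment_meets_frontier oO Ox nOz; eexists; exact: Ft.
Qed.

Let dist_lb x : lbound [set enorm (x - z) | z in frontier Omega] 0.
Proof. by move=> _ [z _ <-]; exact: enorm_ge0. Qed.

Lemma dist_to_le x z : frontier Omega z -> delta x <= enorm (x - z).
Proof. by move=> Fz; apply: ge_inf; [exists 0; exact: dist_lb|exists z]. Qed.

Lemma dist_to_frontier_gt0 x : Omega x -> 0 < delta x.
Proof.
move=> Ox; have : \forall y \near x, Omega y by exact: open_nbhs_nbhs.
move=> /nbhs_ballP[e /= e0 eO]; apply: lt_le_trans e0 _.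
apply: lb_le_inf.
  by have [z Fz] := frontier_nonempty Ox; exists (enorm (x - z)), z.
move=> _ [z [_ Fz] <-]; rewrite leNgt; apply/negP => xz; have Oz : Omega z.
  by apply: eO; rewrite -ball_normE/=; exact: le_lt_trans (enorm_ge_norm _) xz.
have nz : \forall y \near z, Omega y by exact: open_nbhs_nbhs.
exact: Fz nz.
Qed.

(** Otherwise the segment from x to z would meet the frontier at distance at most |z - x| from x. *)
Lemma dist_to_frontier_sub x z : Omega x -> enorm (z - x) < delta x -> Omega z.
Proof.
move=> Ox xz; apply: contrapT => nOz.
have [t /andP[t0 t1] Ft] := segment_meets_frontier oO Ox nOz.
have := dist_to_le x Ft; rewrite opprD addNKr enormN enormZ ger0_norm// => H.
have : t * enorm (z - x) <= enorm (z - x) by rewrite ler_piMl ?enorm_ge0.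
by move=> /(le_trans H); rewrite leNgt xz.
Qed.

Lemma dist_to_frontier_lipschitz x y : Omega x -> delta x <= delta y + enorm (x - y).
Proof.
move=> Ox; rewrite -lerBlDr; apply: lb_le_inf.
  by have [z Fz] := frontier_nonempty Ox; exists (enorm (y - z)), z.
move=> _ [z Fz <-]; rewrite lerBlDr; apply: le_trans (dist_to_le x Fz) _.
by have := ler_enormD (x - y) (y - z); rewrite subrKA; lra.
Qed.

Lemma continuous_dist_to_frontier x : Omega x -> {for x, continuous delta}.
Proof.
move=> Ox; apply/(@cvgrPdist_lt _ _ _ (nbhs x)) => e e0.
have nO : \forall y \near x, Omega y by exact: open_nbhs_nbhs.
have : \forall y \near x, enorm (y - x) < e.
  apply: (cvgr_lt (enorm (x - x)) (@continuous_enorm_sub R d x x)).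
  by rewrite subrr enorm0.
apply: filterS2 nO => y Oy yx.
have h1 := dist_to_frontier_lipschitz y Ox.
have h2 := dist_to_frontier_lipschitz x Oy.
by rewrite enorm_distC in h1; rewrite ltr_norml; apply/andP; split; lra.
Qed.

End distance_to_frontier.

(** * The cutoff *)

Section cutoff_profile.
Context {R : realType} (chi : R -> R).

(** The norm is not differentiable at the origin but its square is: as a function of q = |y|^2 the
    cutoff gets composed with a polynomial. For q <= 0 the square root is 0, where [chi] is 1. *)
Definition cutoff_profile (q : R) : R := chi (Num.sqrt q).

(* Closed under derivation on the positive reals, and made of derivable
   functions: hence all its elements are smooth. *)
Inductive profile_class : (R -> R) -> Prop :=
| profile_chi j : profile_class (fun q => (chi^`(j))%classic (Num.sqrt q))
| profile_invsqrt : profile_class (fun q => (Num.sqrt q)^-1)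
| profile_cst c : profile_class (fun=> c)
| profile_add f g : profile_class f -> profile_class g ->
    profile_class (fun q => f q + g q)
| profile_mul f g : profile_class f -> profile_class g ->
    profile_class (fun q => f q * g q).

Hypothesis cchi : cutoff chi.

Lemma is_derive1_mul (f g : R -> R) (x a b : R) : is_derive x 1 f a -> is_derive x 1 g b ->
  is_derive x 1 (fun y => f y * g y) (a * g x + f x * b).
Proof.
move=> fa gb; have := is_deriveM fa gb; rewrite /GRing.scale/= addrC (mulrC (g x)).
exact.
Qed.

Lemma profile_class_derive f : profile_class f -> exists2 f', profile_class f' &
  forall q : R, 0 < q -> is_derive q 1 f (f' q).
Proof.
have [_ _ dchi _ _] := cchi.
have dsqrt (q : R) : 0 < q -> is_derive q 1 Num.sqrt (2^-1 * (Num.sqrt q)^-1).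
  by move=> q0; have := is_derive1_sqrt q0; rewrite invfM.
elim => [j||c|f1 g1 _ [f' Pf df] _ [g' Pg dg]|f1 g1 P1 [f' Pf df] P2 [g' Pg dg]].
- eexists; last first.
    move=> q q0; apply: is_derive1_comp; last exact: dsqrt.
    have sq : 0 < Num.sqrt q by rewrite sqrtr_gt0.
    by apply: DeriveDef; [exact: dchi|rewrite -derive1E -derive1nS].
  apply: profile_mul; first exact: profile_chi.
  by apply: profile_mul; [exact: profile_cst|exact: profile_invsqrt].
- eexists; last first.
    move=> q q0; have sq : Num.sqrt q != 0 by rewrite gt_eqF// sqrtr_gt0.
    have := @is_derive1_comp R (fun x => x^-1) Num.sqrt q _ _ _ (dsqrt q q0).
    apply; apply: is_deriveV => //; exact: is_derive_id.
  apply: (@profile_mul (fun q => - (Num.sqrt q)^-2 *: 1)); last first.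
    by apply: profile_mul; [exact: profile_cst|exact: profile_invsqrt].
  rewrite (_ : (fun _ => _) = fun q => - 1 * ((Num.sqrt q)^-1 * (Num.sqrt q)^-1)).
    apply: profile_mul; first exact: profile_cst.
    by apply: profile_mul; exact: profile_invsqrt.
  by apply/funext => q; rewrite [_%:A]mulr1 mulN1r -invfM -expr2.
- by exists (fun=> 0); [exact: profile_cst|move=> q _; exact: is_derive_cst].
- exists (fun q => f' q + g' q); first exact: profile_add.
  by move=> q q0; apply: is_deriveD; [exact: df|exact: dg].
- exists (fun q => f' q * g1 q + f1 q * g' q).
    by apply: profile_add; exact: profile_mul.
  by move=> q q0; apply: is_derive1_mul; [exact: df|exact: dg].
Qed.

Lemma near_derive1n (f g : R -> R) (A : set R) : open A -> (forall x, A x -> f x = g x) ->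
  forall j x, A x -> (f^`(j))%classic x = (g^`(j))%classic x.
Proof.
move=> oA fg; elim => [|j IH] x Ax; first exact: fg.
rewrite !derive1nS !derive1E; apply: near_eq_derive.
have : \forall y \near x, A y by exact: open_nbhs_nbhs.
by apply: filterS => y; exact: IH.
Qed.

Lemma derive1n_cst (c : R) j : ((cst c : R -> R)^`(j.+1))%classic = cst 0.
Proof.
elim: j => [|j IH]; last by rewrite derive1nS IH; apply/funext => x; rewrite derive1_cst.
by apply/funext => x; rewrite derive1nS derive1n0 derive1_cst.
Qed.

Lemma profile_derivable j q : derivable (cutoff_profile^`(j))%classic q 1.
Proof.
have [_ _ _ [e e0 chi1] _] := cchi.
have [q0|q0] := ltP 0 q.
  have [f Pf Ef] : exists2 f, profile_class f &
      forall x, 0 < x -> (cutoff_profile^`(j))%classic x = f x.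
    elim: j => [|j [f Pf Ef]].
      by exists (fun q => chi (Num.sqrt q)) => //; exact: (profile_chi 0).
    have [f' Pf' df] := profile_class_derive Pf; exists f' => // x x0.
    rewrite derive1nS derive1E; have [_ <-] := df x x0; apply: near_eq_derive.
    by apply: filterS (lt_nbhsr x0) => y; exact: Ef.
  have [f' Pf' df] := profile_class_derive Pf.
  apply: near_eq_derivable (_ : derivable f q 1); last by have [] := df q q0.
  by apply: filterS (lt_nbhsr q0) => y y0; rewrite Ef.
(* The class only handles q > 0; around any q <= 0 the profile is identically 1. *)
have E x : x < e ^+ 2 -> (cutoff_profile^`(j))%classic x = (cst 1 : R -> R)^`(j)%classic x.
  apply: (@near_derive1n _ _ [set x | x < e ^+ 2]); first exact: open_lt.
  move=> y /= ye; rewrite /cutoff_profile chi1 ?sqrtr_ge0//.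
  have [y0|y0] := leP 0 y; last by rewrite ltr0_sqrtr.
  by rewrite -ltr_sqr ?nnegrE ?sqrtr_ge0 ?(ltW e0)// sqr_sqrtr.
have qe : q < e ^+ 2 by rewrite (le_lt_trans q0)// exprn_gt0.
apply: near_eq_derivable (_ : derivable ((cst 1 : R -> R)^`(j))%classic q 1).
  by apply: filterS (lt_nbhsl qe) => y /E.
case: j {E} => [|j]; first exact: derivable_cst.
by rewrite derive1n_cst; exact: derivable_cst.
Qed.

Lemma profile_is_derive (j : nat) (q : R) :
  is_derive q 1 (cutoff_profile^`(j))%classic ((cutoff_profile^`(j.+1))%classic q).
Proof. by rewrite derive1nS derive1E; apply: derivableP; exact: profile_derivable. Qed.

Lemma profile_continuous j : continuous (cutoff_profile^`(j))%classic.
Proof.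
move=> q; apply/differentiable_continuous/derivable1_diffP; exact: profile_derivable.
Qed.

(** Beyond 1 the profile vanishes on an open set. At q = 1, where [cutoff] does not ask for a zero,
    each derivative is a limit from the right. *)
Lemma profile_eq0 j q : 1 <= q -> (cutoff_profile^`(j))%classic q = 0.
Proof.
have [_ _ _ _ chi0] := cchi.
have E x : 1 < x -> (cutoff_profile^`(j))%classic x = 0.
  have E0 y : 1 < y -> cutoff_profile y = 0.
    move=> y1; rewrite /cutoff_profile chi0// -ltr_sqr ?nnegrE ?sqrtr_ge0//.
    by rewrite sqr_sqrtr ?expr1n// ltW// (lt_trans _ y1).
  move=> x1; rewrite (near_derive1n (open_gt (y := 1)) (g := cst 0) E0)//.
  by case: j => [//|j]; rewrite derive1n_cst.
rewrite le_eqVlt => /orP[/eqP <-|]; last exact: E.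
have c1 : (cutoff_profile^`(j))%classic x @[x --> 1^'+] --> (cutoff_profile^`(j))%classic 1.
  exact: cvg_at_right_filter (@profile_continuous j 1).
apply/esym; apply: (cvg_unique _ _ c1) => //.
apply: (@cvg_trans _ ((cst 0 : R -> R) x @[x --> 1^'+])); last exact: cvg_cst.
apply: near_eq_cvg; near=> x; rewrite E//; by near: x; exact: nbhs_right_gt.
Unshelve. all: by end_near. Qed.

(** All derivatives vanish at 1, so the mean value theorem on [q, 1] trades one more derivative for
    one more power of 1 - q; the case N = 0 is boundedness on [0, 1]. *)
Lemma profile_flat N j : exists2 C : R, 0 <= C & forall q, 0 <= q -> q <= 1 ->
  `|(cutoff_profile^`(j))%classic q| <= C * (1 - q) ^+ N.
Proof.
elim: N j => [|N IH] j.
  have [c _ Hc] := @EVT_max R (fun x => `|(cutoff_profile^`(j))%classic x|) 0 1 ler01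
    (continuous_subspaceT (fun x => continuous_comp (@profile_continuous j x) (@norm_continuous _ _ _))).
  exists `|(cutoff_profile^`(j))%classic c| => // q q0 q1.
  by rewrite expr0 mulr1; apply: Hc; rewrite in_itv/= q0.
have [C C0 HC] := IH j.+1; exists C => // q q0 q1.
have [t _||t] := @MVT_segment R (cutoff_profile^`(j))%classic (cutoff_profile^`(j.+1))%classic q 1 q1.
- exact: profile_is_derive.
- by apply: continuous_subspaceT; exact: profile_continuous.
rewrite in_itv/= (profile_eq0 j (lexx 1)) sub0r => /andP[qt t1] /eqP.
rewrite eqr_oppLR => /eqP ->; rewrite normrN normrM (@ger0_norm _ (1 - q)) ?subr_ge0//.
rewrite exprSr mulrA ler_wpM2r ?subr_ge0//.
apply: le_trans (HC t (le_trans q0 qt) t1) _; rewrite ler_wpM2l//.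
by rewrite lerXn2r ?nnegrE ?subr_ge0// lerD2l lerN2.
Qed.

End cutoff_profile.

(** * Regularity of the cut off waves *)

Section derivatives_of_compositions.
Context {R : realType} {V : normedModType R}.

Lemma is_derive_comp1 (f : V -> R) (g : R -> R) (y v : V) (a b : R) :
  is_derive y v f a -> is_derive (f y) 1 g b ->
  is_derive y v (fun z => g (f z)) (b * a).
Proof.
move=> fa gb.
have fa' : is_derive (y + (0 : R) *: v) v f a by rewrite scale0r addr0.
have := (is_derive_line f y v 0 a).1 fa'.
move=> /(@is_derive1_comp R g (fun s => f (y + s *: v)) 0 b a).
rewrite scale0r addr0 => /(_ gb) H.
have := (is_derive_line (fun z => g (f z)) y v 0 (b * a)).2 H.
by rewrite scale0r addr0.
Qed.

Lemma is_derive_scale_dom (f : V -> R) (y v : V) (c a : R) :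
  is_derive (c *: y) v f a -> is_derive y v (fun z => f (c *: z)) (c * a).
Proof.
move=> /(is_derive_scale_dir c) fa.
have fa' : is_derive (c *: y + (0 : R) *: (c *: v)) (c *: v) f (c * a).
  by rewrite scale0r addr0.
have H := (is_derive_line f (c *: y) (c *: v) 0 (c * a)).1 fa'.
have E : (fun s : R => f (c *: y + s *: (c *: v))) = fun s => f (c *: (y + s *: v)).
  by apply/funext => s; rewrite scalerDr !scalerA mulrC.
rewrite E in H.
have := (is_derive_line (fun z => f (c *: z)) y v 0 (c * a)).2 H.
by rewrite scale0r addr0.
Qed.

End derivatives_of_compositions.

Section cut_off_wave.
Context {R : realType} {d : nat}.
Implicit Types (x y z : 'rV[R]_d) (s : seq 'I_d).
Context (Omega V : set 'rV[R]_d) (J : seq 'I_d -> 'rV[R]_d -> R) (M : R)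
  (alpha : 'rV[R]_d -> 'rV[R]_d) (rho : 'rV[R]_d -> R) (chi : R -> R).
Hypotheses (oV : open V) (hJ : helmholtz_jet V J) (M0 : 0 < M)
  (JM : forall z, V z -> `|J [::] z| <= M)
  (oO : open Omega)
  (alphaC : forall x, Omega x -> {for x, continuous alpha})
  (rhoC : forall x, Omega x -> {for x, continuous rho})
  (rho0 : forall x, Omega x -> 0 < rho x)
  (ballV : forall x z, Omega x -> enorm (z - alpha x) < rho x -> V z)
  (cchi : cutoff chi).

Let g j : R -> R := (cutoff_profile chi)^`(j)%classic.
Let ratio x y := dotr y y / rho x ^+ 2.

(** The values of [J s] off V are arbitrary, but for x in Omega the point alpha x + y leaves V only
    when the ratio is at least 1, where the second factor vanishes. *)
Definition cut_wave s j x y : R := J s (alpha x + y) * g j (ratio x y).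

(* Closed under derivation in y, and made of jointly continuous functions, even
   where the support of the cutoff touches the frontier. *)
Inductive cut_class : ('rV[R]_d -> 'rV[R]_d -> R) -> Prop :=
| cut_gen s j : cut_class (cut_wave s j)
| cut_add S T : cut_class S -> cut_class T -> cut_class (fun x y => S x y + T x y)
| cut_coord i T : cut_class T -> cut_class (fun x y => T x y * y ord0 i)
| cut_scale c T : cut_class T -> cut_class (fun x y => c * T x y)
| cut_rho T : cut_class T -> cut_class (fun x y => T x y * (rho x ^+ 2)^-1).

Let ratio_ge0 x y : Omega x -> 0 <= ratio x y.
Proof. by move=> /rho0 r0; rewrite divr_ge0 ?dotr_ge0 ?sqr_ge0. Qed.

Let ratio_sqrt x y : Omega x -> enorm y = rho x * Num.sqrt (ratio x y).
Proof.
move=> /rho0 r0; rewrite /ratio sqrtrM ?dotr_ge0// sqrtrV ?sqr_ge0//.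
by rewrite sqrtr_sqr gtr0_norm// -/(enorm y) mulrCA divff ?mulr1// gt_eqF.
Qed.

(** With s the square root of the ratio, (1 - s^2)/2 + s <= 1 amounts to (1 - s)^2 >= 0. The room
    left around alpha x + y is thus linear in 1 - ratio, which makes the blow up of the derivatives
    polynomial. *)
Let ratio_lt1 x y : Omega x -> ratio x y < 1 ->
  forall z, enorm (z - (alpha x + y)) < Num.min 1 (rho x) * ((1 - ratio x y) / 2) -> V z.
Proof.
move=> Ox q1 z zy; apply: (ballV Ox).
have r0 := rho0 Ox; have q0 := ratio_ge0 y Ox.
have -> : z - alpha x = (z - (alpha x + y)) + y by rewrite opprD addrA subrK.
apply: le_lt_trans (ler_enormD _ _) _.
rewrite (ratio_sqrt y Ox); set s := Num.sqrt _.
have s0 : 0 <= s by exact: sqrtr_ge0.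
have sq : ratio x y = s ^+ 2 by rewrite sqr_sqrtr.
apply: (@lt_le_trans _ _ (rho x * ((1 - ratio x y) / 2) + rho x * s)).
  rewrite ltrD2r (lt_le_trans zy)// ler_wpM2r ?ge_min ?lexx ?orbT//.
  by rewrite divr_ge0// subr_ge0 ltW.
rewrite -mulrDr ler_piMr ?(ltW r0)// sq.
have : 0 <= (1 - s) ^+ 2 by rewrite sqr_ge0.
lra.
Qed.

Let ratio_lt1V x y : Omega x -> ratio x y < 1 -> V (alpha x + y).
Proof.
move=> Ox q1; apply: (ratio_lt1 Ox q1); rewrite subrr enorm0.
by rewrite mulr_gt0 ?lt_min ?ltr01 ?rho0// divr_gt0// subr_gt0.
Qed.

(* The blow up of the derivatives of the wave at the boundary of the ball is
   compensated by the flatness of the cutoff. *)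
Lemma cut_wave_bound s j : exists2 C : R, 0 <= C & forall x y, Omega x ->
  `|cut_wave s j x y| <=
    C / Num.min 1 (rho x) ^+ size s * Num.max 0 (1 - ratio x y) ^+ 2.
Proof.
have [C1 C10 H1] := @interior_estimate R d s.
(* Of these orders of flatness, [size s] cancel the power of 1 - ratio lost in the interior
   estimate; the other two give differentiability, beyond continuity, at the edge of the cutoff. *)
have [C2 C20 H2] := profile_flat cchi (size s).+2 j.
exists (C1 * M * 2 ^+ size s * C2); first by rewrite !mulr_ge0 ?exprn_ge0// ltW.
move=> x y Ox; have r0 := rho0 Ox; have q0 := ratio_ge0 y Ox.
have m0 : 0 < Num.min 1 (rho x) by rewrite lt_min ltr01.
have [q1|q1] := leP 1 (ratio x y).
  rewrite /cut_wave /g profile_eq0// mulr0 normr0.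
  by rewrite mulr_ge0 ?sqr_ge0// divr_ge0 ?exprn_ge0 ?(ltW m0)// !mulr_ge0 ?exprn_ge0// ltW.
have p0 : 0 < 1 - ratio x y by rewrite subr_gt0.
rewrite (max_r (ltW p0)) /cut_wave normrM.
set k := Num.min 1 (rho x) * ((1 - ratio x y) / 2).
have k0 : 0 < k by rewrite mulr_gt0// divr_gt0.
have k1 : k <= 1.
  rewrite /k mulr_ile1 ?(ltW m0) ?ge_min ?lexx//; first by rewrite divr_ge0// ltW.
  by lra.
have E1 : `|J s (alpha x + y)| <= C1 * M / k ^+ size s.
  apply: H1 hJ _ _ _ _ => // z zk; have Vz := ratio_lt1 Ox q1 zk.
  by split=> //; exact: JM.
have E2 := H2 _ q0 (ltW q1).
apply: le_trans (ler_pM _ _ E1 E2) _ => //.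
rewrite le_eqVlt; apply/orP; left; apply/eqP.
rewrite /k exprMn expr_div_n !exprS; field.
by rewrite !expf_neq0 ?pnatr_eq0// gt_eqF.
Qed.

Let continuous_ratio x y : Omega x ->
  {for (x, y), continuous (fun p : 'rV[R]_d * 'rV[R]_d => ratio p.1 p.2)}.
Proof.
move=> Ox; have r0 := rho0 Ox.
have cy : {for (x, y), continuous (fun p : 'rV[R]_d * 'rV[R]_d => enorm p.2)}.
  have E := @continuous_enorm_sub R d 0 y.
  apply: (@continuous_comp _ _ _ (fun p : 'rV[R]_d * 'rV[R]_d => p.2) (@enorm R d)).
    exact: cvg_snd.
  by move: E; under [fun z => _]eq_fun do rewrite subr0; exact.
have cr : {for (x, y), continuous (fun p : 'rV[R]_d * 'rV[R]_d => (rho p.1)^-1)}.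
  apply: (@cvgV _ _ (nbhs (x, y)) _ (fun p => rho p.1)); first by rewrite gt_eqF.
  apply: (@continuous_comp _ _ _ (fun p : 'rV[R]_d * 'rV[R]_d => p.1) rho).
    exact: cvg_fst.
  exact: rhoC.
have := continuous_at_mul (continuous_at_mul cy cy) (continuous_at_mul cr cr).
rewrite [X in {for _, continuous X} -> _](_ : _ = fun p => ratio p.1 p.2)//.
by apply/funext => p; rewrite /ratio -expr2 sqr_enorm -expr2 exprVn.
Qed.

Lemma continuous_cut_wave s j x y : Omega x ->
  {for (x, y), continuous (fun p : 'rV[R]_d * 'rV[R]_d => cut_wave s j p.1 p.2)}.
Proof.
move=> Ox; have cq := @continuous_ratio x y Ox; have r0 := rho0 Ox.
have cfst : {for (x, y), continuous (fun p : 'rV[R]_d * 'rV[R]_d => p.1)} by exact: cvg_fst.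
have csnd : {for (x, y), continuous (fun p : 'rV[R]_d * 'rV[R]_d => p.2)} by exact: cvg_snd.
have [q1|q1] := ltP (ratio x y) 1.
  apply: continuous_at_mul; last first.
    exact: (continuous_comp cq (@profile_continuous R chi cchi j _)).
  apply: (@continuous_comp _ _ _ (fun p : 'rV[R]_d * 'rV[R]_d => alpha p.1 + p.2) (J s)).
    apply: (@cvgD _ _ _ (nbhs (x, y))) => //.
    exact: (continuous_comp cfst (alphaC Ox)).
  by have [] := hJ.1 s _ (ratio_lt1V Ox q1).
have [C C0 HC] := cut_wave_bound s j.
(* Where the ratio is at least 1 the wave itself may be singular. The product is squeezed instead by
   its bound, which is jointly continuous and vanishes at this point. *)
pose B (p : 'rV[R]_d * 'rV[R]_d) := C * (Num.min 1 (rho p.1) ^+ size s)^-1 *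
  Num.max 0 (1 - ratio p.1 p.2) ^+ 2.
have cB : {for (x, y), continuous B}.
  have cr : {for (x, y), continuous (fun p : 'rV[R]_d * 'rV[R]_d => rho p.1)}.
    exact: (continuous_comp cfst (rhoC Ox)).
  have cc (c : R) : {for (x, y), continuous (cst c : 'rV[R]_d * 'rV[R]_d -> R)}.
    exact: cst_continuous.
  have cm : {for (x, y), continuous (fun p : 'rV[R]_d * 'rV[R]_d => Num.min 1 (rho p.1))}.
    exact: (@continuous_min _ _ (cst 1) (fun p => rho p.1) (x, y) (cc 1) cr).
  have cM : {for (x, y), continuous (fun p : 'rV[R]_d * 'rV[R]_d =>
      Num.max 0 (1 + -1 * ratio p.1 p.2))}.
    exact: (@continuous_max _ _ (cst 0) _ (x, y) (cc 0)
      (continuous_at_add (cc 1) (continuous_at_mul (cc (-1)) cq))).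
  have cX n (f : 'rV[R]_d * 'rV[R]_d -> R) : {for (x, y), continuous f} ->
      {for (x, y), continuous (fun p => f p ^+ n)}.
    by move=> cf; exact: (@continuous_comp _ _ _ f (fun r : R => r ^+ n) _ cf
      (@exprn_continuous R n _)).
  have cV : {for (x, y), continuous (fun p : 'rV[R]_d * 'rV[R]_d =>
      (Num.min 1 (rho p.1) ^+ size s)^-1)}.
    apply: (@cvgV _ _ (nbhs (x, y)) _ (fun p => Num.min 1 (rho p.1) ^+ size s)).
      by rewrite /= expf_neq0// gt_eqF// lt_min ltr01.
    exact: (cX _ _ cm).
  have := continuous_at_mul (continuous_at_mul (cc C) cV) (cX 2 _ cM).
  rewrite [X in {for _, continuous X} -> _](_ : _ = B)//.
  by apply/funext => p; rewrite /B mulN1r.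
have B0 : B (x, y) = 0 by rewrite /B /= max_l ?expr0n ?mulr0// subr_le0.
have E0 : cut_wave s j x y = 0 by rewrite /cut_wave /g profile_eq0// mulr0.
rewrite /prop_for /continuous_at /= E0.
apply: (@squeeze_cvgr _ (nbhs (x, y)) _ R (fun p => - B p) B).
- have nO : \forall p \near (x, y), Omega p.1.
    by apply: cfst; exact: open_nbhs_nbhs.
  by apply: filterS nO => p Op; rewrite -ler_norml; exact: HC.
- by rewrite -oppr0 -B0; apply: (@cvgN _ _ _ (nbhs (x, y))); exact: cB.
- by rewrite -B0; exact: cB.
Qed.

Lemma is_derive_cut_wave s j i x y : Omega x ->
  is_derive y (basis_vec i) (cut_wave s j x)
    (cut_wave (i :: s) j x y + 2 * (cut_wave s j.+1 x y * y ord0 i * (rho x ^+ 2)^-1)).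
Proof.
move=> Ox; have r0 := rho0 Ox; have r20 : 0 < rho x ^+ 2 by rewrite exprn_gt0.
have [q1|q1] := ltP (ratio x y) 1.
  have dJ : is_derive y (basis_vec i) (fun z => J s (alpha x + z)) (J (i :: s) (alpha x + y)).
    apply/(is_derive_shift_dom (J s) y (basis_vec i) _ (alpha x)).
    by have [_] := hJ.1 s _ (ratio_lt1V Ox q1); exact.
  have dq : is_derive y (basis_vec i) (ratio x) (2 * y ord0 i * (rho x ^+ 2)^-1).
    have dd : is_derive y (basis_vec i) (fun z => dotr z z) (2 * y ord0 i).
      have -> : (fun z => dotr z z) = (fun z : 'rV[R]_d => dotr (z - 0) (z - 0)).
        by apply/funext => z; rewrite subr0.
      by rewrite -[in 2 * _](subr0 y); exact: is_derive_dotr.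
    have := is_derive_mul dd (is_derive_cst ((rho x ^+ 2)^-1) y (basis_vec i)).
    by rewrite mulr0 addr0.
  have dg := is_derive_comp1 dq (profile_is_derive cchi j (ratio x y)).
  by apply: is_derive_eq (is_derive_mul dJ dg) _; rewrite /cut_wave /g; ring.
have -> : cut_wave (i :: s) j x y + 2 * (cut_wave s j.+1 x y * y ord0 i * (rho x ^+ 2)^-1) = 0.
  by rewrite /cut_wave /g !profile_eq0//; ring.
have [C C0 HC] := cut_wave_bound s j.
set K := C / Num.min 1 (rho x) ^+ size s.
have K0 : 0 <= K.
  by rewrite divr_ge0// exprn_ge0// le_min ler01 ltW.
(* The cut off wave vanishes at y. Moving by t e_i changes |y|^2 by 2 t y_i + t^2, so that 1 - ratio
   is at most (2 |y_i| + 1) |t| / rho^2, whose square is a quadratic remainder. *)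
apply: (@is_derive_taylor _ _ _ _ _ _ (K * ((2 * `|y ord0 i| + 1) / rho x ^+ 2) ^+ 2)) => t t1.
have -> : cut_wave s j x y = 0 by rewrite /cut_wave /g profile_eq0// mulr0.
rewrite mulr0 !subr0; apply: le_trans (HC x _ Ox) _; rewrite -/K -mulrA ler_wpM2l//.
rewrite -[t ^+ 2]real_normK ?num_real// -exprMn lerXn2r ?nnegrE ?le_max ?lexx//.
  by rewrite mulr_ge0// divr_ge0 ?(ltW r20)// addr_ge0// mulr_ge0.
have A0 : 0 <= (2 * `|y ord0 i| + 1) / rho x ^+ 2 * `|t|.
  by rewrite mulr_ge0// divr_ge0 ?(ltW r20)// addr_ge0// mulr_ge0.
rewrite ge_max A0/=.
rewrite /ratio dotrD dotrZr dotr_basisr dotrZl dotrZr dotr_basisr mxE !eqxx mulr1.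
apply: (@le_trans _ _ ((2 * `|y ord0 i| * `|t| + `|t| * `|t|) / rho x ^+ 2)); last first.
  by rewrite [leRHS]mulrAC ler_pM2r ?invr_gt0// [leRHS]mulrDl mul1r lerD2l ler_piMr.
apply: (@le_trans _ _ (- (2 * (t * y ord0 i) + t * t) / rho x ^+ 2)).
  rewrite -subr_ge0 (_ : _ - _ = dotr y y / rho x ^+ 2 - 1).
    by rewrite subr_ge0.
  by field; rewrite gt_eqF.
rewrite ler_pM2r ?invr_gt0// (le_trans (ler_norm _))// normrN.
rewrite (le_trans (ler_normD _ _))// !normrM (ger0_norm (ler0n _ 2)).
by rewrite [`|t| * `|y ord0 i|]mulrC mulrA.
Qed.

Lemma cut_class_derive T i : cut_class T -> exists2 T', cut_class T' &
  forall x y, Omega x -> is_derive y (basis_vec i) (T x) (T' x y).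
Proof.
elim => [s j|S T0 _ [S' cS dS] _ [T' cT dT]|k T0 cT0 [T' cT dT]|c T0 _ [T' cT dT]|
  T0 _ [T' cT dT]].
- eexists; last by move=> x y Ox; exact: is_derive_cut_wave.
  by apply: cut_add; [exact: cut_gen|apply: cut_scale; apply: cut_rho; apply: cut_coord; exact: cut_gen].
- exists (fun x y => S' x y + T' x y); first exact: cut_add.
  by move=> x y Ox; apply: is_deriveD; [exact: dS|exact: dT].
- exists (fun x y => T' x y * y ord0 k + (k == i)%:R * T0 x y).
    by apply: cut_add; [exact: cut_coord|exact: cut_scale].
  move=> x y Ox.
  have dk : is_derive y (basis_vec i) (fun z : 'rV[R]_d => z ord0 k) (k == i)%:R.
    have -> : (fun z => z ord0 k) = (fun z : 'rV[R]_d => (z - 0) ord0 k).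
      by apply/funext => z; rewrite subr0.
    exact: is_derive_coord.
  have := is_derive_mul (dT x y Ox) dk.
  by rewrite [T0 x y * _]mulrC.
- exists (fun x y => c * T' x y); first exact: cut_scale.
  move=> x y Ox; have := is_derive_mul (is_derive_cst c y (basis_vec i)) (dT x y Ox).
  by rewrite mul0r add0r.
- exists (fun x y => T' x y * (rho x ^+ 2)^-1); first exact: cut_rho.
  move=> x y Ox.
  have := is_derive_mul (dT x y Ox) (is_derive_cst ((rho x ^+ 2)^-1) y (basis_vec i)).
  by rewrite mulr0 addr0.
Qed.

Lemma cut_class_continuous T x y : cut_class T -> Omega x ->
  {for (x, y), continuous (fun p : 'rV[R]_d * 'rV[R]_d => T p.1 p.2)}.
Proof.
move=> + Ox; elim => [s j|S T0 _ cS _ cT|k T0 _ cT|c T0 _ cT|T0 _ cT].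
- exact: continuous_cut_wave.
- exact: continuous_at_add cS cT.
- apply: continuous_at_mul cT _.
  apply: (@continuous_comp _ _ _ (fun p : 'rV[R]_d * 'rV[R]_d => p.2)
    (fun v : 'rV[R]_d => v ord0 k)); first exact: cvg_snd.
  exact: coord_continuous.
- by apply: continuous_at_mul cT; exact: cst_continuous.
- apply: continuous_at_mul cT _.
  apply: (@continuous_comp _ _ _ (fun p : 'rV[R]_d * 'rV[R]_d => p.1)
    (fun v : 'rV[R]_d => (rho v ^+ 2)^-1)); first exact: cvg_fst.
  apply: (@cvgV _ _ (nbhs x) _ (fun v => rho v ^+ 2)).
    by rewrite /= expf_neq0// gt_eqF// rho0.
  exact: (@continuous_comp _ _ _ rho (fun r : R => r ^+ 2) _ (rhoC Ox)
    (@exprn_continuous R 2 _)).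
Qed.

(** Choosing within the class a derivative of each member in each direction, and iterating, yields a
    jet on the whole space made of jointly continuous functions; [jet_smooth] identifies it with
    [pderivs]. *)
Lemma cut_class_smooth T : cut_class T ->
  (forall x, Omega x -> smooth_on setT (T x)) /\
  forall s x y, Omega x ->
    {for (x, y), continuous (fun p : 'rV[R]_d * 'rV[R]_d => pderivs s (T p.1) p.2)}.
Proof.
move=> cT.
have /choice[D HD] : forall iS : 'I_d * ('rV[R]_d -> 'rV[R]_d -> R), exists T',
    cut_class iS.2 -> cut_class T' /\
    forall x y, Omega x -> is_derive y (basis_vec iS.1) (iS.2 x) (T' x y).
  move=> [i S]; have [cS|] := pselect (cut_class S); last by exists S.
  by have [T' ? ?] := cut_class_derive i cS; exists T'.
pose K s := foldr (fun i S => D (i, S)) T s.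
have cK s : cut_class (K s).
  by elim: s => //= i s IH; have [] := HD (i, K s) IH.
have jK x : Omega x -> jet setT (fun s => K s x).
  move=> Ox s y _; split.
    have c2 : {for y, continuous (fun y => (x, y))}.
      apply: (@cvg_pair _ _ _ (nbhs y) (nbhs x) (nbhs y) _ _ _ (fun=> x) id); [exact: cvg_cst|exact: cvg_id].
    exact: (@continuous_comp _ _ _ (fun y => (x, y)) (fun p => K s p.1 p.2) y
      c2 (@cut_class_continuous (K s) x y (cK s) Ox)).
  by move=> i; have [_] := HD (i, K s) (cK s); apply.
have S x : Omega x -> smooth_on setT (T x) /\ forall s y, setT y -> pderivs s (T x) y = K s x y.
  by move=> Ox; apply: jet_smooth (jK x Ox) _ => //; exact: openT.
split=> [x /S[]//|s x y Ox].
have := @cut_class_continuous (K s) x y (cK s) Ox.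
rewrite /prop_for /continuous_at /= (S x Ox).2//.
apply: cvg_trans; apply: near_eq_cvg.
have nO : \forall p \near (x, y), Omega p.1.
  have cfst : {for (x, y), continuous (fun p : 'rV[R]_d * 'rV[R]_d => p.1)} by exact: cvg_fst.
  by apply: cfst; exact: open_nbhs_nbhs.
by apply: filterS nO => p Op; rewrite (S _ Op).2.
Qed.

End cut_off_wave.

(** * Convergence and evaluation in C^k *)

Section convergence_in_Ck.
Context {R : realType} {d k : nat}.

(** Compactness of closed balls turns the local condition into uniform convergence on them, and
    there are finitely many s of length at most k. *)
Lemma Ck_cvg {I : Type} (F : set_system I) {FF : Filter F}
    (f : I -> Ck_space R d k) (f0 : Ck_space R d k) :
  (forall s, (size s <= k)%N -> forall (y : 'rV[R]_d) (e : R), 0 < e ->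
    \forall y' \near y & i \near F, `|pderivs s f0 y' - pderivs s (f i) y'| < e) ->
  f i @[i --> F] --> f0.
Proof.
move=> H; apply/cvg_ballP => eps eps0.
(* As in the distance, e is both the precision and the inverse of the radius. The supremum is kept
   below e/2, hence strictly below e, itself strictly below eps. *)
pose e := eps / 2; have e0 : 0 < e by rewrite divr_gt0.
have e20 : 0 < e / 2 by rewrite divr_gt0.
pose K := [set x : 'rV[R]_d | enorm (x - 0) <= e^-1].
have cK : near_covering K by apply/compact_near_coveringP/enorm_compact.
have Hs s : (size s <= k)%N ->
    \forall i \near F, K `<=` [set y | `|pderivs s f0 y - pderivs s (f i) y| < e / 2].
  by move=> sk; apply: cK => x _; exact: H.
have : \forall i \near F, forall (n : 'I_k.+1) (s : n.-tuple 'I_d),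
    K `<=` [set y | `|pderivs s f0 y - pderivs s (f i) y| < e / 2].
  apply: filter_forall => n; apply: filter_forall => s; apply: Hs.
  by rewrite size_tuple -ltnS.
apply: filterS => i Hi; rewrite ballEmdist /=.
apply: (@le_lt_trans _ _ e); last by rewrite /e; lra.
apply: ge_inf; first by exists 0 => x [/ltW].
split => //; apply: (@le_lt_trans _ _ (e / 2)%:E); last by rewrite lte_fin; lra.
apply: ge_ereal_sup => _ [s [x [sk xe ->]]]; rewrite lee_fin.
rewrite (pderivsB (Ck_funP f0) (Ck_funP (f i)))//=.
have ss : (size s < k.+1)%N by rewrite ltnS.
apply: ltW; apply: (Hi (Ordinal ss) (in_tuple s)).
by rewrite /K /= subr0 ltW.
Qed.

Lemma Ck_eval0_continuous : continuous (fun f : Ck_space R d k => f 0).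
Proof.
move=> f; apply/(@cvgrPdist_lt _ _ _ (nbhs f)) => e e0.
have := nbhsx_ballx f e e0.
apply: filterS => g; rewrite ballEmdist /= => /inf_lt[|a [a0 fga] ae].
  (* The infimum must be over a nonempty set: the sum of bounds for both functions on the unit ball,
     plus 1, belongs to it, as the corresponding radius is at most 1. *)
  have [M fM] := pderivs_bounded (Ck_funP f); have [N gN] := pderivs_bounded (Ck_funP g).
  have MN0 : 0 <= `|M| + `|N| by rewrite addr_ge0.
  exists (`|M| + `|N| + 1); split; first by rewrite ltr_pwDr.
  apply: (@le_lt_trans _ _ (`|M| + `|N|)%:E); last by rewrite lte_fin ltrDl.
  apply: ge_ereal_sup => _ [s [x [sk xr ->]]]; rewrite lee_fin.
  have x1 : enorm x <= 1.
    by rewrite (le_trans (ltW xr))// invf_le1 ?lerDr// ltr_pwDr.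
  rewrite (pderivsB (Ck_funP f) (Ck_funP g))//= (le_trans (ler_normB _ _))// lerD//.
    by rewrite (le_trans (fM _ _ sk x1))// ler_norm.
  by rewrite (le_trans (gN _ _ sk x1))// ler_norm.
apply: lt_trans ae; rewrite -lte_fin; apply: le_lt_trans fga.
by apply: ereal_sup_ubound; exists [::], 0; rewrite enorm0 invr_gt0.
Qed.

End convergence_in_Ck.

(** * Rescaling eigenfunctions to frequency 1 *)

Section rescaled_waves.
Context {R : realType} {d : nat}.
Implicit Types (x y z : 'rV[R]_d) (s : seq 'I_d).
Context (Omega : set 'rV[R]_d) (phi : 'rV[R]_d -> R) (h : R) (chi : R -> R).
Hypotheses (oO : open Omega) (sphi : smooth_on Omega phi) (h0 : 0 < h)
  (ephi : forall x, Omega x -> - (h ^+ 2 * laplacian phi x) = phi x).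

Lemma continuous_scale (c : R) : continuous (fun z : 'rV[R]_d => c *: z).
Proof. by move=> z; exact: (@cvgZl_tmp _ _ _ (nbhs z) _ c id z cvg_id). Qed.

Definition scaled_domain : set 'rV[R]_d := (fun z => h *: z) @^-1` Omega.

(** The derivatives of phi(h z) in z, by the chain rule. In this variable the equation no longer
    involves h, so the estimates are uniform in n. *)
Definition scaled_jet s z : R := h ^+ size s * pderivs s phi (h *: z).

Lemma open_scaled_domain : open scaled_domain.
Proof.
by apply: open_comp => // z _; exact: continuous_scale.
Qed.

Lemma scaled_jet_helmholtz : helmholtz_jet scaled_domain scaled_jet.
Proof.
split=> [s z Vz|z Vz].
  have [cs ds] := smooth_jet sphi s Vz; split.
    have cc : {for z, continuous (cst (h ^+ size s) : 'rV[R]_d -> R)} by exact: cst_continuous.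
    exact: continuous_at_mul cc (@continuous_comp _ _ _ (fun z : 'rV[R]_d => h *: z)
      (pderivs s phi) z (@continuous_scale h z) cs).
  move=> i; rewrite /scaled_jet /=.
  have := is_derive_mul (is_derive_cst (h ^+ size s) z (basis_vec i))
    (is_derive_scale_dom (ds i)).
  by rewrite mul0r add0r exprSr mulrA.
by rewrite /scaled_jet /= -mulr_sumr expr0 mul1r; exact: ephi.
Qed.

Context (M : R).
Hypotheses (d0 : (0 < d)%N) (bO : bounded_set Omega) (cchi : cutoff chi) (M0 : 0 < M)
  (phiM : forall x, Omega x -> `|phi x| <= M).

Lemma rescaled_smooth :
  (forall x, Omega x -> smooth_on setT (rescaled Omega chi h phi x)) /\
  forall s x y, Omega x -> {for (x, y), continuous
    (fun p : 'rV[R]_d * 'rV[R]_d => pderivs s (rescaled Omega chi h phi p.1) p.2)}.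
Proof.
(* Then x + h y = h (alpha x + y), and the argument of the cutoff becomes |y| / rho x. *)
pose alpha x := h^-1 *: x; pose rho x := dist_to (frontier Omega) x / h.
have hn0 : h != 0 by rewrite gt_eqF.
have hV0 : 0 < h^-1 by rewrite invr_gt0.
have alphaC x : Omega x -> {for x, continuous alpha}.
  by move=> _; exact: continuous_scale.
have rhoC x : Omega x -> {for x, continuous rho}.
  move=> Ox; apply: continuous_at_mul; last exact: cst_continuous.
  exact: continuous_dist_to_frontier.
have rho0 x : Omega x -> 0 < rho x.
  by move=> Ox; rewrite divr_gt0// dist_to_frontier_gt0.
have ballV x z : Omega x -> enorm (z - alpha x) < rho x -> scaled_domain z.
  move=> Ox zx; apply: (dist_to_frontier_sub oO Ox).
  rewrite /rho ltr_pdivlMr// in zx; apply: le_lt_trans zx.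
  rewrite -[X in _ <= _ * X]gtr0_norm// mulrC -enormZ scalerBr /alpha scalerA.
  by rewrite divff// scale1r.
have JM z : scaled_domain z -> `|scaled_jet [::] z| <= M.
  by move=> Vz; rewrite /scaled_jet expr0 mul1r phiM.
have E x : Omega x -> rescaled Omega chi h phi x = cut_wave scaled_jet alpha rho chi [::] 0 x.
  move=> Ox; apply/funext => y; rewrite /rescaled /cut_wave /scaled_jet expr0 mul1r.
  rewrite scalerDr /alpha scalerA divff// scale1r derive1n0 /cutoff_profile.
  rewrite sqrtrM ?dotr_ge0// sqrtrV ?sqr_ge0// sqrtr_sqr (gtr0_norm (rho0 x Ox)).
  by congr (_ * chi _); rewrite -/(enorm y) /rho; field; rewrite hn0 gt_eqF ?dist_to_frontier_gt0.
have [S1 S2] := cut_class_smooth open_scaled_domain scaled_jet_helmholtz M0 JM oO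
  alphaC rhoC rho0 ballV cchi (@cut_gen R d scaled_jet alpha rho chi [::] 0).
split=> [x Ox|s x y Ox]; first by rewrite E//; exact: S1.
have := S2 s x y Ox; rewrite /prop_for /continuous_at /= E//.
apply: cvg_trans; apply: near_eq_cvg.
have nO : \forall p \near (x, y), Omega p.1.
  have cfst : {for (x, y), continuous (fun p : 'rV[R]_d * 'rV[R]_d => p.1)} by exact: cvg_fst.
  by apply: cfst; exact: open_nbhs_nbhs.
by apply: filterS nO => p Op; rewrite (E _ Op).
Qed.

Lemma to_Ck_rescaledE k x : Omega x ->
  Ck_fun (to_Ck k (rescaled Omega chi h phi x)) = rescaled Omega chi h phi x.
Proof.
move=> Ox; rewrite /to_Ck; case: pselect => // -[].
exact: rescaled_smooth.1 x Ox k.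
Qed.

Lemma to_Ck_rescaled_continuous k x : Omega x ->
  {for x, continuous (fun x => to_Ck k (rescaled Omega chi h phi x))}.
Proof.
move=> Ox; apply: (@Ck_cvg _ _ _ _ (nbhs x)) => s sk y e e0.
have e20 : 0 < e / 2 by rewrite divr_gt0.
have c1 := rescaled_smooth.2 s x y Ox.
have c2 := (smooth_jet (rescaled_smooth.1 x Ox) s (x := y) I).1.
(* Centre x' at y' and centre x at y' are both compared with centre x at y. *)
have n1 : \forall p \near (x, y), `|pderivs s (rescaled Omega chi h phi x) y -
    pderivs s (rescaled Omega chi h phi p.1) p.2| < e / 2.
  exact: (@cvgr_dist_lt _ _ _ (nbhs (x, y)) _ _ _ c1).
have n2 : \forall y' \near y, `|pderivs s (rescaled Omega chi h phi x) y -
    pderivs s (rescaled Omega chi h phi x) y'| < e / 2.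
  exact: (@cvgr_dist_lt _ _ _ (nbhs y) _ _ _ c2).
have nO : \forall x' \near x, Omega x' by exact: open_nbhs_nbhs.
have [[A B] [/= nA nB] AB] := n1.
exists (B `&` [set y' | `|pderivs s (rescaled Omega chi h phi x) y -
    pderivs s (rescaled Omega chi h phi x) y'| < e / 2], A `&` Omega).
  by split; apply: filterI.
move=> [y' x'] [[/= By' h2] [Ax' Ox']].
have K (f f' : Ck_space R d k) g g' : Ck_fun f = g -> Ck_fun f' = g' ->
    `|pderivs s g y' - pderivs s g' y'| < e ->
    `|pderivs s f y' - pderivs s f' y'| < e by move=> -> ->.
apply: K (to_Ck_rescaledE k Ox) (to_Ck_rescaledE k Ox') _.
have h1 := AB (x', y') (conj Ax' By'); rewrite /= in h1.
move: h1 h2; rewrite !ltr_norml => /andP[a1 a2] /andP[b1 b2].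
by apply/andP; split; lra.
Qed.

End rescaled_waves.

(** * Compactness *)

Section ultrafilter_limits.

Lemma ultra_fmap (T U : Type) (f : T -> U) (F : set_system T) :
  UltraFilter F -> UltraFilter (f @ F).
Proof.
move=> FU; split; first exact: fmap_proper_filter.
move=> G GF FG; apply/seteqP; split => A; last exact: FG.
have [//|FnA] := in_ultra_setVsetC (f @^-1` A) FU.
move=> GA; exfalso; have GnA : G (~` A) by apply: FG.
have := @filterI _ G _ _ _ GA GnA; rewrite setICr => G0.
by have [] := @filter_ex _ G _ _ (G0 _).
Qed.

Lemma ultra_bounded_cvg (R : realType) (T : Type) (F : set_system T) (f : T -> R) (C : R) :
  UltraFilter F -> (\forall n \near F, `|f n| <= C) -> exists l : R, f n @[n --> F] --> l.
Proof.
move=> FU fC; have : compact (`[- C, C]%classic : set R) by exact: segment_compact.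
rewrite compact_ultra => /(_ _ (ultra_fmap f FU)).
case; last by move=> l [_ /= fl]; exists l.
by apply: filterS fC => n /=; rewrite in_itv/= ler_norml.
Qed.

End ultrafilter_limits.

Section coordinate_paths.
Context {R : realType} {d : nat}.

(* The segments parallel to the axes from y to y' stay in the ball. *)
Lemma coordinatewise_lipschitz (f : 'rV[R]_d -> R) (fi : 'I_d -> 'rV[R]_d -> R)
    (y y' : 'rV[R]_d) (C : R) :
  (forall z i, enorm (z - y) <= enorm (y' - y) ->
    is_derive z (basis_vec i) f (fi i z) /\ `|fi i z| <= C) ->
  `|f y' - f y| <= d%:R * (C * enorm (y' - y)).
Proof.
move=> H.
pose z (m : nat) : 'rV[R]_d := \row_i (if (i < m)%N then y' ord0 i else y ord0 i).
have z0 : z 0%N = y by apply/rowP => i; rewrite mxE.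
have zd : z d = y' by apply/rowP => i; rewrite mxE ltn_ord.
suff S m : (m <= d)%N -> `|f (z m) - f y| <= m%:R * (C * enorm (y' - y)).
  by rewrite -{1}zd; exact: S.
elim: m => [_|m IH md]; first by rewrite z0 subrr normr0 mul0r.
pose i := Ordinal md; pose c := y' ord0 i - y ord0 i.
have zS (t : R) j : (z m + t *: (c *: basis_vec i)) ord0 j =
    if (j < m)%N then y' ord0 j else if j == i then y ord0 j + t * c else y ord0 j.
  rewrite !mxE eqxx /=; have [->|ji] := eqVneq j i; last by rewrite !mulr0 addr0.
  by rewrite ltnn mulr1.
have zE : z m.+1 = z m + c *: basis_vec i.
  apply/rowP => j; rewrite -[c *: _]scale1r zS mxE ltnS leq_eqVlt.
  have [jm|jm|jm] := ltngtP j m; rewrite ?orbF ?orbT//.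
    by case: eqVneq => // ji; rewrite ji /= ltnn in jm.
  have -> : j = i by exact: val_inj.
  by rewrite eqxx mul1r /c addrC subrK.
have zb (t : R) : 0 <= t <= 1 -> enorm (z m + t *: (c *: basis_vec i) - y) <= enorm (y' - y).
  move=> /andP[t0 t1]; rewrite ler_wsqrtr//; apply: ler_sum => j _.
  rewrite -!expr2 mxE [(- y) _ _]mxE zS [(y' - y) _ _]mxE [(- y) _ _]mxE.
  case: ifP => // _; case: eqVneq => [->|_]; last by rewrite subrr expr0n sqr_ge0.
  rewrite addrAC subrr add0r exprMn -/c ler_piMl ?sqr_ge0//.
  by rewrite exprn_ile1.
have cb : `|c| <= enorm (y' - y).
  rewrite -sqrtr_sqr ler_wsqrtr// /dotr (bigD1 i)//= !mxE -expr2 lerDl.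
  by apply: sumr_ge0 => j _; rewrite -expr2 sqr_ge0.
have [t t01 E] := line_mvt_scaled (f := f) (g := fi i) (fun t t01 => (H _ i (zb t t01)).1).
rewrite zE -(subrK (f (z m)) (f (z m + _))) -addrA (le_trans (ler_normD _ _))//.
rewrite mulrS mulrDl mul1r lerD//; last exact/IH/ltnW.
by rewrite E normrM mulrC ler_pM//; exact: (H _ i (zb t t01)).2.
Qed.

End coordinate_paths.

Section limits_of_waves.
Context {R : realType} {d : nat}.
Context (F : set_system nat) {FU : UltraFilter F}.
Context (V : nat -> set 'rV[R]_d) (J : nat -> seq 'I_d -> 'rV[R]_d -> R) (M : R).
Hypotheses (oV : forall n, open (V n)) (hJ : forall n, helmholtz_jet (V n) (J n))
  (M0 : 0 < M)
  (JM : forall r : R, \forall n \near F, forall y, enorm y < r -> V n y /\ `|J n [::] y| <= M).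

(** Eventually the unit ball around every point of B(0, r) is in V n with the bound M, so the
    interior estimate at radius 1 gives a C independent of r. *)
Lemma jets_bounded s : exists2 C : R, 0 < C &
  forall r : R, \forall n \near F, forall y, enorm y < r -> V n y /\ `|J n s y| <= C.
Proof.
have [C C0 HC] := @interior_estimate R d s; exists (C * M); first exact: mulr_gt0.
move=> r; apply: filterS (JM (r + 1)) => n Hn y yr; split.
  by apply: (Hn y _).1; lra.
have := HC (V n) (J n) y 1 M (@oV n) (@hJ n) ltr01 (lexx 1) M0.
rewrite expr1n divr1; apply => z zy; apply: Hn.
have := ler_enormD (z - y) y; rewrite subrK; lra.
Qed.

Lemma jets_cvg s y : exists l : R, J n s y @[n --> F] --> l.
Proof.
have [C _ HC] := jets_bounded s; apply: (@ultra_bounded_cvg _ _ _ _ C) => //.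
apply: filterS (HC (enorm y + 1)) => n Hn; apply: (Hn y _).2; lra.
Qed.

(** Limits are taken pointwise for each derivative, and inequalities survive them: Lipschitz bounds
    give continuity and local uniformity, second order Taylor bounds show that the limit of the
    derivatives is the derivative of the limit. *)
Lemma wave_limit : exists G : seq 'I_d -> 'rV[R]_d -> R,
  [/\ helmholtz_jet setT G, forall y, `|G [::] y| <= M &
  forall s (y : 'rV[R]_d) (e : R), 0 < e ->
    \forall y' \near y & n \near F, `|G s y' - J n s y'| < e].
Proof.
have /choice[G HG] : forall sy : seq 'I_d * 'rV[R]_d, exists l : R,
  J n sy.1 sy.2 @[n --> F] --> l by move=> [s y]; exact: jets_cvg.
have {}HG s y : J n s y @[n --> F] --> G (s, y) by exact: HG (s, y).
have /choice[C HC] : forall s, exists C : R, 0 < C /\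
    forall r : R, \forall n \near F, forall y, enorm y < r -> V n y /\ `|J n s y| <= C.
  by move=> s; have [C C0 HC] := jets_bounded s; exists C.
pose D s := \sum_i C (i :: s); pose L s := d%:R * D s.
have D0 s : 0 <= D s by apply: sumr_ge0 => i _; have [/ltW] := HC (i :: s).
have L0 s : 0 <= L s by rewrite mulr_ge0.
have lipJ s y (a : R) : \forall n \near F, forall y', enorm (y' - y) <= a ->
    `|J n s y' - J n s y| <= L s * enorm (y' - y).
  pose r := enorm y + a + 1.
  have B : \forall n \near F, forall i z, enorm z < r -> V n z /\ `|J n (i :: s) z| <= C (i :: s).
    by apply: filter_forall => i; exact: (HC (i :: s)).2.
  apply: filterS B => n Hn y' y'a; rewrite -mulrA.
  apply: (@coordinatewise_lipschitz _ _ (J n s) (fun i => J n (i :: s))) => z i zy.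
  have [|Vz Jz] := Hn i z.
    by rewrite /r; have := ler_enormD (z - y) y; rewrite subrK; lra.
  split; first by have [_] := (@hJ n).1 s z Vz; exact.
  apply: le_trans Jz _; rewrite /D (bigD1 i)//= lerDl; apply: sumr_ge0 => j _.
  by have [/ltW] := HC (j :: s).
have lipG s y y' : `|G (s, y') - G (s, y)| <= L s * enorm (y' - y).
  have c : `|J n s y' - J n s y| @[n --> F] --> `|G (s, y') - G (s, y)|.
    by apply: cvg_norm; apply: cvgB; exact: HG.
  apply: cvgr_to_le c _; apply: filterS (lipJ s y (enorm (y' - y))) => n; exact.
have dG s y i : is_derive y (basis_vec i) (fun y => G (s, y)) (G (i :: s, y)).
  apply: (@is_derive_taylor _ _ _ _ _ _ (C [:: i, i & s])) => t t1.
  have c : `|J n s (y + t *: basis_vec i) - J n s y - t * J n (i :: s) y| @[n --> F] -->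
      `|G (s, y + t *: basis_vec i) - G (s, y) - t * G (i :: s, y)|.
    apply: cvg_norm; apply: cvgB; first by apply: cvgB; exact: HG.
    by apply: cvgM; [exact: cvg_cst|exact: HG].
  apply: cvgr_to_le c _.
  have yt (a : R) : 0 <= a <= 1 -> enorm (y + a *: (t *: basis_vec i)) < enorm y + d%:R + 1.
    move=> /andP[a0 a1]; apply: le_lt_trans (ler_enormD _ _) _.
    suff : enorm (a *: (t *: basis_vec i : 'rV[R]_d)) <= d%:R by lra.
    apply: le_trans (enorm_le_norm _) _; rewrite ler_piMr// scalerA.
    by rewrite (le_trans (norm_scale_basis_vec _ _))// normrM mulr_ile1// ger0_norm.
  apply: filterS ((HC [:: i, i & s]).2 (enorm y + d%:R + 1)) => n Hn.
  have dJ s' a : 0 <= a <= 1 -> is_derive (y + a *: (t *: basis_vec i)) (basis_vec i) (J n s')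
      (J n (i :: s') (y + a *: (t *: basis_vec i))).
    by move=> /yt/Hn[Vz _]; have [_] := (@hJ n).1 s' _ Vz; exact.
  (* Two mean values, the second between 0 and a t, write the Taylor remainder as t^2 a times a
     second derivative, with 0 <= a <= 1. *)
  have [a a01 Ea] := line_mvt_scaled (g := J n (i :: s)) (dJ s).
  have dJ2 (b : R) : 0 <= b <= 1 -> is_derive (y + b *: ((a * t) *: basis_vec i)) (basis_vec i)
      (J n (i :: s)) (J n [:: i, i & s] (y + b *: ((a * t) *: basis_vec i))).
    move=> b01; rewrite -[(a * t) *: _]scalerA scalerA; apply: dJ.
    by move: a01 b01 => /andP[a0 a1] /andP[b0 b1]; rewrite mulr_ge0//= mulr_ile1.
  have [b b01 Eb] := line_mvt_scaled (g := J n [:: i, i & s]) dJ2.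
  rewrite Ea -mulrBr scalerA Eb.
  rewrite (_ : t * _ = t ^+ 2 * (a * J n [:: i, i & s] (y + b *: ((a * t) *: basis_vec i)))).
    rewrite normrM [C _ * _]mulrC (@ger0_norm _ (t ^+ 2)) ?sqr_ge0// ler_wpM2l ?sqr_ge0//.
    have [|_ Jb] := Hn (y + b *: ((a * t) *: basis_vec i)).
      rewrite -[(a * t) *: _]scalerA scalerA; apply: yt.
      by move: a01 b01 => /andP[a0 a1] /andP[b0 b1]; rewrite mulr_ge0//= mulr_ile1.
    move: a01 => /andP[a0 a1]; rewrite normrM ger0_norm// (le_trans _ Jb)//.
    by rewrite ler_piMl.
  by rewrite expr2; ring.
exists (fun s y => G (s, y)); split.
- split=> [s y _|y _].
    split; last by move=> i; exact: dG.
    apply/(@cvgrPdist_lt _ _ _ (nbhs y)) => e e0.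
    have Ld : 0 < e / (L s + 1) by rewrite divr_gt0// ltr_wpDl.
    have : \forall y' \near y, enorm (y' - y) < e / (L s + 1).
      apply: (cvgr_lt (enorm (y - y)) (@continuous_enorm_sub R d y y)).
      by rewrite subrr enorm0.
    apply: filterS => y' yy'; rewrite distrC; apply: le_lt_trans (lipG s y y') _.
    rewrite ltr_pdivlMr ?ltr_wpDl// in yy'; apply: le_lt_trans yy'.
    by rewrite mulrC ler_wpM2l ?enorm_ge0// lerDl.
  have c : - (\sum_i J n [:: i; i] y) @[n --> F] --> - (\sum_i G ([:: i; i], y)).
    by apply: cvgN; apply: cvg_big => [|i _]; [exact: add_continuous|exact: HG].
  apply: (cvg_unique _ c) => //.
  have := HG [::] y; apply: cvg_trans; apply: near_eq_cvg.
  apply: filterS (JM (enorm y + 1)) => n Hn.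
  have [|Vy _] := Hn y; first by lra.
  by rewrite (@hJ n).2.
- move=> y; apply: (cvgr_to_le (cvg_norm (HG [::] y))).
  by apply: filterS (JM (enorm y + 1)) => n Hn; apply: (Hn y _).2; lra.
- move=> s y e e0.
  have e30 : 0 < e / 3 by rewrite divr_gt0.
  have Ld : 0 < Num.min 1 (e / 3 / (L s + 1)).
    by rewrite lt_min ltr01 divr_gt0// ltr_wpDl.
  have n1 : \forall y' \near y, enorm (y' - y) < Num.min 1 (e / 3 / (L s + 1)).
    apply: (cvgr_lt (enorm (y - y)) (@continuous_enorm_sub R d y y)).
    by rewrite subrr enorm0.
  have n2 : \forall n \near F, `|G (s, y) - J n s y| < e / 3.
    exact: (@cvgr_dist_lt _ _ _ F _ _ _ (HG s y)).
  exists ([set y' | enorm (y' - y) < Num.min 1 (e / 3 / (L s + 1))],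
    [set n | `|G (s, y) - J n s y| < e / 3 /\ forall y', enorm (y' - y) <= 1 ->
      `|J n s y' - J n s y| <= L s * enorm (y' - y)]).
    by split => //; apply: filterI n2 (lipJ s y 1).
  move=> [y' n] /= [+ [h1 h2]]; rewrite lt_min => /andP[y1 yL].
  have h3 := h2 y' (ltW y1); have h4 := lipG s y y'.
  have h5 : L s * enorm (y' - y) <= e / 3.
    rewrite ltr_pdivlMr ?ltr_wpDl// in yL; apply: le_trans (ltW yL).
    by rewrite mulrC ler_wpM2l ?enorm_ge0// lerDl.
  move: (le_trans h3 h5) (le_trans h4 h5) h1.
  rewrite ltr_norml !ler_norml => /andP[a1 a2] /andP[b1 b2] /andP[c1 c2].
  by rewrite ltr_norml; apply/andP; split; lra.
Qed.

End limits_of_waves.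

Section compactness_of_rescaled_waves.
Context {R : realType} {d : nat}.

Lemma helmholtz_jet_shift (U : set 'rV[R]_d) J (a : 'rV[R]_d) : helmholtz_jet U J ->
  helmholtz_jet ((fun y => a + y) @^-1` U) (fun s y => J s (a + y)).
Proof.
move=> [jJ HJ]; split=> [s y Uy|y Uy]; last exact: HJ.
have [cJ dJ] := jJ s _ Uy; split.
  apply: (@continuous_comp _ _ _ (fun y => a + y) (J s) y) cJ.
  by apply: (@cvgD _ _ _ (nbhs y)); [exact: cvg_cst|exact: cvg_id].
by move=> i; apply/(is_derive_shift_dom (J s) y (basis_vec i) _ a); exact: dJ.
Qed.

Context (Omega : set 'rV[R]_d) (phi : nat -> 'rV[R]_d -> R) (h : nat -> R) (chi : R -> R)
  (M : R) (k : nat).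
Hypotheses (d0 : (0 < d)%N) (oO : open Omega) (bO : bounded_set Omega)
  (h_gt0 : forall n, 0 < h n) (h_cvg0 : h n @[n --> \oo] --> 0)
  (sphi : forall n, smooth_on Omega (phi n))
  (ephi : forall n x, Omega x -> - (h n ^+ 2 * laplacian (phi n) x) = phi n x)
  (cchi : cutoff chi) (M0 : 0 < M).

(** On a fixed ball in y the cutoff is eventually 1, so the rescaled function and its derivatives
    are those of the wave [J n] there, and [wave_limit] applies. *)
Lemma rescaled_limit (F : set_system nat) (FU : UltraFilter F) (x : 'rV[R]_d) :
  Omega x -> F --> \oo ->
  (\forall n \near F, forall x, Omega x -> `|phi n x| <= M) ->
  exists2 f : FP R d k, `|val f 0| <= M &
    to_Ck k (rescaled Omega chi (h n) (phi n) x) @[n --> F] --> val f.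
Proof.
move=> Ox Foo FM.
have {Foo}hF : h n @[n --> F] --> 0 by apply: cvg_trans h_cvg0; exact: cvg_app.
pose a n := (h n)^-1 *: x.
pose V n := (fun y => a n + y) @^-1` scaled_domain Omega (h n).
pose J n s y := scaled_jet (phi n) (h n) s (a n + y).
have h0 n : h n != 0 by rewrite gt_eqF.
have aE n y : h n *: (a n + y) = x + h n *: y.
  by rewrite scalerDr scalerA divff// scale1r.
have oV n : open (V n).
  apply: open_comp; last exact: open_scaled_domain.
  by move=> y _; apply: (@cvgD _ _ _ (nbhs y)); [exact: cvg_cst|exact: cvg_id].
have hJ n : helmholtz_jet (V n) (J n).
  by apply/helmholtz_jet_shift/scaled_jet_helmholtz => // y; exact: ephi.
pose delta := dist_to (frontier Omega) x.
have delta0 : 0 < delta by exact: dist_to_frontier_gt0.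
(* Used with e = 1 to place x + h y in Omega, and with e = e1 to make the cutoff equal to 1. *)
have small (r e : R) : 0 < e -> \forall n \near F, forall y : 'rV[R]_d, enorm y < r ->
    h n * enorm y / delta < e.
  move=> e0; have r0 : 0 < `|r| + 1 by rewrite ltr_wpDl.
  have : \forall n \near F, h n < e * delta / (`|r| + 1).
    by apply: (cvgr_lt 0 hF); rewrite divr_gt0 ?mulr_gt0.
  apply: filterS => n hn y yr; rewrite ltr_pdivrMr//.
  rewrite ltr_pdivlMr// in hn; apply: le_lt_trans hn.
  rewrite ler_wpM2l ?(ltW (h_gt0 n))//; have := ler_norm r; lra.
have JM r : \forall n \near F, forall y : 'rV[R]_d, enorm y < r -> V n y /\ `|J n [::] y| <= M.
  apply: filterS2 FM (small r 1 ltr01) => n Hn Sn y yr.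
  have Oy : Omega (x + h n *: y).
    apply: (dist_to_frontier_sub oO Ox); rewrite addrC addKr enormZ gtr0_norm//.
    by have := Sn y yr; rewrite ltr_pdivrMr// mul1r.
  rewrite /V /J /scaled_domain /scaled_jet /preimage /= aE; split => //.
  by rewrite expr0 mul1r Hn.
have [G [hG GM GJ]] := wave_limit oV hJ M0 JM.
have [sG pG] := jet_smooth openT hG.1 (fun x _ => erefl (G [::] x)).
pose g := MkCk (sG k).
have gFP : g \in @FP_set R d k.
  rewrite inE; split => // y; rewrite -[RHS](hG.2 y I) /laplacian.
  by congr (- _); apply: eq_bigr => i _; exact: pG.
exists (exist _ g gFP : FP R d k) => /=; first exact: GM.
apply: Ck_cvg => s sk y e e0.
have [_ _ _ [e1 e10 chi1] _] := cchi.
have Er : \forall n \near F, forall y', enorm y' < enorm y + 1 ->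
    pderivs s (to_Ck k (rescaled Omega chi (h n) (phi n) x)) y' = J n s y'.
  apply: filterS3 FM (small (enorm y + 1) e1 e10) (JM (enorm y + 1)) => n Hn Sn Jn y' y'r.
  have K (f : Ck_space R d k) u : Ck_fun f = u -> pderivs s u y' = J n s y' ->
    pderivs s f y' = J n s y' by move=> ->.
  apply: K (to_Ck_rescaledE oO (sphi n) (h_gt0 n) (ephi n) d0 bO cchi M0 Hn k Ox) _.
  have jB : jet [set y' | enorm y' < enorm y + 1] (J n).
    by apply: jet_sub (hJ n).1 => z /Jn[].
  have Eb z : enorm z < enorm y + 1 -> rescaled Omega chi (h n) (phi n) x z = J n [::] z.
    move=> zr; have hz0 : 0 <= h n * enorm z / delta.
      by rewrite divr_ge0 ?(ltW delta0)// mulr_ge0 ?enorm_ge0// ltW.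
    by rewrite /rescaled (chi1 _ hz0 (Sn z zr)) mulr1 /J /scaled_jet aE expr0 mul1r.
  exact: (jet_smooth (@open_enorm_ball R d (enorm y + 1)) jB Eb).2 s y' y'r.
have ny : \forall y' \near y, enorm y' < enorm y + 1.
  apply: open_nbhs_nbhs; split; first exact: open_enorm_ball.
  by rewrite /= ltrDl.
have [[A B] /= [nA nB] AB] := GJ s y e e0.
exists (A `&` [set y' | enorm y' < enorm y + 1],
  B `&` [set n | forall y', enorm y' < enorm y + 1 ->
    pderivs s (to_Ck k (rescaled Omega chi (h n) (phi n) x)) y' = J n s y']).
  by split; apply: filterI.
move=> [y' n] /= [[Ay' y'r] [Bn En]]; rewrite (En y' y'r) (pG s y' I).
exact: (AB (y', n)).
Qed.

End compactness_of_rescaled_waves.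

(** * Measure theory *)

Section volumes.
Context {R : realType}.

Lemma ball_rVP n (a v : 'rV[R]_n) (r : R) : 0 < r ->
  ball a r v <-> forall i, `|a ord0 i - v ord0 i| < r.
Proof.
move=> r0; rewrite -ball_normE /= [X in X < _]/Num.norm/= mx_normrE; split.
  move=> /bigmax_ltP[_ H] i; have := H (ord0, i) isT; by rewrite !mxE.
move=> H; apply/bigmax_ltP; split => // -[i j] _ /=.
by rewrite (ord1 i) !mxE; exact: H.
Qed.

(** Sup norm balls are cubes, which [consv] splits into an interval times a cube of one dimension
    less. In dimension 0 there is a single point, of Dirac mass 1. *)
Lemma lebesgue_rV_ball n (a : 'rV[R]_n) (r : R) : 0 < r ->
  lebesgue_rV n (ball a r : set (borel 'rV[R]_n)) = ((2 * r) ^+ n)%:E.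
Proof.
move=> r0; elim: n a => [|n IH] a.
  rewrite /= diracE (_ : _ \in _ = true)//; apply/mem_set/ball_rVP => //.
  by case.
pose a' : 'rV[R]_n := \row_i a ord0 (lift ord0 i).
have -> : lebesgue_rV n.+1 (ball a r : set (borel 'rV[R]_n.+1)) =
  (lebesgue_measure \x lebesgue_rV n)%E (@consv R n @^-1` ball a r) by [].
have -> : @consv R n @^-1` ball a r = `]a ord0 ord0 - r, a ord0 ord0 + r[%classic `*` ball a' r.
  have c0 (p : R * 'rV[R]_n) : (consv p) ord0 ord0 = p.1.
    have -> : ord0 = lshift n ord0 :> 'I_(1 + n) by exact: val_inj.
    by rewrite /consv [LHS]row_mxEl mxE.
  have cS (p : R * 'rV[R]_n) i : (consv p) ord0 (lift ord0 i) = p.2 ord0 i.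
    have -> : lift ord0 i = rshift 1 i :> 'I_(1 + n) by exact: val_inj.
    by rewrite /consv [LHS]row_mxEr.
  apply/seteqP; split => p /=.
    move=> /(ball_rVP _ _ r0) H; split.
      by have := H ord0; rewrite c0 in_itv/= ltr_distlC.
    by apply/ball_rVP => // i; have := H (lift ord0 i); rewrite cS mxE.
  move=> [H1 /(ball_rVP _ _ r0) H2]; apply/ball_rVP => // i.
  have [j ->|->] := unliftP ord0 i; first by have := H2 j; rewrite cS mxE.
  by rewrite c0; move: H1; rewrite in_itv/= ltr_distlC.
rewrite product_measure1E//; last by apply: open_borel; exact: ball_open.
have L : lebesgue_measure (`]a ord0 ord0 - r, a ord0 ord0 + r[%classic : set R) = (2 * r)%:E.
  rewrite lebesgue_measure_itv/= lte_fin ifT; last by lra.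
  by rewrite -EFinB; congr EFin; ring.
by rewrite IH exprS EFinM; congr (_ * _)%E; exact: L.
Qed.

Lemma lebesgue_rV_open_gt0 n (U : set 'rV[R]_n) : open U -> U !=set0 ->
  (0 < lebesgue_rV n (U : set (borel 'rV[R]_n)))%E.
Proof.
move=> oU [x Ux]; have : \forall y \near x, U y by exact: open_nbhs_nbhs.
move=> /nbhs_ballP[r /= r0 rU].
apply: (@lt_le_trans _ _ (lebesgue_rV n (ball x r : set (borel 'rV[R]_n)))).
  by rewrite lebesgue_rV_ball// lte_fin exprn_gt0// mulr_gt0.
by apply: le_measure => //; rewrite inE; apply: open_borel => //; exact: ball_open.
Qed.

Lemma lebesgue_rV_bounded n (U : set 'rV[R]_n) : measurable (U : set (borel 'rV[R]_n)) ->
  bounded_set U -> (lebesgue_rV n (U : set (borel 'rV[R]_n)) < +oo)%E.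
Proof.
move=> mU [M [_ UM]].
have M0 : 0 < `|M| + 2 by rewrite ltr_wpDl.
apply: (@le_lt_trans _ _ (lebesgue_rV n (ball (0 : 'rV[R]_n) (`|M| + 2) : set (borel 'rV[R]_n)))).
  apply: le_measure; rewrite ?inE//; first by apply: open_borel; exact: ball_open.
  move=> x Ux; rewrite -ball_normE/= sub0r normrN.
  have M1 : M < `|M| + 1 by rewrite (le_lt_trans (ler_norm M)) ?ltrDl.
  by rewrite (le_lt_trans (UM _ M1 x Ux))// ltrD2l ltr1n.
by rewrite lebesgue_rV_ball// ltry.
Qed.

(** The normalizing volume is positive and finite, so its inverse is a true one. This total mass is
    later the variance of the field at 0. *)
Lemma unif_sphere_setT d : unif_sphere [set: borel 'rV[R]_d] = 1%E.
Proof.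
rewrite /unif_sphere preimage_setT setTI.
have mB : measurable (unit_ball : set (borel 'rV[R]_d)).
  rewrite (_ : unit_ball = enorm @^-1` `]-oo, 1]).
    by rewrite -[X in measurable X]setTI; exact: measurable_enorm.
  by apply/seteqP; split => x; rewrite /= in_itv.
have B0 : (0 < lebesgue_rV d (unit_ball : set (borel 'rV[R]_d)))%E.
  have oB := @open_enorm_ball R d 1.
  apply: (@lt_le_trans _ _ (lebesgue_rV d ([set x : 'rV[R]_d | enorm x < 1] : set (borel 'rV[R]_d)))).
    by apply: (lebesgue_rV_open_gt0 oB); exists 0; rewrite /= enorm0.
  by apply: le_measure; rewrite ?inE//; [exact: open_borel|move=> x /ltW].
have Boo : (lebesgue_rV d (unit_ball : set (borel 'rV[R]_d)) < +oo)%E.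
  apply: lebesgue_rV_bounded => //; exists 1; split => // r r1 x x1 /=.
  by rewrite (le_trans (enorm_ge_norm x))// (le_trans x1)// ltW.
rewrite -[X in (_ * X)%E]fineK ?ge0_fin_numE// -EFinM mulVf//.
by rewrite gt_eqF// fine_gt0// B0.
Qed.

(** By continuity a value above M persists on a small ball, and balls have positive measure. *)
Lemma Lnorm_oo_le n (U : set 'rV[R]_n) (f : 'rV[R]_n -> R) (M : R) : open U ->
  (forall x, U x -> {for x, continuous f}) ->
  ('N[lebesgue_rV n]_+oo[EFin \o (f \_ U : borel 'rV[R]_n -> R)] <= M%:E)%E ->
  forall x, U x -> `|f x| <= M.
Proof.
move=> oU cf; rewrite unlock /Lnorm ifT; last first.
  by apply: lebesgue_rV_open_gt0; [exact: openT|exists 0].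
move=> /ess_supP[N [mN N0 HN]] x Ux; rewrite leNgt; apply/negP => fx.
have nx : \forall y \near x, U y /\ M < `|f y|.
  apply: filterI; first exact: open_nbhs_nbhs.
  have cn : {for x, continuous (fun y => `|f y|)}.
    exact: (@continuous_comp _ _ _ f Num.norm x (cf x Ux) (@norm_continuous _ _ _)).
  exact: (cvgr_gt _ cn).
have /nbhs_ballP[r /= r0 rP] := nx.
have : (lebesgue_rV n (ball x r : set (borel 'rV[R]_n)) <= 0)%E.
  rewrite -N0; apply: le_measure; rewrite ?inE//.
    by apply: open_borel; exact: ball_open.
  move=> y /rP[Uy fy]; apply: HN => /=; rewrite patchE mem_set// lee_fin.
  by apply/negP; rewrite -ltNge.
by rewrite lebesgue_rV_ball// lee_fin leNgt exprn_gt0// mulr_gt0.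
Qed.

End volumes.

Section dirac_mixtures.
Import HBNNSimple.
Local Open Scope ereal_scope.
Context {R : realType} {d1 d2 : measure_display} {T1 : measurableType d1}
  {T2 : measurableType d2}.

Lemma ge0_integral_mrestr (mu : {measure set T1 -> \bar R}) (D : set T1) (mD : measurable D)
    (f : T1 -> \bar R) : measurable_fun setT f -> (forall x, 0 <= f x) ->
  \int[mrestr mu mD]_x f x = \int[mu]_(x in D) f x.
Proof.
move=> mf f0; have mC : measurable (~` D) by exact: measurableC.
have DC : [disjoint ~` D & D] by apply/disj_setPS; rewrite setICl.
have mfU : measurable_fun (~` D `|` D) f by rewrite setvU.
rewrite -(setvU D) (ge0_integral_setU _ mC mD mfU (fun x _ => f0 x) DC).
rewrite null_set_integral//; [|exact: measurable_funTS|]; last first.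
  by change (mu (~` D `&` D) = 0); rewrite setICl measure0.
rewrite add0e.
apply: eq_measure_integral => A mA AD.
by change (mu (A `&` D) = mu A); congr (mu _); exact/setIidPl.
Qed.

(** [LM] is a bare set function, to be compared with a genuine measure on measurable sets only;
    integrals, being suprema over measurable simple functions, see nothing else. *)
Lemma eq_integral_measurable_sets (m m' : set T2 -> \bar R) (D : set T2) (f : T2 -> \bar R) :
  (forall A, measurable A -> m A = m' A) -> \int[m]_(y in D) f y = \int[m']_(y in D) f y.
Proof.
move=> mm'; rewrite /integral.
have E (h : {nnsfun T2 >-> R}) : sintegral m h = sintegral m' h.
  by apply: eq_fsbigr => x _; rewrite mm'.
by congr (ereal_sup _ - ereal_sup _); apply/seteqP; split => _ [h hf <-]; exists h.
Qed.

(** The mixture is c times the image under g of the restriction of mu to D, so this is a change of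
    variables on positive and negative parts. Boundedness of F and finiteness of mu D make the
    negative part finite, so that c factors out of the difference. *)
Lemma integral_dirac_mixture (mu : {measure set T1 -> \bar R}) (D : set T1)
    (g : T1 -> T2) (c K : R) (F : T2 -> R) :
  measurable D -> mu D < +oo -> measurable_fun D g -> (0 <= c)%R ->
  measurable_fun setT F -> (forall y, (`|F y| <= K)%R) ->
  \int[fun B => c%:E * \int[mu]_(x in D) \d_(g x) B]_y (F y)%:E =
  c%:E * \int[mu]_(x in D) (F (g x))%:E.
Proof.
move=> mD muD mg c0 mF FK.
have [D0|/eqP/set0P[x0 Dx0]] := pselect (D = set0).
  rewrite {2}D0 integral_set0 mule0 (@eq_integral_measurable_sets _ mzero).
    exact: integral_measure_zero.
  by move=> B _; rewrite D0 integral_set0 mule0.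
(* An image measure requires a map measurable everywhere: off D a constant value of g is used, which
   is why the empty D was set apart. *)
pose g' x := if x \in D then g x else g x0.
have mD' : measurable_fun setT (fun x => x \in D).
  apply: (measurable_fun_bool true); rewrite setTI.
  rewrite (_ : _ @^-1` _ = D)//; apply/seteqP; split => x /=.
    exact: set_mem.
  exact: mem_set.
have mg' : measurable_fun setT g'.
  apply: measurable_fun_if => //.
  by rewrite setTI (_ : _ @^-1` _ = D)//; apply/seteqP; split => x /=; [exact: set_mem|exact: mem_set].
have g'E x : D x -> g' x = g x by move=> Dx; rewrite /g' mem_set.
pose m := mscale (NngNum c0) (measure_function_pushforward__canonical__measure_function_Measure
  (mrestr mu mD) mg').
rewrite (@eq_integral_measurable_sets _ m); last first.
  move=> B mB; rewrite /m/= /mscale/= /pushforward; congr (_ * _).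
  have mgB : measurable (g' @^-1` B) by have := mg' measurableT _ mB; rewrite setTI.
  change (\int[mu]_(x in D) \d_(g x) B = mu (g' @^-1` B `&` D)).
  rewrite -integral_indic//; apply: eq_integral => x; rewrite inE => Dx.
  by rewrite diracE -(g'E x Dx) indicE; congr (_%:R%:E); apply/idP/idP; rewrite !inE.
have ge0E (f : T2 -> \bar R) : measurable_fun setT f -> (forall y, 0 <= f y) ->
    \int[m]_y f y = c%:E * \int[mu]_(x in D) f (g x).
  move=> mf f0; rewrite ge0_integral_mscale//; congr (_ * _).
  rewrite (ge0_integral_pushforward mg')// preimage_setT.
  rewrite (ge0_integral_mrestr mu mD (measurableT_comp mf mg') (fun x => f0 (g' x))).
  by apply: eq_integral => x; rewrite inE => Dx /=; rewrite g'E.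
have mFE : measurable_fun setT (fun y => (F y)%:E) by exact/measurable_EFinP.
have fin (f : T2 -> \bar R) : measurable_fun setT f -> (forall y, 0 <= f y) ->
    (forall y, f y <= K%:E) -> \int[mu]_(x in D) f (g x) \is a fin_num.
  move=> mf f0 fK; rewrite ge0_fin_numE; last by apply: integral_ge0.
  apply: (@le_lt_trans _ _ (\int[mu]_(x in D) (cst K%:E) x)).
    exact: (@ge0_le_integral _ _ _ mu D mD (f \o g) (cst K%:E) (fun x _ => f0 (g x))
      (measurableT_comp mf mg) (measurable_cst _) (fun x _ => fK (g x))).
  rewrite integral_cst// lte_mul_pinfty//.
  by rewrite lee_fin (le_trans _ (FK (g x0))).
have finN : \int[mu]_(x in D) (fun y => (F y)%:E)^\- (g x) \is a fin_num.
  apply: fin; [exact: measurable_funeneg|exact: funeneg_ge0|].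
  move=> y; rewrite funenegE ge_max -EFinN !lee_fin.
  by rewrite (le_trans _ (FK y)) ?(le_trans _ (FK y))//= -normrN ler_norm.
rewrite [LHS]integralE (ge0E _ (measurable_funepos mFE) (funepos_ge0 _)).
rewrite (ge0E _ (measurable_funeneg mFE) (funeneg_ge0 _)) -muleBr//.
  congr (_ * _); rewrite [RHS]integralE; congr (_ - _); apply: eq_integral => x _.
    by rewrite !funeposE.
  by rewrite !funenegE.
by rewrite fin_num_adde_defl// fin_numN.
Qed.

End dirac_mixtures.

Section gaussian_values.
Context {R : realType} {d : nat} {dT : measure_display} {T : measurableType dT}
  (P : probability T R).

(** The density is positive everywhere and the set contains an interval of length 1. *)
Lemma normal_prob_gt0 (m s M : R) : s != 0 ->
  (0 < normal_prob m s [set y : R | (M < `|y|)%R])%E.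
Proof.
move=> s0.
have mA : measurable [set y : R | M < `|y|].
  rewrite (_ : [set _ | _] = Num.norm @^-1` `]M, +oo[).
    by rewrite -[X in measurable X]setTI; exact: normr_measurable.
  by apply/seteqP; split => y; rewrite /= in_itv/= andbT.
have mpdf : measurable_fun [set y : R | M < `|y|] (fun x => (normal_pdf m s x)%:E).
  by apply/measurable_EFinP/measurable_funTS; exact: measurable_normal_pdf.
rewrite lt_neqAle eq_sym; apply/andP; split; last first.
  by apply: integral_ge0 => x _; rewrite lee_fin normal_pdf_ge0.
apply/eqP => I0.
have /(ae_eq_integral_abs lebesgue_measure mA mpdf)[N [mN N0 HN]] :
    (\int[lebesgue_measure]_(x in [set y : R | (M < `|y|)%R]) `|(normal_pdf m s x)%:E| = 0)%E.
  rewrite -I0; apply: eq_integral => x _.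
  by rewrite gee0_abs// lee_fin normal_pdf_ge0.
have : (lebesgue_measure (`]`|M|%R, (`|M| + 1)%R[%classic : set R) <= 0)%E.
  rewrite -N0; apply: le_measure; rewrite ?inE//.
  move=> y; rewrite /= in_itv/= => /andP[My _]; apply: HN => /= H.
  have My' : M < `|y|.
    by rewrite (le_lt_trans (ler_norm M))// (lt_le_trans My)// ler_norm.
  have [] := H My'; apply/eqP; rewrite gt_eqF//.
  rewrite normal_pdfE//; apply: mulr_gt0; last exact: expR_gt0.
  exact: normal_peak_gt0.
by rewrite lebesgue_measure_itv/= lte_fin ltrDl ltr01 -EFinB lee_fin; lra.
Qed.

(** If the Gaussian value at 0 were degenerate, it would be almost surely its mean 0 and have zero
    variance; the covariance formula at x = x' = 0 gives the total mass 1 of the sphere instead. *)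
Lemma berry_field_gt0 (Psi : 'rV[R]_d -> T -> R) (M : R) : berry_field P Psi ->
  measurable_fun setT (Psi 0) /\ (0 < P [set w | (M < `|Psi 0 w|)%R])%E.
Proof.
move=> [GP EP CP].
have [] := GP 1%N (fun=> 0) (fun=> 1).
rewrite (_ : (fun w => _) = Psi 0); last first.
  by apply/funext => w; rewrite big_ord1 mul1r.
move=> mY [m [s Law]]; split => //.
have mA : measurable [set y : R | M < `|y|].
  rewrite (_ : [set _ | _] = Num.norm @^-1` `]M, +oo[).
    by rewrite -[X in measurable X]setTI; exact: normr_measurable.
  by apply/seteqP; split => y; rewrite /= in_itv/= andbT.
have := Law _ mA; rewrite (_ : _ @^-1` _ = [set w | M < `|Psi 0 w|])// => ->.
case: eqVneq => [s0|s0]; last exact: normal_prob_gt0.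
exfalso.
have Ym : ae_eq P setT (EFin \o Psi 0) (cst m%:E).
  exists (Psi 0 @^-1` (~` [set m])); split.
  - by rewrite -[X in measurable X]setTI; apply: mY => //; exact: measurableC.
  - have mC : measurable (~` [set m] : set R) by exact: measurableC.
    have := Law _ mC; rewrite s0 eqxx => H; apply: etrans H _.
    by rewrite diracE memNset//= => /(_ erefl).
  - by move=> w /= H YM; apply: H => _; rewrite YM.
have m0 : m = 0.
  have := EP 0; rewrite unlock (ae_eq_integral (cst m%:E))//; last exact/measurable_EFinP.
  rewrite integral_cst// => mP.
  have : (m%:E * 1)%E = 0%E := etrans (congr1 (mule m%:E) (esym (probability_setT P))) mP.
  by rewrite mule1 => -[].
have YY : ae_eq P setT (EFin \o (Psi 0 \* Psi 0)) (cst 0%E).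
  by apply: filterS Ym => w H _; move: (H I) => /= -[->]; rewrite m0 mul0r.
have := CP 0 0; rewrite unlock (ae_eq_integral (cst 0%E))//; last first.
  by apply/measurable_EFinP; exact: measurable_funM.
rewrite integral_cst// mul0e /= /Cintegral => -[+ _].
rewrite (_ : (fun x => cos _) = fun=> 1); last first.
  apply/funext => x; rewrite subrr (_ : dotr 0 x = 0)/= ?cos0//.
  by rewrite /dotr big1// => i _; rewrite mxE mul0r.
rewrite Rintegral_cst// mul1r => /esym.
have U1 : unif_sphere [set: borel 'rV[R]_d] = 1%E := unif_sphere_setT d.
move=> H; have : fine (1%E : \bar R) = 0 := etrans (congr1 fine (esym U1)) H.
by move=> /eqP; rewrite oner_eq0.
Qed.

End gaussian_values.

(** The hypothesis says that the trace of the tails on A is a proper filter; any ultrafilter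
    refining it will do. *)
Lemma ultra_of_frequently (A : set nat) : ~ (\forall n \near \oo, ~ A n) ->
  exists F : set_system nat, [/\ UltraFilter F, F --> \oo & F A].
Proof.
move=> nA; have PF : ProperFilter (within A \oo).
  split; last exact: within_filter.
  by move=> W0; exact: nA W0.
have [F [UF WF]] := ultraFilterLemma PF; exists F; split => //.
  by move=> B oB; apply: WF; apply: filterS oB.
by apply: WF; apply: nearW.
Qed.

(** * Integration against the local measures *)

Section local_measure_integral.
Context {R : realType} {d k : nat}.
Context (Omega : set 'rV[R]_d) (chi : R -> R)
  (iota : {linear Cb R (FP R d k) -> Cb R (Ck_space R d k)}) (h : R) (phi : 'rV[R]_d -> R).
Hypotheses (oO : open Omega) (bO : bounded_set Omega).
Hypothesis gC : forall x, Omega x ->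
  {for x, continuous (fun x => to_Ck k (rescaled Omega chi h phi x))}.

Local Notation mu := (lebesgue_rV d).
Let g x := to_Ck k (rescaled Omega chi h phi x).

Lemma volume_fin : (mu (Omega : set (borel 'rV[R]_d)) < +oo)%E.
Proof. by apply: lebesgue_rV_bounded => //; exact: open_borel. Qed.

Lemma measurable_to_Ck_rescaled :
  measurable_fun (Omega : set (borel 'rV[R]_d)) (g : borel 'rV[R]_d -> borel (Ck_space R d k)).
Proof.
apply: (@measurability _ _ (borel 'rV[R]_d) (borel (Ck_space R d k)) Omega g
  (@open (Ck_space R d k)) erefl) => _ [U oU <-].
apply: open_borel; rewrite openE => x [Ox Ugx].
have nO : \forall y \near x, Omega y by exact: open_nbhs_nbhs.
have nU : \forall y \near x, U (g y).
  by apply: (gC Ox); exact: open_nbhs_nbhs.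
exact: filterI nO nU.
Qed.

Lemma measurable_Cb_comp (F : Cb R (Ck_space R d k)) :
  measurable_fun (Omega : set (borel 'rV[R]_d)) (fun x : borel 'rV[R]_d => F (g x)).
Proof.
have [cF _] := CbP F.
exact: measurableT_comp (continuous_borel_measurable cF) measurable_to_Ck_rescaled.
Qed.

Lemma integrable_volume (c : R) : mu.-integrable Omega (cst c%:E).
Proof.
have mO : measurable (Omega : set (borel 'rV[R]_d)) by exact: open_borel.
apply/integrableP; split; first exact: measurable_cst.
by rewrite /= integral_cst// lte_mul_pinfty//; exact: volume_fin.
Qed.

Lemma integrable_Cb_comp (F : Cb R (Ck_space R d k)) :
  (mu).-integrable Omega (EFin \o (fun x : borel 'rV[R]_d => F (g x))).
Proof.
have mO : measurable (Omega : set (borel 'rV[R]_d)) by exact: open_borel.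
apply: (@le_integrable _ _ _ mu Omega mO _ (cst (`|F|)%:E)).
- by apply/measurable_EFinP; exact: measurable_Cb_comp.
- by move=> x _ /=; rewrite lee_fin normr_id; exact: Cb_norm_ub.
- exact: integrable_volume.
Qed.

Lemma LM_extE (F : Cb R (FP R d k)) : LM_ext Omega chi iota Omega h phi F =
  (fine (mu (Omega : set (borel 'rV[R]_d))))^-1 *
  \int[mu]_(x in Omega) (iota F (g x)).
Proof.
have mO : measurable (Omega : set (borel 'rV[R]_d)) by exact: open_borel.
have c0 : 0 <= (fine (mu (Omega : set (borel 'rV[R]_d))))^-1 by rewrite invr_ge0 fine_ge0.
have [cF _] := CbP (iota F).
have E := integral_dirac_mixture mO volume_fin measurable_to_Ck_rescaled c0
  (continuous_borel_measurable cF) (Cb_norm_ub (iota F)).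
apply: etrans (congr1 fine E) _; rewrite fineM//.
exact: integrable_fin_num (integrable_Cb_comp _).
Qed.

Lemma LM_ext_linear (a : R) (F G : Cb R (FP R d k)) :
  LM_ext Omega chi iota Omega h phi (a *: F + G) =
  a * LM_ext Omega chi iota Omega h phi F + LM_ext Omega chi iota Omega h phi G.
Proof.
have mO : measurable (Omega : set (borel 'rV[R]_d)) by exact: open_borel.
rewrite !LM_extE mulrCA -mulrDr; congr (_ * _).
rewrite -RintegralZl//; last exact: integrable_Cb_comp.
rewrite -RintegralD//; last exact: integrable_Cb_comp.
  by apply: eq_Rintegral => x _; rewrite linearP.
exact: (integrable_Cb_comp (a *: iota F)).
Qed.

Lemma LM_ext_le (F : Cb R (FP R d k)) : (forall F : Cb R (FP R d k), `|iota F| = `|F|) ->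
  `|LM_ext Omega chi iota Omega h phi F| <= `|F|.
Proof.
move=> iotaN.
have mO : measurable (Omega : set (borel 'rV[R]_d)) by exact: open_borel.
set v := fine (mu (Omega : set (borel 'rV[R]_d))).
have v0 : 0 <= v by rewrite fine_ge0.
rewrite LM_extE normrM -/v ger0_norm ?invr_ge0//.
(* An empty Omega has volume 0, whose inverse is 0 by convention. *)
have [->|vn0] := eqVneq v 0; first by rewrite invr0 mul0r.
rewrite ler_pdivrMl ?lt_def ?vn0// mulrC.
apply: le_trans (le_normr_Rintegral mO (integrable_Cb_comp _)) _.
rewrite -[X in _ <= X](@Rintegral_cst _ _ _ mu _ mO).
apply: (le_Rintegral mO (integrable_norm (integrable_Cb_comp _)) (integrable_volume `|F|)).
by move=> x _; rewrite -iotaN; exact: Cb_norm_ub.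
Qed.

End local_measure_integral.

(** * The test functional and the limit measure *)

Section overshoot.
Context {R : realType} {d k : nat} (M : R).

Lemma FP_val_continuous : continuous (fun f : FP R d k => val f : Ck_space R d k).
Proof. exact: (@initial_continuous (FP R d k) (Ck_space R d k) val). Qed.

Definition overshoot (f : FP R d k) : R := Num.min 1 (Num.max 0 (`|val f 0| - M)).

Lemma overshoot_ge0 f : 0 <= overshoot f.
Proof. by rewrite le_min ler01 le_max lexx. Qed.

Lemma overshoot_le1 f : overshoot f <= 1.
Proof. by rewrite ge_min lexx. Qed.

Lemma overshoot_eq0 (f : FP R d k) : `|val f 0| <= M -> overshoot f = 0.
Proof. by move=> fM; rewrite /overshoot max_l ?subr_le0// min_r. Qed.

Lemma overshoot_gt0 (f : FP R d k) : M < `|val f 0| -> 0 < overshoot f.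
Proof. by move=> fM; rewrite lt_min ltr01 lt_max subr_gt0 fM orbT. Qed.

Lemma overshoot_bcont : overshoot \in @bcont R (FP R d k).
Proof.
rewrite inE; split; last first.
  exists 1; split; first exact: num_real.
  move=> r r1 f _ /=; rewrite ger0_norm ?overshoot_ge0//.
  by rewrite (le_trans (overshoot_le1 f))// ltW.
move=> f.
have ce : {for f, continuous (fun f : FP R d k => `|val f 0| + - M)}.
  apply: continuous_at_add; last exact: cst_continuous.
  have c1 := continuous_comp (@FP_val_continuous f) (@Ck_eval0_continuous R d k (val f)).
  exact: (continuous_comp c1 (@norm_continuous _ _ _)).
have cc (c : R) : {for f, continuous (cst c : FP R d k -> R)} by exact: cst_continuous.
exact: (@continuous_min _ _ (cst 1) _ f (cc 1)
  (@continuous_max _ _ (cst 0) _ f (cc 0) ce)).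
Qed.

Definition overshoot_Cb : Cb R (FP R d k) := MkCb overshoot_bcont.

(** A zero mean of the nonnegative overshoot would give |Psi 0| <= M almost surely, against
    [berry_field_gt0]. *)
Lemma berry_overshoot_gt0 {dT : measure_display} {T : measurableType dT}
    (P : probability T R) (Psi : 'rV[R]_d -> T -> R) (X : {mfun T >-> borel (FP R d k)}) :
  berry_field P Psi ->
  {ae P, forall w, Psi^~ w = val (X w : FP R d k) :> ('rV[R]_d -> R)} ->
  0 < \int[distribution P X]_f overshoot_Cb f.
Proof.
move=> PB XE; have [mY PY] := berry_field_gt0 M PB.
have mF : measurable_fun setT (fun f : borel (FP R d k) => (overshoot f)%:E).
  apply/measurable_EFinP.
  by apply: continuous_borel_measurable; have [] := CbP overshoot_Cb.
have mFX : measurable_fun setT (fun w => (overshoot (X w))%:E).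
  exact: (measurableT_comp mF (@measurable_funPT _ _ _ _ X)).
rewrite /Rintegral.
have F0 f : (0 <= (overshoot f)%:E)%E by rewrite lee_fin overshoot_ge0.
have IE : (\int[distribution P X]_f (overshoot f)%:E = \int[P]_w (overshoot (X w))%:E)%E.
  exact: ge0_integral_distribution mF F0.
(* [fine] sends an infinite integral to 0, so finiteness is checked along with positivity. *)
apply: fine_gt0; rewrite [X in (0 < X < _)%E]IE; apply/andP; split.
  rewrite lt_neqAle integral_ge0 ?andbT//; apply/eqP => /esym I0.
  have I0' : (\int[P]_w `|(overshoot (X w))%:E| = 0)%E.
    by rewrite -I0; apply: eq_integral => w _; rewrite gee0_abs.
  have /(ae_eq_integral_abs P measurableT mFX) Xae := I0'.
  have N : {ae P, forall w, ~ M < `|Psi 0 w|}.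
    apply: filterS2 Xae XE => w /(_ I) Xw PX.
    have -> : Psi 0 w = val (X w : FP R d k) 0 by rewrite -PX.
    by move=> /overshoot_gt0; move: Xw => /= -[->]; rewrite ltxx.
  have [A [mA A0 HA]] := N.
  have mM : measurable [set w | M < `|Psi 0 w|].
    rewrite (_ : [set w | _] = (fun w => `|Psi 0 w|) @^-1` `]M, +oo[).
      rewrite -[X in measurable X]setTI; apply: (measurableT_comp (@normr_measurable _ setT) mY) => //.
    by apply/seteqP; split => w; rewrite /= in_itv/= andbT.
  have : (P [set w | (M < `|Psi 0 w|)%R] <= P A)%E.
    apply: le_measure; rewrite ?inE//.
    by move=> w /= Mw; apply: HA => /=; exact.
  by rewrite A0 leNgt PY.
apply: (@le_lt_trans _ _ (\int[P]_w (cst 1%E) w)%E).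
  exact: (@ge0_le_integral _ _ _ P setT measurableT (fun w => (overshoot (X w))%:E) (cst 1%E)
    (fun w _ => F0 (X w)) mFX (measurable_cst _) (fun w _ => overshoot_le1 (X w))).
rewrite integral_cst// mul1e; apply: le_lt_trans (probability_le1 P measurableT) _.
exact: ltry.
Qed.

End overshoot.

Section accumulation.
Context {R : realType} {d k : nat}.
Context (Omega : set 'rV[R]_d) (chi : R -> R)
  (iota : {linear Cb R (FP R d k) -> Cb R (Ck_space R d k)})
  (h : nat -> R) (phi : nat -> 'rV[R]_d -> R) (A : set nat) (F : set_system nat).
Hypotheses (oO : open Omega) (bO : bounded_set Omega)
  (UF : UltraFilter F) (Foo : F --> \oo) (FA : F A)
  (iotaN : forall F : Cb R (FP R d k), `|iota F| = `|F| )
  (gC : forall n, A n -> forall x, Omega x ->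
    {for x, continuous (fun x => to_Ck k (rescaled Omega chi (h n) (phi n) x))}).

(* The limit along an ultrafilter replaces the Banach-Alaoglu theorem. *)
Lemma sigma_limit : exists2 L, sigma Omega chi iota Omega h phi L &
  forall G, LM_ext Omega chi iota Omega (h n) (phi n) G @[n --> F] --> L G.
Proof.
have /choice[L HL] : forall G, exists l : R,
    LM_ext Omega chi iota Omega (h n) (phi n) G @[n --> F] --> l.
  move=> G; apply: (@ultra_bounded_cvg _ _ _ _ (`|G|)) => //.
  apply: filterS FA => n An; apply: LM_ext_le => //; exact: gC.
exists L => //; split; last first.
  have cL : {ptws, (fun n => LM_ext Omega chi iota Omega (h n) (phi n)) @ F --> L}.
    by apply/pointwise_cvgP => G; exact: HL.
  (* F refines the tails and carries the functionals to [L], so both preimages are in F, and members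
     of F meet. *)
  move=> B C BF CL.
  have FB : F ((fun n => LM_ext Omega chi iota Omega (h n) (phi n)) @^-1` B) by exact: Foo.
  have FC : F ((fun n => LM_ext Omega chi iota Omega (h n) (phi n)) @^-1` C) by exact: cL.
  have [n [Bn Cn]] := @filter_ex _ F _ _ (filterI FB FC).
  by exists (LM_ext Omega chi iota Omega (h n) (phi n)).
(* Linearity and the norm bound hold for n in A only; as A belongs to F, they pass to the limit. *)
have Llin a (G H : Cb R (FP R d k)) : L (a *: G + H) = a * L G + L H.
  have c : LM_ext Omega chi iota Omega (h n) (phi n) (a *: G + H) @[n --> F] -->
      a * L G + L H.
    have : a * LM_ext Omega chi iota Omega (h n) (phi n) G +
      LM_ext Omega chi iota Omega (h n) (phi n) H @[n --> F] --> a * L G + L H.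
      by apply: cvgD; [apply: cvgM; [exact: cvg_cst|exact: HL]|exact: HL].
    apply: cvg_trans; apply: near_eq_cvg; apply: filterS FA => n An.
    by rewrite LM_ext_linear//; exact: gC.
  exact: (cvg_unique _ (HL _) c).
have Lle G : `|L G| <= `|G|.
  apply: cvgr_to_le (cvg_norm (HL G)) _.
  by apply: filterS FA => n An; apply: LM_ext_le => //; exact: gC.
split; first by move=> a G H; exact: Llin.
move=> G; apply/(@cvgrPdist_lt _ _ _ (nbhs G)) => e e0.
have := nbhsx_ballx G e e0; apply: filterS => H; rewrite -ball_normE /= => GH.
have -> : L G - L H = L (G - H).
  by have := Llin (-1) H G; rewrite scaleN1r mulN1r (addrC (- H)) (addrC (- L H)) => ->.
exact: le_lt_trans (Lle _) GH.
Qed.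

End accumulation.

Section vanishing.
Context {R : realType} {d k : nat}.
Context (Omega : set 'rV[R]_d) (chi : R -> R)
  (iota : {linear Cb R (FP R d k) -> Cb R (Ck_space R d k)})
  (h : nat -> R) (phi : nat -> 'rV[R]_d -> R) (M : R).
Hypotheses (d0 : (0 < d)%N) (oO : open Omega) (bO : bounded_set Omega)
  (h_gt0 : forall n, 0 < h n) (h_cvg0 : h n @[n --> \oo] --> 0)
  (sphi : forall n, smooth_on Omega (phi n))
  (ephi : forall n x, Omega x -> - (h n ^+ 2 * laplacian (phi n) x) = phi n x)
  (cchi : cutoff chi) (M0 : 0 < M) (iota_ext : extension_operator iota).

Let A : set nat := [set n | forall x, Omega x -> `|phi n x| <= M].
Local Notation mu := (lebesgue_rV d).

Let g n x := to_Ck k (rescaled Omega chi (h n) (phi n) x).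

Lemma to_Ck_rescaled_continuous_on n : A n -> forall x, Omega x -> {for x, continuous (g n)}.
Proof.
move=> An x Ox.
exact: (to_Ck_rescaled_continuous oO (sphi n) (h_gt0 n) (ephi n) d0 bO cchi M0 An).
Qed.

(** Otherwise the values are at least some e > 0 for infinitely many n in A. Along an ultrafilter on
    these n the rescaled functions converge to some f in [FP] with |f(0)| <= M; there [iota] returns
    the overshoot itself, which is 0, against continuity. *)
Lemma iota_overshoot_cvg0 x : Omega x ->
  (if n \in A then iota (overshoot_Cb M) (g n x) else 0) @[n --> \oo] --> (0 : R).
Proof.
move=> Ox; set u := (X in X @ _ --> _).
apply/(@cvgrPdist_lt _ _ _ \oo) => e e0; apply: contrapT => ncvg.
pose B := [set n | A n /\ e <= `|iota (overshoot_Cb M) (g n x)|].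
have nB : ~ (\forall n \near \oo, ~ B n).
  move=> H; apply: ncvg; apply: filterS H => n nBn; rewrite /u sub0r normrN.
  case: ifPn => [/set_mem An|_]; last by rewrite normr0.
  by rewrite ltNge; apply/negP => eB; exact: nBn.
have [F [UF Foo FB]] := ultra_of_frequently nB.
have FA : \forall n \near F, forall x, Omega x -> `|phi n x| <= M.
  by apply: filterS FB => n [].
have [f fM gf] := rescaled_limit k d0 oO bO h_gt0 h_cvg0 sphi ephi cchi M0 UF Ox Foo FA.
have [cF _] := CbP (iota (overshoot_Cb M)).
have [_ ext _] := iota_ext.
have c : iota (overshoot_Cb M) (g n x) @[n --> F] --> iota (overshoot_Cb M) (val f).
  exact: (cvg_comp _ _ gf (cF (val f))).
have e0' : e <= `|iota (overshoot_Cb M) (val f)|.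
  by apply: cvgr_to_ge (cvg_norm c) _; apply: filterS FB => n [].
move: e0'; rewrite ext /= overshoot_eq0// normr0; apply/negP; by rewrite -ltNge.
Qed.

(** The integrands [u n], set to 0 off A, converge along all integers and are dominated by a
    constant on a set of finite volume; on A, a member of F, they are the actual ones. *)
Lemma LM_ext_overshoot_cvg0 (F : set_system nat) {UF : UltraFilter F} : F --> \oo -> F A ->
  LM_ext Omega chi iota Omega (h n) (phi n) (overshoot_Cb M) @[n --> F] --> (0 : R).
Proof.
move=> Foo FA.
have mO : measurable (Omega : set (borel 'rV[R]_d)) by exact: open_borel.
pose u n (x : borel 'rV[R]_d) : R := if n \in A then iota (overshoot_Cb M) (g n x) else 0.
have mu_ n : measurable_fun (Omega : set (borel 'rV[R]_d)) (fun x => (u n x)%:E).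
  apply/measurable_EFinP; have [An|nAn] := pselect (A n).
    rewrite (_ : u n = fun x => iota (overshoot_Cb M) (g n x)); last first.
      by apply/funext => x; rewrite /u mem_set.
    by apply: measurable_Cb_comp => //; exact: to_Ck_rescaled_continuous_on.
  rewrite (_ : u n = cst 0); first exact: measurable_cst.
  by apply/funext => x; rewrite /u memNset.
have iK := integrable_volume oO bO `|iota (overshoot_Cb M)|.
have [||_ _ cu] := dominated_convergence mO mu_ (measurable_cst 0%E) _ iK.
- apply: aeW => x Ox; apply/cvg_EFin; first exact: nearW.
  exact: iota_overshoot_cvg0.
- apply: aeW => x n Ox; rewrite lee_fin /u; case: ifPn => _; last by rewrite normr0.
  exact: Cb_norm_ub.
have cR : \int[mu]_(x in Omega) (u n x) @[n --> \oo] --> (0 : R).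
  by move: cu; rewrite integral_cst// mul0e => /fine_cvg.
have cF : (fine (mu (Omega : set (borel 'rV[R]_d))))^-1 * \int[mu]_(x in Omega) (u n x)
    @[n --> F] --> (0 : R).
  rewrite -(mulr0 (fine (mu (Omega : set (borel 'rV[R]_d))))^-1).
  apply: cvgM; first exact: cvg_cst.
  by apply: cvg_trans cR; exact: cvg_app.
apply: cvg_trans cF; apply: near_eq_cvg; apply: filterS FA => n An.
rewrite LM_extE//; last exact: to_Ck_rescaled_continuous_on.
by congr (_ * _); apply: eq_Rintegral => x _; rewrite /u mem_set.
Qed.

End vanishing.

Theorem mainTheorem9 (R : realType) (d : nat) (hd : (0 < d)%N)
  (Omega : set 'rV[R]_d) (openOmega : open Omega)
  (boundedOmega : bounded_set Omega)
  (phi : nat -> 'rV[R]_d -> R) (h : nat -> R)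
  (h_gt0 : forall n, 0 < h n)
  (h_cvg0 : h n @[n --> \oo] --> 0)
  (phi_smooth : forall n, smooth_on Omega (phi n))
  (phi_eigen : forall n x, Omega x -> - (h n ^+ 2 * laplacian (phi n) x) = phi n x)
  (phi_dirichlet : forall n, in_H10 Omega (phi n))
  (phi_norm : forall n,
    (\int[lebesgue_rV d]_(x in Omega) (phi n x ^+ 2)%:E = lebesgue_rV d Omega)%E)
  (phi_orthogonal : forall m n, m <> n ->
    (\int[lebesgue_rV d]_(x in Omega) (phi m x * phi n x)%:E = 0)%E)
  (chi : R -> R) (chi_cutoff : cutoff chi)
  (k : nat) (iota : {linear Cb R (FP R d k) -> Cb R (Ck_space R d k)})
  (iota_ext : extension_operator iota)
  (* X is a random element of FP which is almost surely equal to the field Psi: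
     its distribution is mu_Berry *)
  (dT : measure_display) (T : measurableType dT) (P : probability T R)
  (Psi : 'rV[R]_d -> T -> R) (Psi_berry : berry_field P Psi)
  (X : {mfun T >-> borel (FP R d k)})
  (XE : {ae P, forall w, Psi^~ w = val (X w : FP R d k) :> ('rV[R]_d -> R)}) :
  sigma Omega chi iota Omega h phi =
    [set fun F : Cb R (FP R d k) => \int[distribution P X]_f F f] ->
  ('N[lebesgue_rV d]_+oo[EFin \o (phi n \_ Omega)] @[n --> \oo] --> +oo)%E.
Proof.
move=> sigmaE; apply/cvgeyPger => B _; apply: contrapT => nB.
(* The maximum with 1 supplies the positivity of M that the interior estimates require. *)
pose M := Num.max 1 B; have M0 : 0 < M by rewrite lt_max ltr01.
pose A : set nat := [set n | forall x, Omega x -> `|phi n x| <= M].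
(* For n outside A the norm is at least B, so a tail disjoint from A would contradict the choice of
   B. *)
have nA : ~ (\forall n \near \oo, ~ A n).
  move=> H; apply: nB; apply: filterS H => n nAn.
  rewrite leNgt; apply/negP => NB; apply: nAn.
  apply: (@Lnorm_oo_le R d Omega (phi n) M openOmega).
    by move=> x Ox; have [] := phi_smooth n 0%N [::] (leqnn _) x Ox.
  by rewrite (le_trans (ltW NB))// lee_fin le_max lexx orbT.
have [F [UF Foo FA]] := ultra_of_frequently nA.
have [_ _ iotaN] := iota_ext.
have [L LS HL] := @sigma_limit R d k Omega chi iota h phi A F openOmega boundedOmega UF Foo FA iotaN
  (to_Ck_rescaled_continuous_on hd openOmega boundedOmega h_gt0 phi_smooth phi_eigen chi_cutoff M0).
have L0 : L (overshoot_Cb M) = 0.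
  apply: (cvg_unique _ (HL (overshoot_Cb M))) => //.
  exact: LM_ext_overshoot_cvg0.
have LE : L = fun F : Cb R (FP R d k) => \int[distribution P X]_f F f.
  by move: LS; rewrite sigmaE.
have := berry_overshoot_gt0 M Psi_berry XE.
by rewrite -[X in 0 < X](congr1 (fun l => l (overshoot_Cb M)) LE) L0 ltxx.
Qed.
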